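(* Let $p$ be an odd prime and let $\Gamma \subseteq \mathbb{F}_p^*$ be a multiplicative subgroup. Then for every integer $k\ge 1$ one has $$0\le \mathsf{T}^{+}_{2^k} (\Gamma) - \frac{|\Gamma|^{2^{k+1}}}{p} \le 2^{3k^2} (C_* \log^4 p)^{k-1} \cdot |\Gamma|^{2^{k+1} - \frac{(k+7)}{2}}\, \mathsf{T}^{+}_2 (\Gamma),$$ where $C_* >0$ is an absolute constant.
   Context: $\mathbb{F}_p=\mathbb{Z}/p\mathbb{Z}$, $\mathbb{F}_p^*=\mathbb{F}_p\setminus\{0\}$. For a set $A\subseteq \mathbb{F}_p$ and an integer $k\ge1$, $\mathsf{T}^{+}_k(A)$ denotes the number of tuples $(a_1,\dots,a_k,a'_1,\dots,a'_k)\in A^{2k}$ with $a_1+\dots+a_k=a'_1+\dots+a'_k$. All logarithms are to base $2$. *)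

(* Defs.v *)
From HB Require Import structures.
From mathcomp Require Import all_boot all_order all_algebra all_fingroup.
From mathcomp Require Import all_classical all_reals all_analysis.

Set Implicit Arguments.
Unset Strict Implicit.
Unset Printing Implicit Defensive.

Import Order.TTheory GRing.Theory Num.Theory.
Local Open Scope ring_scope.

Definition log2 (R : realType) (x : R) : R := ln x / ln 2.

(* T^+_k(A). The 2k-tuple is split into its two halves, the pair of
   k-tuples x.1 = (a_1, ..., a_k) and x.2 = (a'_1, ..., a'_k). *)
Definition Tplus (p k : nat) (A : {set 'F_p}) : nat :=
  #|[set x : {ffun 'I_k -> 'F_p} * {ffun 'I_k -> 'F_p} |
      [&& [forall i, x.1 i \in A], [forall i, x.2 i \in A]
        & \sum_i x.1 i == \sum_i x.2 i]]|.

(* A subgroup of the unit group, seen as a subset of the field. *)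
Definition unit_set (p : nat) (G : {set {unit 'F_p}}) : {set 'F_p} :=
  [set FinRing.uval u | u in G].

(* Main.v *)
(* Let rho be the 2^(k-1)-fold representation function of Gamma. The excess
   T_{2^k} - |Gamma|^(2^(k+1)) / p is the additive energy of rho - mean rho, a
   function constant on the orbits of Gamma. Cutting it into level sets and
   applying Minkowski to the fourth root of the energy and Hoelder to the sum over
   levels, it is enough to know that the centred energy of every Gamma-invariant
   set B is O(|B|^3 / |Gamma|^(1/2)); the step from k - 1 to k then
   costs a factor O(|Gamma|^(2^k - 1/2) 2^k log p).

   By invariance, for all c, c' in Gamma the energy of B counts the solutions of
   a - a' = c b' - c' b in B, which says that the rays (a, c, b) and (a', c', b')
   meet, where (a, c, b) is the line {x + c y = a, y + c z = b}; its direction lies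
   on a fixed conic. If there are more than p^2 rays, averaging over all dilations
   suffices. Otherwise the polynomial method applies. If N red and N blue rays
   meet more than a large multiple of N^(3/2) times, then a polynomial F of low
   degree vanishing on a few red rays vanishes on most blue ones. On a prime factor
   of F, both null directions are asymptotic wherever a red and a blue ray
   cross, so an explicit polynomial Psi vanishes there. Either F does not divide
   Psi, and Bezout (through a resultant) bounds the number of rays lying on both
   surfaces; or F divides Psi, and along each blue ray the inverse of the direction
   of the crossing red ray, relative to that of the blue one, is an affine
   function of the parameter, which allows few crossings. *)

From HB Require Import structures.
Require Import Defs.
From mathcomp Require Import all_boot all_order all_algebra all_fingroup.
From mathcomp Require Import all_classical all_reals all_analysis.
From mathcomp Require Import fintype finset ring lra zify.

Set Implicit Arguments.
Unset Strict Implicit.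
Unset Printing Implicit Defensive.

Import Order.TTheory GRing.Theory Num.Theory.
Local Open Scope ring_scope.

(** * Unique factorisation in polynomial rings *)

(** Three obstacles shape the incidence argument. Degrees bound the number of crossing points, but
    several rays may pass through one point. The two colours are therefore scaled by different
    powers of an indeterminate [t] over F_p: this preserves a - a' = c b' - c' b and separates the
    crossings on each ray, except those with a = a', which are few and discarded. Next, derivatives
    lose information in characteristic p, so degrees must stay well below p. The interpolation
    degree is a small fraction of the square root of the number of rays, whence the threshold of p^2
    rays, beyond which averaging is strong enough. Finally, Bezout has to count common rays, not
    points. A ray is parametrised by Z, so its X-coordinate lies in k[Z], and common rays give roots
    in k[Z] of a resultant, a polynomial in X. Distinct rays must then have distinct X-coordinates,
    which the shear X = x + s y provides for generic s. Prime factors are taken in k[Z][X][Y], where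
    non-divisibility by a prime makes the resultant nonzero. *)

Definition dvdr (R : idomainType) (a b : R) := exists c, b = a * c.

Definition prime_elt (R : idomainType) (a : R) :=
  [/\ a != 0, a \isn't a GRing.unit
    & forall b c, dvdr a (b * c) -> dvdr a b \/ dvdr a c].

Definition factorial_dom (R : idomainType) := forall a : R, a != 0 ->
  exists (u : R) (s : seq R), [/\ u \is a GRing.unit,
    forall x, x \in s -> prime_elt x & a = u * \prod_(x <- s) x].

Lemma factorial_field (k : fieldType) : factorial_dom k.
Proof.
move=> a a0; exists a, [::]; rewrite unitfE a0 big_nil mulr1.
by split.
Qed.

Section Divisibility.

Variable R : idomainType.
Implicit Types (a b c p : R).

Lemma dvdrr a : dvdr a a. Proof. by exists 1; rewrite mulr1. Qed.

Lemma dvdr_mulr a b c : dvdr a b -> dvdr a (b * c).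
Proof. by case=> d ->; exists (d * c); rewrite mulrA. Qed.

Lemma dvdr_mull a b c : dvdr a c -> dvdr a (b * c).
Proof. by rewrite mulrC; exact: dvdr_mulr. Qed.

Lemma dvdr_trans b a c : dvdr a b -> dvdr b c -> dvdr a c.
Proof. by case=> d -> [e ->]; exists (d * e); rewrite mulrA. Qed.

Lemma prime_dvd_unit p u : prime_elt p -> u \is a GRing.unit -> ~ dvdr p u.
Proof.
by case=> _ /negP pU _ uU [c uE]; apply: pU; move: uU; rewrite uE unitrM => /andP[].
Qed.

Lemma prime_dvd_prod p s : prime_elt p -> dvdr p (\prod_(x <- s) x) ->
  exists2 x, x \in s & dvdr p x.
Proof.
move=> pp; elim: s => [|x s IHs]; rewrite ?big_nil ?big_cons.
  by move/(prime_dvd_unit pp (unitr1 _)).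
have [_ _ pP] := pp; case/pP => [px|/IHs[y ys py]].
  by exists x; rewrite ?mem_head.
by exists y; rewrite // inE ys orbT.
Qed.

Lemma prime_associate p x : prime_elt p -> prime_elt x -> dvdr p x ->
  exists2 v, v \is a GRing.unit & x = p * v.
Proof.
move=> [p0 pU pP] [x0 xU xP] [v xE]; exists v => //.
have : dvdr x (p * v) by rewrite -xE; exact: dvdrr.
case/xP=> -[w].
  move=> pE; have : 1 * p = (w * v) * p by rewrite {1}pE xE; ring.
  move/(mulIf p0) => wv; have : 1 \is a @GRing.unit R := unitr1 _.
  by rewrite wv unitrM => /andP[].
move=> vE; have v0 : v != 0 by apply: contraNneq x0 => v0; rewrite xE v0 mulr0.
have : 1 * v = (p * w) * v by rewrite {1}vE xE; ring.
move/(mulIf v0) => wv; have : 1 \is a @GRing.unit R := unitr1 _.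
by rewrite wv unitrM => /andP[]; rewrite (negPf pU).
Qed.

End Divisibility.

Section Factorial.

Variable R : idomainType.
Implicit Types (a b c p : R) (f g h q : {poly R}).

Lemma dvdr_polyCP c f : dvdr c%:P f <-> forall i, dvdr c f`_i.
Proof.
split=> [[g ->] i|]; first by exists g`_i; rewrite coefCM.
elim/poly_ind: f => [|f a IHf] cf; first by exists 0; rewrite mulr0.
have [i|g fE] := IHf.
  by have := cf i.+1; rewrite coefD coefMX coefC /= addr0.
have := cf 0; rewrite coefD coefMX coefC /= add0r => -[d ->].
by exists (g * 'X + d%:P); rewrite mulrDr mulrA -fE polyCM.
Qed.

(** Gauss's lemma by induction on the two sizes: [c] divides the product of the constant
    coefficients, hence one of them, and the corresponding factor can be replaced by its quotient by
    ['X]. *)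
Lemma prime_polyC c : prime_elt c -> prime_elt c%:P.
Proof.
move=> [c0 cU cP]; split; rewrite ?polyC_eq0 //.
  by rewrite poly_unitE size_polyC c0 coefC eqxx.
have dP q : q != 0 -> exists (q' : {poly R}) d, q = q' * 'X + d%:P /\ (size q' < size q)%N.
  elim/poly_ind: q => [/eqP//|q d _ q0]; exists q, d; split=> //.
  rewrite size_MXaddC; case: eqP => [qE|//]; case: eqP => [dE|//].
  by move: q0; rewrite qE dE mul0r add0r polyC0 eqxx.
have low (f g q : {poly R}) a : f = q * 'X + a%:P -> dvdr c a ->
    dvdr c%:P (f * g) -> dvdr c%:P (q * g).
  move=> -> [d ->] cfg; apply/dvdr_polyCP => i.
  have : dvdr c%:P (q * g * 'X).
    have -> : q * g * 'X = (q * 'X + (c * d)%:P) * g - c%:P * (d%:P * g).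
      by rewrite polyCM; ring.
    by case: cfg => e ->; exists (e - d%:P * g); rewrite mulrBr.
  by move/dvdr_polyCP/(_ i.+1); rewrite coefMX.
have up (f q : {poly R}) a : f = q * 'X + a%:P -> dvdr c a -> dvdr c%:P q -> dvdr c%:P f.
  by move=> -> [d ->] [e ->]; exists (e * 'X + d%:P); rewrite polyCM; ring.
move=> f g; have [n] := ubnP (size f + size g).
elim: n f g => // n IHn f g.
have [->|f0] := eqVneq f 0; first by left; exists 0; rewrite mulr0.
have [->|g0] := eqVneq g 0; first by right; exists 0; rewrite mulr0.
have [f1 [a [fE sf]]] := dP f f0; have [g1 [b [gE sg]]] := dP g g0.
move=> ltn cfg.
have : dvdr c (a * b).
  have /dvdr_polyCP/(_ 0%N) := cfg.
  by rewrite fE gE coef0M !coefD !coefMX !coefC /= !add0r.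
case/cP=> cd.
- have [||cf1|] // := IHn f1 g; [lia|exact: low fE cd cfg| |by right].
  by left; apply: up fE cd cf1.
- have [|||cg1] // := IHn f g1; [lia| |by left|].
    by rewrite mulrC; apply: low gE cd _; rewrite mulrC.
  by right; apply: up gE cd cg1.
Qed.

Definition primitive f := forall p, prime_elt p -> ~ dvdr p%:P f.

Hypothesis facR : factorial_dom R.

(** Induction on the number of primes in the leading coefficient: each prime pulled out of [f] uses
    up one of them, up to a unit. *)
Lemma content_primitive f : f != 0 -> exists (s : seq R) g,
  [/\ forall x, x \in s -> prime_elt x, primitive g & f = (\prod_(x <- s) x)%:P * g].
Proof.
move=> f0; have [|u [s [uU sP fE]]] := facR (a := lead_coef f); first by rewrite lead_coef_eq0.
have [n] := ubnP (size s); elim: n => // n IHn in f f0 u s uU sP fE *.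
move=> ltn; have [fP|/existsNP[p /not_implyP[pp /contrapT[g gE]]]] := pselect (primitive f).
  by exists [::], f; rewrite big_nil mul1r.
have g0 : g != 0 by apply: contraNneq f0 => g0; rewrite gE g0 mulr0.
have lE : p * lead_coef g = u * \prod_(x <- s) x by rewrite -fE gE lead_coefM lead_coefC.
have [_ _ pP] := (pp : prime_elt p).
have : dvdr p (u * \prod_(x <- s) x) by exists (lead_coef g).
case/pP=> [/(prime_dvd_unit pp uU)//|/(prime_dvd_prod pp)[x xs px]].
have [v vU xE] := prime_associate pp (sP _ xs) px.
have [||||s' [h [s'P hP ghE]]] := IHn g g0 (u * v) (rem x s).
- by rewrite unitrM uU.
- by move=> y /mem_rem; exact: sP.
- have p0 : p != 0 by case: pp.
  apply: (mulIf p0); rewrite mulrC lE (perm_big _ (perm_to_rem xs)) /= big_cons {1}xE; ring.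
- by rewrite size_rem //; case: (s) xs ltn.
exists (p :: s'), h; split=> //.
  by move=> y; rewrite inE => /predU1P[->|/s'P].
by rewrite big_cons gE ghE polyCM mulrA.
Qed.

Lemma primitive_dvd f g : primitive f -> dvdr g f -> primitive g.
Proof. by move=> fP gf p pp pg; apply: (fP p pp); apply: dvdr_trans gf. Qed.

(** Turns a factorisation over the fraction field into one over [R]: the primes of [c] are cancelled
    one at a time, each from [g] or from [h]. Keeping the sizes lets irreducibility of [f] be
    applied to the result. *)
Lemma clear_denominator (c : R) f g h : c != 0 -> c%:P * f = g * h ->
  exists g' h', [/\ f = g' * h', size g' = size g & size h' = size h].
Proof.
move=> c0; have [u [s [uU sP ->]]] := facR c0.
elim: s sP f g h => [|p s IHs] sP f g h.
  rewrite big_nil mulr1 => fE; exists (u^-1%:P * g), h; split=> //.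
    by rewrite -mulrA -fE mulrA -polyCM mulVr // mul1r.
  by rewrite size_Cmul // invr_eq0; apply: contraTneq uU => ->; rewrite unitr0.
rewrite big_cons => fE.
have pp : prime_elt p by apply: sP; rewrite mem_head.
have ss x : x \in s -> prime_elt x by move=> xs; apply: sP; rewrite inE xs orbT.
have [pP0 pPU pPP] := prime_polyC pp.
have p0 : p != 0 by case: pp.
have : dvdr p%:P (g * h).
  by rewrite -fE; exists ((u * \prod_(x <- s) x)%:P * f); rewrite !polyCM; ring.
have key e1 e2 : g * h = p%:P * (e1 * e2) -> (u * \prod_(x <- s) x)%:P * f = e1 * e2.
  by rewrite -fE => E; apply: (mulIf pP0); rewrite mulrC [RHS]mulrC -E !polyCM; ring.
case/pPP=> -[e eE].
  have [|g' [h' [-> sg sh]]] := IHs ss f e h; first by apply: key; rewrite eE; ring.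
  by exists g', h'; split=> //; rewrite sg eE size_Cmul.
have [|g' [h' [-> sg sh]]] := IHs ss f g e; first by apply: key; rewrite eE; ring.
by exists g', h'; split=> //; rewrite sh eE size_Cmul.
Qed.

Lemma clear_denominator_primitive (c : R) f g h : primitive f -> c != 0 ->
  c%:P * g = f * h -> dvdr f g.
Proof.
move=> fP c0; have [u [s [uU sP ->]]] := facR c0.
elim: s sP h => [|p s IHs] sP h.
  rewrite big_nil mulr1 => fE; exists (u^-1%:P * h).
  by rewrite mulrCA -fE mulrA -polyCM mulVr // mul1r.
rewrite big_cons => fE.
have pp : prime_elt p by apply: sP; rewrite mem_head.
have ss x : x \in s -> prime_elt x by move=> xs; apply: sP; rewrite inE xs orbT.
have [pP0 pPU pPP] := prime_polyC pp.
have : dvdr p%:P (f * h).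
  by rewrite -fE; exists ((u * \prod_(x <- s) x)%:P * g); rewrite !polyCM; ring.
case/pPP=> [/(fP p pp)//|[e eE]].
apply: (IHs ss e); apply: (mulIf pP0).
have -> : f * e * p%:P = f * h by rewrite eE; ring.
by rewrite -fE !polyCM; ring.
Qed.

(** The gcd of [f] and [g] over the fraction field yields a factorisation of [f]. If the gcd is
    constant, [f] divides a constant multiple of [h]; if the cofactor is constant, one of [g].
    Primitivity of [f] removes the constant. *)
Lemma primitive_irreducible_prime f : primitive f -> (1 < size f)%N ->
  (forall g h, f = g * h -> size g = 1%N \/ size h = 1%N) -> prime_elt f.
Proof.
move=> fP sf firr; have f0 : f != 0 by rewrite -size_poly_gt0; lia.
split=> // [|g h [q qE]].
  by rewrite poly_unitE negb_and; apply/orP; left; rewrite neq_ltn sf orbT.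
have dvdpE (a b : {poly R}) : a %| b -> exists (c : R) (q : {poly R}), c != 0 /\ c%:P * b = a * q.
  move=> /Pdiv.Idomain.dvdpP[[c q'] /= c0 E]; exists c, q'; split=> //.
  by rewrite mul_polyC E mulrC.
set d := gcdp f g.
have [c [f' [c0 cE]]] := dvdpE _ _ (dvdp_gcdl f g : d %| f).
have [c' [g' [c'0 c'E]]] := dvdpE _ _ (dvdp_gcdr f g : d %| g).
have [d1 [f1 [fE sd1 sf1]]] := clear_denominator c0 cE.
have [sd|sf1'] := firr _ _ fE.
- have cop : coprimep f g by rewrite coprimep_def -/d -sd1 sd.
  right; have : f %| g * h by rewrite qE dvdp_mulr.
  rewrite Gauss_dvdpr // => /dvdpE[e [r [e0 eE]]].
  exact: clear_denominator_primitive eE.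
- left; have /eqP/size_poly1P[v v0 vE] : size f' = 1%N by rewrite -sf1.
  apply: (@clear_denominator_primitive (v * c') _ _ (c%:P * g')) => //.
    by rewrite mulf_neq0.
  rewrite polyCM -mulrA c'E -vE mulrA [f' * d]mulrC -cE; ring.
Qed.

Lemma primitive_factorial f : primitive f -> f != 0 ->
  exists (u : {poly R}) s, [/\ u \is a GRing.unit,
    forall x, x \in s -> prime_elt x & f = u * \prod_(x <- s) x].
Proof.
have [n] := ubnP (size f); elim: n f => // n IHn f ltn fP f0.
have [sf|sf] := leqP (size f) 1.
  have /size_poly1P[v v0 vE] : size f == 1%N.
    by rewrite eqn_leq sf size_poly_gt0.
  have [u [[|p s] [uU sP vE']]] := facR v0.
    exists f, [::]; rewrite big_nil mulr1 vE; split=> //.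
    by rewrite poly_unitE size_polyC v0 coefC eqxx vE' big_nil mulr1 uU.
  case: (fP p); first by apply: sP; rewrite mem_head.
  exists ((u * \prod_(x <- s) x)%:P); rewrite vE vE' big_cons -polyCM; congr (_%:P); ring.
have [|/existsNP[g /existsNP[h /not_implyP[fE /not_orP[sg sh]]]]] :=
    pselect (forall g h, f = g * h -> size g = 1%N \/ size h = 1%N).
  move=> firr; exists 1, [:: f]; rewrite unitr1 big_seq1 mul1r; split=> // x.
  by rewrite inE => /eqP ->; exact: primitive_irreducible_prime.
have g0 : g != 0 by apply: contraNneq f0 => g0; rewrite fE g0 mul0r.
have h0 : h != 0 by apply: contraNneq f0 => h0; rewrite fE h0 mulr0.
have sfE : size f = (size g + size h).-1 by rewrite fE size_mul.
have := size_poly_gt0 g; have := size_poly_gt0 h; rewrite g0 h0 => shp sgp.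
have [|||u [s [uU sP gE]]] // := IHn g; [lia| |].
  by apply: primitive_dvd fP _; rewrite fE; exact/dvdr_mulr/dvdrr.
have [|||v [t [vU tP hE]]] // := IHn h; [lia| |].
  by apply: primitive_dvd fP _; rewrite fE; exact/dvdr_mull/dvdrr.
exists (u * v), (s ++ t); rewrite unitrM uU vU; split=> //.
  by move=> x; rewrite mem_cat => /orP[/sP|/tP].
by rewrite big_cat /= fE gE hE; ring.
Qed.

Lemma factorial_poly : factorial_dom {poly R}.
Proof.
move=> f f0; have [s [g [sP gP fE]]] := content_primitive f0.
have [|u [t [uU tP gE]]] := primitive_factorial gP.
  by apply: contraNneq f0 => g0; rewrite fE g0 mulr0.
exists u, ([seq x%:P | x <- s] ++ t); split=> //.
  move=> x; rewrite mem_cat => /orP[/mapP[y /sP yp ->]|/tP//].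
  exact: prime_polyC.
rewrite big_cat /= big_map fE gE rmorph_prod /=; ring.
Qed.

End Factorial.

(** * Polynomials in three variables *)

Section Derivation.

Variables (R : comNzRingType) (d : {additive R -> R}).
Hypothesis dM : forall x y, d (x * y) = d x * y + x * d y.

Lemma map_derivM (F G : {poly R}) :
  map_poly d (F * G) = map_poly d F * G + F * map_poly d G.
Proof.
apply/polyP => i; rewrite coef_map_id0 ?raddf0 // coefD !coefM raddf_sum -big_split /=.
by apply: eq_bigr => j _; rewrite dM !coef_map_id0 ?raddf0.
Qed.

(** The chain rule when [d] moves both the point and the coefficients. *)
Lemma map_deriv_horner (F : {poly R}) c :
  d F.[c] = d c * F^`().[c] + (map_poly d F).[c].
Proof.
elim/poly_ind: F => [|F a IHF]; first by rewrite deriv0 !raddf0 !horner0 raddf0; ring.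
rewrite hornerMXaddC derivMXaddC !raddfD /= dM IHF.
have -> : map_poly d (F * 'X) = map_poly d F * 'X.
  apply/polyP => i; rewrite !coef_map_id0 ?raddf0 // !coefMX; case: eqP => _.
    by rewrite raddf0.
  by rewrite coef_map_id0 ?raddf0.
have -> : map_poly d a%:P = (d a)%:P.
  apply/polyP => i; rewrite !coef_map_id0 ?raddf0 // !coefC; case: eqP => // _.
  by rewrite raddf0.
by rewrite !(hornerD, hornerM, hornerX, hornerC); ring.
Qed.

End Derivation.

(* Locked, so that rewriting with the rules for [polyC] leaves constants alone. *)
HB.lock Definition kc (k : fieldType) (c : k) : {poly {poly {poly k}}} := c%:P%:P%:P.

Section Poly3.

Variable k : fieldType.
Notation P3 := {poly {poly {poly k}}}.
Implicit Types (F G : P3) (xi eta : {poly k}).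

(* The outer indeterminate is Y, the middle one X, the inner one Z. *)
Definition dY F : P3 := F^`().
Definition dX F : P3 := map_poly (@deriv {poly k}) F.
Definition dZ F : P3 := map_poly (map_poly (@deriv k)) F.

Fact dX_is_zmod_morphism : zmod_morphism dX. Proof. exact: raddfB. Qed.
Fact dY_is_zmod_morphism : zmod_morphism dY. Proof. exact: raddfB. Qed.
Fact dZ_is_zmod_morphism : zmod_morphism dZ. Proof. exact: raddfB. Qed.
HB.instance Definition _ := GRing.isZmodMorphism.Build P3 P3 dX dX_is_zmod_morphism.
HB.instance Definition _ := GRing.isZmodMorphism.Build P3 P3 dY dY_is_zmod_morphism.
HB.instance Definition _ := GRing.isZmodMorphism.Build P3 P3 dZ dZ_is_zmod_morphism.

Lemma dXD : {morph dX : F G / F + G}. Proof. exact: raddfD. Qed.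
Lemma dYD : {morph dY : F G / F + G}. Proof. exact: raddfD. Qed.
Lemma dZD : {morph dZ : F G / F + G}. Proof. exact: raddfD. Qed.
Lemma dX0 : dX 0 = 0. Proof. exact: raddf0. Qed.
Lemma dY0 : dY 0 = 0. Proof. exact: raddf0. Qed.
Lemma dZ0 : dZ 0 = 0. Proof. exact: raddf0. Qed.
Lemma dXN : {morph dX : F / - F}.
Proof. by move=> F; apply/eqP; rewrite -subr_eq0 opprK -dXD addNr dX0. Qed.
Lemma dYN : {morph dY : F / - F}.
Proof. by move=> F; apply/eqP; rewrite -subr_eq0 opprK -dYD addNr dY0. Qed.
Lemma dZN : {morph dZ : F / - F}.
Proof. by move=> F; apply/eqP; rewrite -subr_eq0 opprK -dZD addNr dZ0. Qed.

Lemma coef_dX F j i l : (dX F)`_j`_i`_l = F`_j`_i.+1`_l *+ i.+1.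
Proof. by rewrite coef_map_id0 ?deriv0 // coef_deriv coefMn. Qed.
Lemma coef_dY F j i l : (dY F)`_j`_i`_l = F`_j.+1`_i`_l *+ j.+1.
Proof. by rewrite coef_deriv !coefMn. Qed.
Lemma coef_dZ F j i l : (dZ F)`_j`_i`_l = F`_j`_i`_l.+1 *+ l.+1.
Proof. by rewrite !coef_map_id0 ?raddf0 // coef_deriv. Qed.

Lemma poly3P F G : (forall j i l, F`_j`_i`_l = G`_j`_i`_l) -> F = G.
Proof. by move=> FG; apply/polyP => j; apply/polyP => i; apply/polyP => l. Qed.

Lemma dXY F : dX (dY F) = dY (dX F).
Proof.
by apply: poly3P => j i l; rewrite !(coef_dX, coef_dY) -!mulrnA mulnC.
Qed.
Lemma dZX F : dZ (dX F) = dX (dZ F).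
Proof. by apply: poly3P => j i l; rewrite !(coef_dX, coef_dZ) -!mulrnA mulnC. Qed.
Lemma dZY F : dZ (dY F) = dY (dZ F).
Proof. by apply: poly3P => j i l; rewrite !(coef_dZ, coef_dY) -!mulrnA mulnC. Qed.

Lemma dYM F G : dY (F * G) = dY F * G + F * dY G. Proof. exact: derivM. Qed.
Lemma dXM F G : dX (F * G) = dX F * G + F * dX G.
Proof. by apply: map_derivM; exact: derivM. Qed.
Lemma dZM F G : dZ (F * G) = dZ F * G + F * dZ G.
Proof. by do 2!apply: map_derivM => ? ?; exact: derivM. Qed.

Lemma dX_kc (c : k) : dX (kc c) = 0.
Proof. by rewrite /dX kc.unlock map_polyC /= derivC. Qed.
Lemma dY_kc (c : k) : dY (kc c) = 0.
Proof. by rewrite /dY kc.unlock derivC. Qed.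
Lemma dZ_kc (c : k) : dZ (kc c) = 0.
Proof. by rewrite /dZ kc.unlock map_polyC /= (map_polyC (@deriv k)) /= derivC. Qed.
Lemma dXkc c F : dX (kc c * F) = kc c * dX F.
Proof. by rewrite dXM dX_kc mul0r add0r. Qed.
Lemma dYkc c F : dY (kc c * F) = kc c * dY F.
Proof. by rewrite dYM dY_kc mul0r add0r. Qed.
Lemma dZkc c F : dZ (kc c * F) = kc c * dZ F.
Proof. by rewrite dZM dZ_kc mul0r add0r. Qed.

(** Restriction to the curve X = [xi], Y = [eta]; the inner indeterminate Z remains as the parameter
    of the curve. *)
Definition ev xi eta F : {poly k} := F.[eta%:P].[xi].

Fact ev_is_zmod_morphism xi eta : zmod_morphism (ev xi eta).
Proof. by move=> F G; rewrite /ev !hornerE. Qed.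
Fact ev_is_monoid_morphism xi eta : monoid_morphism (ev xi eta).
Proof. by split=> [|F G]; rewrite /ev ?hornerE // !hornerE. Qed.
HB.instance Definition _ xi eta :=
  GRing.isZmodMorphism.Build P3 {poly k} (ev xi eta) (ev_is_zmod_morphism xi eta).
HB.instance Definition _ xi eta :=
  GRing.isMonoidMorphism.Build P3 {poly k} (ev xi eta) (ev_is_monoid_morphism xi eta).

Lemma ev_kc xi eta c : ev xi eta (kc c) = c%:P.
Proof. by rewrite /ev kc.unlock !hornerC. Qed.

Lemma deriv_ev xi eta F : (ev xi eta F)^`() =
  xi^`() * ev xi eta (dX F) + eta^`() * ev xi eta (dY F) + ev xi eta (dZ F).
Proof.
rewrite /ev (map_deriv_horner (d := @deriv k)); last by exact: derivM.
have -> : (F.[eta%:P])^`() = (dX F).[eta%:P].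
  rewrite (map_deriv_horner (d := @deriv {poly k})); last by exact: derivM.
  by rewrite /= derivC mul0r add0r.
rewrite (map_deriv_horner (d := map_poly (@deriv k))); last first.
  by apply: map_derivM; exact: derivM.
rewrite /=; have -> : map_poly (@deriv k) eta%:P = eta^`()%:P.
  by apply/polyP => i; rewrite coef_map_id0 ?deriv0 // !coefC; case: eqP; rewrite ?deriv0.
by rewrite !(hornerD, hornerM, hornerC) addrA.
Qed.

(** Brings Z to the outside, so that [size] reads off the degree in Z, as [swapXY] does for X. *)
Definition rotZ F : P3 := swapXY (map_poly swapXY F).

Fact rotZ_is_zmod_morphism : zmod_morphism rotZ.
Proof. by move=> F G; rewrite /rotZ !raddfB. Qed.
Fact rotZ_is_monoid_morphism : monoid_morphism rotZ.
Proof. by split=> [|F G]; rewrite /rotZ ?rmorph1 ?rmorphM. Qed.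
HB.instance Definition _ := GRing.isZmodMorphism.Build P3 P3 rotZ rotZ_is_zmod_morphism.
HB.instance Definition _ := GRing.isMonoidMorphism.Build P3 P3 rotZ rotZ_is_monoid_morphism.

Lemma coef_rotZ F j i l : (rotZ F)`_l`_j`_i = F`_j`_i`_l.
Proof. by rewrite coef_swapXY coef_map_id0 ?rmorph0 // coef_swapXY. Qed.
Lemma coef_swap3 F j i l : (swapXY F)`_i`_j`_l = F`_j`_i`_l.
Proof. by rewrite coef_swapXY. Qed.

Lemma rotZ_eq0 F : (rotZ F == 0) = (F == 0).
Proof.
apply/eqP/eqP => [r0|->]; last by rewrite raddf0.
by apply: poly3P => j i l; rewrite -coef_rotZ r0 !coef0.
Qed.

Lemma swapXY_dX F : swapXY (dX F) = (swapXY F)^`().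
Proof. by apply: poly3P => j i l; rewrite coef_swap3 coef_dX (coef_dY (swapXY F)) coef_swap3. Qed.
Lemma swapXY_dY F : swapXY (dY F) = dX (swapXY F).
Proof. by apply: poly3P => j i l; rewrite coef_swap3 coef_dX coef_dY coef_swap3. Qed.
Lemma swapXY_dZ F : swapXY (dZ F) = dZ (swapXY F).
Proof. by apply: poly3P => j i l; rewrite coef_swap3 !coef_dZ coef_swap3. Qed.
Lemma rotZ_dZ F : rotZ (dZ F) = (rotZ F)^`().
Proof. by apply: poly3P => j i l; rewrite coef_rotZ coef_dZ (coef_dY (rotZ F)) coef_rotZ. Qed.
Lemma rotZ_dY F : rotZ (dY F) = dX (rotZ F).
Proof. by apply: poly3P => j i l; rewrite coef_rotZ coef_dY coef_dX coef_rotZ. Qed.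
Lemma rotZ_dX F : rotZ (dX F) = dZ (rotZ F).
Proof. by apply: poly3P => j i l; rewrite coef_rotZ coef_dX coef_dZ coef_rotZ. Qed.

Lemma size_dX F : (size (dX F) <= size F)%N. Proof. exact: size_poly. Qed.
Lemma size_dZ F : (size (dZ F) <= size F)%N. Proof. exact: size_poly. Qed.
Lemma size_dY F : (size (dY F) <= size F)%N.
Proof. by rewrite (leq_trans (size_poly _ _)) // leq_pred. Qed.

(** The sum of the partial degrees replaces the total degree: it still bounds the degree along a
    line, and it is additive on products. *)
Definition tdeg F := ((size F).-1 + (size (swapXY F)).-1 + (size (rotZ F)).-1)%N.

Lemma pred_size_mul (S : idomainType) (p q : {poly S}) : p != 0 -> q != 0 ->
  (size (p * q)).-1 = ((size p).-1 + (size q).-1)%N.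
Proof.
rewrite -!size_poly_gt0 => sp sq; rewrite size_mul -?size_poly_gt0 //.
by case: (size p) sp => // a; case: (size q) sq => // b _ _; rewrite addSn addnS.
Qed.

Lemma tdegM F G : F != 0 -> G != 0 -> tdeg (F * G) = (tdeg F + tdeg G)%N.
Proof.
move=> F0 G0; rewrite /tdeg !rmorphM /= !pred_size_mul ?rotZ_eq0 ?swapXY_eq0 //.
by rewrite [in RHS]addnACA [X in (X + _)%N = _]addnACA.
Qed.

(* [le3 m F G]: each partial degree of [G] is at most [m] times that of [F]. *)
Definition le3 m F G := [&& (size G <= (m * (size F).-1).+1)%N,
  (size (swapXY G) <= (m * (size (swapXY F)).-1).+1)%N &
  (size (rotZ G) <= (m * (size (rotZ F)).-1).+1)%N].

Lemma le3D m F G H : le3 m F G -> le3 m F H -> le3 m F (G + H).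
Proof.
case/and3P=> [g1 g2 g3] /and3P[h1 h2 h3]; apply/and3P.
by rewrite !raddfD; split; rewrite (leq_trans (size_polyD _ _)) // geq_max ?g1 ?g2 ?g3.
Qed.

Lemma le3N m F G : le3 m F G -> le3 m F (- G).
Proof. by rewrite /le3 [swapXY (- G)]raddfN [rotZ (- G)]raddfN /= !size_polyN. Qed.

Lemma size_mul_leS (S : idomainType) (p q : {poly S}) a b :
  (size p <= a.+1)%N -> (size q <= b.+1)%N -> (size (p * q)%R <= (a + b).+1)%N.
Proof.
move=> sp sq; apply: (leq_trans (size_polyMleq _ _)).
by move: (size p) (size q) sp sq => u v; lia.
Qed.

Lemma le3M m n F G H : le3 m F G -> le3 n F H -> le3 (m + n) F (G * H).
Proof.
case/and3P=> [g1 g2 g3] /and3P[h1 h2 h3]; apply/and3P.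
by rewrite !rmorphM !mulnDl; split; exact: size_mul_leS.
Qed.

Lemma swapXY_CC (S : nzRingType) (a : S) : swapXY a%:P%:P = a%:P%:P.
Proof. by rewrite swapXY_polyC map_polyC. Qed.

Lemma le3_kc F c : le3 0 F (kc c).
Proof.
have rE : rotZ (kc c) = kc c.
  by rewrite /rotZ kc.unlock map_polyC /= !swapXY_CC.
have sE : swapXY (kc c) = kc c by rewrite kc.unlock swapXY_CC.
by rewrite /le3 rE sE !mul0n kc.unlock size_polyC_leq1.
Qed.

Lemma le3kcM m F G c : le3 m F G -> le3 m F (kc c * G).
Proof. exact: (le3M (le3_kc F c)). Qed.

Lemma le3_refl F : F != 0 -> le3 1 F F.
Proof. by move=> F0; rewrite /le3 !mul1n !leqSpred. Qed.

Lemma le3_dX m F G : le3 m F G -> le3 m F (dX G).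
Proof.
case/and3P=> [g1 g2 g3]; apply/and3P; rewrite swapXY_dX rotZ_dX.
by split; [apply: leq_trans (size_dX _) _|apply: leq_trans (size_dY _) _
  |apply: leq_trans (size_dZ _) _].
Qed.
Lemma le3_dY m F G : le3 m F G -> le3 m F (dY G).
Proof.
case/and3P=> [g1 g2 g3]; apply/and3P; rewrite swapXY_dY rotZ_dY.
by split; [apply: leq_trans (size_dY _) _|apply: leq_trans (size_dX _) _
  |apply: leq_trans (size_dX _) _].
Qed.
Lemma le3_dZ m F G : le3 m F G -> le3 m F (dZ G).
Proof.
case/and3P=> [g1 g2 g3]; apply/and3P; rewrite swapXY_dZ rotZ_dZ.
by split; [apply: leq_trans (size_dZ _) _|apply: leq_trans (size_dZ _) _
  |apply: leq_trans (size_dY _) _].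
Qed.

Lemma le3_tdeg m F G : le3 m F G -> (tdeg G <= m * tdeg F)%N.
Proof. by rewrite /le3 /tdeg => /and3P[]; nia. Qed.

Lemma size_coefX F j : (size (F`_j)%R <= size (swapXY F))%N.
Proof. by rewrite -sizeYE max_size_coefXY. Qed.

Lemma size_coefZ F j i : (size (F`_j`_i)%R <= size (rotZ F))%N.
Proof.
apply/leq_sizeP => l lel; rewrite -coef_rotZ.
by rewrite (nth_default _ lel) !coef0.
Qed.

Lemma size_ev xi eta F : (size xi <= 2)%N -> (size eta <= 2)%N ->
  (size (ev xi eta F) <= (tdeg F).+1)%N.
Proof.
move=> sxi seta.
have szX (c : {poly k}) n : (size c <= 2)%N -> (size (c ^+ n) <= n.+1)%N.
  by move=> sc; rewrite (leq_trans (size_poly_exp_leq _ _)) // ltnS -[n in leqRHS]mul1n leq_mul2r; lia.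
have -> : ev xi eta F = \sum_(j < size F) \sum_(i < size (F`_j)%R) F`_j`_i * xi ^+ i * eta ^+ j.
  rewrite /ev (horner_coef F) horner_sum; apply: eq_bigr => j _.
  by rewrite -rmorphXn /= hornerM hornerC horner_coef mulr_suml.
apply: (leq_trans (size_sum _ _ _)); apply/bigmax_leqP => j _.
apply: (leq_trans (size_sum _ _ _)); apply/bigmax_leqP => i _.
have hZ := leq_trans (size_coefZ F j i) (leqSpred _).
apply: leq_trans (size_mul_leS (size_mul_leS hZ (szX xi i sxi)) (szX eta j seta)) _.
have := leq_trans (ltn_ord i) (size_coefX F j); have := ltn_ord j; rewrite /tdeg.
move: (nat_of_ord i) => a; move: (nat_of_ord j) => b.
by move: (size F) (size (swapXY F)) (size (rotZ F)); lia.
Qed.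

(** [phi] selects the variable whose degree is compared. A nonzero partial derivative has smaller
    degree in its own variable, so [F] cannot divide it. *)
Lemma ndvdr_morph (S : idomainType) (phi : {rmorphism P3 -> {poly S}}) F G :
  phi G != 0 -> (size (phi G) < size (phi F))%N -> ~ dvdr F G.
Proof.
move=> G0 ltGF [H GE]; move: ltGF G0; rewrite GE rmorphM.
have [->|F0] := eqVneq (phi F) 0; first by rewrite size_poly0.
have [->|H0] := eqVneq (phi H) 0; first by rewrite mulr0 eqxx.
rewrite size_mul //; have : (0 < size (phi H))%N by rewrite size_poly_gt0.
lia.
Qed.

Lemma ndvdr_dY F : dY F != 0 -> ~ dvdr F (dY F).
Proof.
move=> F0; apply: (ndvdr_morph (phi := idfun)) => //=.
by apply: lt_size_deriv; apply: contraNneq F0 => ->; rewrite raddf0.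
Qed.
Lemma ndvdr_dX F : dX F != 0 -> ~ dvdr F (dX F).
Proof.
move=> F0; apply: (ndvdr_morph (phi := swapXY)) => /=; rewrite ?swapXY_eq0 // swapXY_dX.
by apply: lt_size_deriv; rewrite swapXY_eq0; apply: contraNneq F0 => ->; rewrite raddf0.
Qed.
Lemma ndvdr_dZ F : dZ F != 0 -> ~ dvdr F (dZ F).
Proof.
move=> F0; apply: (ndvdr_morph (phi := rotZ)) => /=; rewrite ?rotZ_eq0 // rotZ_dZ.
by apply: lt_size_deriv; rewrite rotZ_eq0; apply: contraNneq F0 => ->; rewrite raddf0.
Qed.

Lemma tdeg0_const F : (tdeg F = 0)%N -> F = kc F`_0`_0`_0.
Proof.
move=> /eqP; rewrite /tdeg !addn_eq0 -!subn1 !subn_eq0 => /andP[/andP[hY hX] hZ].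
have hX' := leq_trans (size_coefX F 0) hX; have hZ' := leq_trans (size_coefZ F 0 0) hZ.
by rewrite kc.unlock {1}(size1_polyC hY) {1}(size1_polyC hX') {1}(size1_polyC hZ').
Qed.

Section Characteristic.
Variable p : nat.
Hypothesis charp : forall n, (0 < n < p)%N -> n%:R != 0 :> k.

Lemma deriv_eq0_size (G : P3) : (size G <= p)%N -> G^`() = 0 -> (size G <= 1)%N.
Proof.
move=> sG G0; apply/leq_sizeP => j j1; apply/polyP => i; apply/polyP => l; rewrite !coef0.
have [jp|pj] := ltnP j p; last by rewrite (nth_default _ (leq_trans sG pj)) !coef0.
have : (G^`())`_j.-1`_i`_l = 0 by rewrite G0 !coef0.
rewrite (coef_dY G) prednK // -mulr_natr => /eqP; rewrite mulf_eq0.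
by rewrite (negPf (charp _)) ?j1 // orbF => /eqP.
Qed.

(** The degree bound excludes polynomials in p-th powers, whose derivatives vanish too. *)
Lemma partials0_tdeg F : (tdeg F < p)%N -> dX F = 0 -> dY F = 0 -> dZ F = 0 -> tdeg F = 0%N.
Proof.
rewrite /tdeg => Fp X0 Y0 Z0.
have hz : (rotZ F)^`() = 0 by rewrite -rotZ_dZ Z0 raddf0.
have hx : (swapXY F)^`() = 0 by rewrite -swapXY_dX X0 raddf0.
have := fun h => deriv_eq0_size h Y0; have := fun h => deriv_eq0_size h hx.
have := fun h => deriv_eq0_size h hz; move: Fp.
by move: (size F) (size (swapXY F)) (size (rotZ F)); lia.
Qed.

End Characteristic.

End Poly3.

(** * Counting the curves common to two surfaces *)

Section Bezout.

Lemma size_det (R : comNzRingType) n (M : 'M[{poly R}]_n) m :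
  (forall i j, (size (M i j) <= m.+1)%N) -> (size (\det M) <= (n * m).+1)%N.
Proof.
move=> Mm; apply: (leq_trans (size_sum _ _ _)); apply/bigmax_leqP => s _.
have : (size (\prod_i M i (s i))%R <= (n * m).+1)%N.
  apply: (leq_trans (size_poly_prod_leq _ _)); rewrite cardT size_enum_ord leq_subLR.
  rewrite addnS ltnS -mulnS -[n in (_ <= n * _)%N]card_ord -sum_nat_const.
  exact: leq_sum.
by rewrite -signr_odd; case: odd; rewrite ?expr0 ?expr1 ?mul1r // mulN1r size_polyN.
Qed.

Variable k : fieldType.
Notation P3 := {poly {poly {poly k}}}.

Lemma size_resultant (F G : P3) m :
  (size (swapXY F) <= m.+1)%N -> (size (swapXY G) <= m.+1)%N ->
  (size (resultant F G) <= (((size G).-1 + (size F).-1) * m).+1)%N.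
Proof.
move=> Fm Gm; apply: size_det => i j; rewrite Sylvester_mxE.
have le (H : P3) (b : bool) l : (size (swapXY H) <= m.+1)%N -> (size (H`_l *+ b)%R <= m.+1)%N.
  by case: b => Hm; rewrite ?mulr0n ?size_poly0 // mulr1n (leq_trans (size_coefX _ _)).
by case: (fintype.split _) => i'; exact: le.
Qed.

(** If the resultant vanished, the gcd would have positive degree in Y. Up to a factor free of Y,
    [F] is the gcd times a cofactor, so the prime [F] divides one of them: the gcd, hence [G], or
    the cofactor, which has smaller degree. *)
Lemma resultant_prime_neq0 (F G : P3) : prime_elt F -> ~ dvdr F G ->
  (1 < size F)%N -> resultant F G != 0.
Proof.
move=> [F0 FU FP] FG sF; rewrite resultant_eq0; apply/negP => sd.
have dvdpE (a b : P3) : a %| b -> exists (c : {poly {poly k}}) (q : P3), c != 0 /\ c%:P * b = a * q.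
  move=> /Pdiv.Idomain.dvdpP[[c q'] /= c0 E]; exists c, q'; split=> //.
  by rewrite mul_polyC E mulrC.
have [c [u [c0 cE]]] := dvdpE _ _ (dvdp_gcdl F G).
have [c' [w [c'0 c'E]]] := dvdpE _ _ (dvdp_gcdr F G).
have u0 : u != 0.
  by apply: contraTneq c0 => u0; move/eqP: cE; rewrite u0 mulr0 mulf_eq0 (negPf F0) orbF polyC_eq0 => ->.
have szc (e : {poly {poly k}}) (q : P3) : e != 0 -> size (e%:P * q) = size q by move=> e0; rewrite size_Cmul.
have ndv (q : P3) : q != 0 -> (size q < size F)%N -> ~ dvdr F q.
  move=> q0 sq [r qE]; move: sq q0; rewrite qE.
  have [->|r0] := eqVneq r 0; first by rewrite mulr0 eqxx.
  rewrite size_mul // => sq _; have : (0 < size r)%N by rewrite size_poly_gt0.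
  by move: (size F) (size r) sq => a b; lia.
have d0 : gcdp F G != 0 by rewrite -size_poly_gt0; lia.
have [|[h hE]|] := FP (gcdp F G) u; first by rewrite -cE; exists c%:P; rewrite mulrC.
- have [] := FP c'%:P G.
  + by rewrite c'E hE -mulrA; exists (h * w).
  + by apply: ndv; rewrite ?polyC_eq0 // size_polyC c'0.
  + exact: FG.
- apply: ndv => //; have := congr1 (size : P3 -> nat) cE.
  by rewrite szc // size_mul // => ->; move: (size u) (size (gcdp F G)) sd => a b; lia.
Qed.

(** Eliminating Y leaves a polynomial in X over the domain k[Z]. Each member of [xs] is one of its
    roots, so the degree in X of the resultant bounds their number. *)
Lemma bezout (F G : P3) m (xs : seq {poly k}) : prime_elt F -> ~ dvdr F G ->
  (0 < m)%N -> le3 m F G -> uniq xs ->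
  (forall x, x \in xs -> exists eta, ev x eta F = 0 /\ ev x eta G = 0) ->
  (size xs <= m.+1 * m * (tdeg F) ^ 2)%N.
Proof.
move=> pF FG m0 /and3P[mGY mGX mGZ] uxs xsP.
have [F0 _ _] := pF.
have G0 : G != 0 by apply/eqP => G0; apply: FG; rewrite G0; exists 0; rewrite mulr0.
(* If [F] or [G] is free of Y, it takes over the role of the resultant: it is itself a nonzero
   polynomial in X that vanishes at all of [xs]. *)
have cst (H : P3) : H != 0 -> (size H <= 1)%N -> (forall x, x \in xs -> exists eta, ev x eta H = 0) ->
    (size xs <= (size (swapXY H)).-1)%N.
  move=> H0 sH HP; have HE := size1_polyC sH.
  have H00 : H`_0 != 0 by move: H0; rewrite HE polyC_eq0 coefC.
  rewrite -ltnS prednK ?size_poly_gt0 ?swapXY_eq0 //.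
  apply: (leq_trans _ (size_coefX H 0)); apply: max_poly_roots => //; apply/allP => x /HP[eta].
  by rewrite /ev HE hornerC coefC /= => /eqP.
have bX : ((size (swapXY F)).-1 <= tdeg F ^ 2)%N.
  apply: (@leq_trans (tdeg F)); first by rewrite /tdeg addnAC leq_addl.
  by case: tdeg => // t; rewrite expnS expn1 leq_pmull.
have bX' : (m * (size (swapXY F)).-1 <= m.+1 * m * tdeg F ^ 2)%N.
  by rewrite -mulnA (leq_trans _ (leq_pmull _ _)) // leq_mul2l bX orbT.
have [sF|sF] := leqP (size F) 1.
  have := cst F F0 sF (fun x xx => let: ex_intro e (conj a _) := xsP x xx in ex_intro _ e a).
  move/leq_trans; apply; apply: leq_trans bX'; exact: leq_pmull.
have [sG|sG] := leqP (size G) 1.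
  have := cst G G0 sG (fun x xx => let: ex_intro e (conj _ a) := xsP x xx in ex_intro _ e a).
  move/leq_trans; apply; rewrite -ltnS prednK ?size_poly_gt0 ?swapXY_eq0 //.
  exact: leq_trans mGX _.
have R0 := resultant_prime_neq0 pF FG sF.
have : (size xs < size (resultant F G))%N.
  apply: max_poly_roots => //; apply/allP => x /xsP[eta [evF evG]].
  have [[u v] _ /= E] := resultant_in_ideal sF sG.
  apply/eqP; have := congr1 (ev x eta) E.
  by rewrite rmorphD !rmorphM /= evF evG !mulr0 addr0 {1}/ev hornerC.
have := @size_resultant F G (m * (size (swapXY F)).-1).
move=> /(_ _ mGX) sR /leq_trans/(_ (sR _)); rewrite ltnS => /(_ _)/leq_trans; apply.
  by case: (size (swapXY F)) => // n /=; nia.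
rewrite /tdeg; set a := (size F).-1; set b := (size (swapXY F)).-1; set c := (size (rotZ F)).-1.
have sG' : ((size G).-1 <= m * a)%N by rewrite -ltnS prednK // ltnW.
have ab : (a * b <= (a + b + c) ^ 2)%N by rewrite expnS expn1 leq_mul // -addnA ?leq_addr // addnCA leq_addr.
have -> : (m.+1 * m * (a + b + c) ^ 2 = m.+1 * (m * (a + b + c) ^ 2))%N by rewrite mulnA.
apply: (@leq_trans ((m.+1 * a) * (m * b))); first by rewrite leq_mul // mulSn addnC leq_add2l.
by rewrite -!mulnA leq_mul2l mulnCA leq_mul2l ab !orbT.
Qed.

End Bezout.

(** * Surfaces containing rays *)

Section Rays.

Variable k : fieldType.
Notation P3 := {poly {poly {poly k}}}.
Variable s : k.
Implicit Types (F G : P3) (c a b z : k).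

(* The ray {x + c y = a, y + c z = b} of direction (c^2, -c, 1), parametrised
   by Z = z and written in the coordinates X = x + s y, Y = y. *)
Definition rayX c a b : {poly k} := (a - c * b + s * b)%:P + (c ^+ 2 - s * c)%:P * 'X.
Definition rayY c b : {poly k} := b%:P - c%:P * 'X.
Definition on_ray c a b : P3 -> {poly k} := ev (rayX c a b) (rayY c b).

Lemma rayD c a b F G : on_ray c a b (F + G) = on_ray c a b F + on_ray c a b G.
Proof. by rewrite /on_ray /ev !hornerD. Qed.
Lemma rayN c a b F : on_ray c a b (- F) = - on_ray c a b F.
Proof. by rewrite /on_ray /ev !hornerN. Qed.
Lemma rayM c a b F G : on_ray c a b (F * G) = on_ray c a b F * on_ray c a b G.
Proof. by rewrite /on_ray /ev !hornerM. Qed.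
Lemma ray_kc c a b e : on_ray c a b (kc e) = e%:P. Proof. by rewrite /on_ray ev_kc. Qed.

Lemma size_lin (u v : k) : (size (u%:P + v%:P * 'X)%R <= 2)%N.
Proof.
rewrite (leq_trans (size_polyD _ _)) // geq_max (leq_trans (size_polyC_leq1 _)) //=.
by rewrite (leq_trans (size_polyMleq _ _)) // size_polyX; have := size_polyC_leq1 v; lia.
Qed.

Lemma size_rayX c a b : (size (rayX c a b) <= 2)%N. Proof. exact: size_lin. Qed.
Lemma size_rayY c b : (size (rayY c b) <= 2)%N.
Proof. by rewrite /rayY -mulNr -polyCN size_lin. Qed.

Lemma size_on_ray c a b F : (size (on_ray c a b F) <= (tdeg F).+1)%N.
Proof. by apply: size_ev; [exact: size_rayX|exact: size_rayY]. Qed.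

Lemma kc1 : kc (1 : k) = 1. Proof. by rewrite kc.unlock !polyC1. Qed.
Lemma kcD : {morph @kc k : x y / x + y}. Proof. by move=> x y; rewrite kc.unlock !polyCD. Qed.
Lemma kcN : {morph @kc k : x / - x}. Proof. by move=> x; rewrite kc.unlock !polyCN. Qed.
Lemma kcM : {morph @kc k : x y / x * y}. Proof. by move=> x y; rewrite kc.unlock !polyCM. Qed.

Definition Dv c F : P3 := kc (c ^+ 2 - s * c) * dX F - kc c * dY F + dZ F.
(** Minus the derivative of [Dv c] with respect to [c], so the tangent direction to the conic of ray
    directions. As [dX] is half the second derivative, [Dv], [Dt] and [dX] form the frame in which
    Taylor expansion in [c] relates any two rays. *)
Definition Dt c F : P3 := dY F + kc (s - c - c) * dX F.

Lemma deriv_on_ray c a b F : (on_ray c a b F)^`() = on_ray c a b (Dv c F).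
Proof.
rewrite {1}/on_ray deriv_ev /Dv !(rayD, rayN, rayM, ray_kc) -!/(on_ray c a b _).
have -> : (rayX c a b)^`() = (c ^+ 2 - s * c)%:P.
  by rewrite /rayX derivD derivM !derivC derivX mul0r mulr1 !add0r.
have -> : (rayY c b)^`() = - c%:P.
  by rewrite /rayY derivB derivM !derivC derivX mul0r mulr1 !add0r.
by rewrite mulNr.
Qed.

Lemma DtD c : {morph Dt c : F G / F + G}. Proof. by move=> F G; rewrite /Dt dXD dYD; ring. Qed.
Lemma DtN c : {morph Dt c : F / - F}. Proof. by move=> F; rewrite /Dt dXN dYN; ring. Qed.
Lemma DtM c F G : Dt c (F * G) = Dt c F * G + F * Dt c G.
Proof. by rewrite /Dt dYM dXM; ring. Qed.
Lemma DvD c : {morph Dv c : F G / F + G}. Proof. by move=> F G; rewrite /Dv dXD dYD dZD; ring. Qed.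
Lemma DvN c : {morph Dv c : F / - F}. Proof. by move=> F; rewrite /Dv dXN dYN dZN; ring. Qed.

Lemma Dvkc c e F : Dv c (kc e * F) = kc e * Dv c F.
Proof. by rewrite /Dv dXkc dYkc dZkc; ring. Qed.
Lemma Dtkc c e F : Dt c (kc e * F) = kc e * Dt c F.
Proof. by rewrite /Dt dXkc dYkc; ring. Qed.

Lemma dX_Dv c F : dX (Dv c F) = Dv c (dX F).
Proof. by rewrite /Dv !(dXD, dXN) !dXkc -dXY dZX. Qed.
Lemma dX_Dt c F : dX (Dt c F) = Dt c (dX F).
Proof. by rewrite /Dt dXD dXkc dXY. Qed.
Lemma Dt_Dv c F : Dt c (Dv c F) = Dv c (Dt c F).
Proof.
rewrite /Dt DvD Dvkc dX_Dv; congr (_ + _).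
by rewrite /Dv !(dYD, dYN) !dYkc dXY dZY.
Qed.

(* The directional derivatives along two rays, expressed in the frame adapted to [e]. *)
Lemma Dv_shift e c F :
  Dv c F = Dv e F - kc (c - e) * Dt e F + kc ((c - e) ^+ 2) * dX F.
Proof. by rewrite /Dv /Dt !expr2 !(kcD, kcN, kcM); ring. Qed.

Lemma Dv2_shift e c F : Dv c (Dv c F) = Dv e (Dv e F)
  - kc (c - e) * (Dt e (Dv e F) + Dt e (Dv e F))
  + kc ((c - e) ^+ 2) * (Dt e (Dt e F) + (dX (Dv e F) + dX (Dv e F)))
  - kc ((c - e) ^+ 3) * (dX (Dt e F) + dX (Dt e F)) + kc ((c - e) ^+ 4) * dX (dX F).
Proof.
have linV u w (A B C : P3) : Dv e (A - kc u * B + kc w * C) =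
    Dv e A - kc u * Dv e B + kc w * Dv e C by rewrite !(DvD, DvN) !Dvkc.
have linT u w (A B C : P3) : Dt e (A - kc u * B + kc w * C) =
    Dt e A - kc u * Dt e B + kc w * Dt e C by rewrite !(DtD, DtN) !Dtkc.
have linX u w (A B C : P3) : dX (A - kc u * B + kc w * C) =
    dX A - kc u * dX B + kc w * dX C by rewrite !(dXD, dXN) !dXkc.
rewrite (Dv_shift e c (Dv c F)) (Dv_shift e c F) linV linT linX.
rewrite -(Dt_Dv e F) -(dX_Dv e F) -(dX_Dt e F) !exprS !expr0 !mulr1 !kcM; ring.
Qed.

(* For an umbilic surface (one whose two null directions are asymptotic
   everywhere), graphed as y = phi(x, z) in the frame of [e], this is the
   relation phi_x^2 phi_zz = phi_z^2 phi_xx. *)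
Definition Psi e F : P3 :=
  dX F ^+ 2 * (Dt e F * Dv e (Dv e F) - (Dv e F * Dt e (Dv e F) + Dv e F * Dt e (Dv e F)))
  - Dv e F ^+ 2 * (Dt e F * dX (dX F) - (dX F * dX (Dt e F) + dX F * dX (Dt e F))).

Lemma le3_Dv m F G c : le3 m F G -> le3 m F (Dv c G).
Proof.
by move=> h; rewrite /Dv; do ?[apply: le3D|apply: le3N|apply: le3kcM|apply: le3_dX|apply: le3_dY|apply: le3_dZ].
Qed.

Lemma le3_Dt m F G c : le3 m F G -> le3 m F (Dt c G).
Proof.
by move=> h; rewrite /Dt; do ?[apply: le3D|apply: le3kcM|apply: le3_dX|apply: le3_dY].
Qed.

Lemma le3_Psi e F : F != 0 -> le3 4 F (Psi e F).
Proof.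
move=> /le3_refl F1; have := (le3_dX F1, le3_Dv e F1, le3_Dt e F1) => -[[hX hV] hT].
have hVV := le3_Dv e hV; have hTV := le3_Dt e hV; have hXX := le3_dX hX; have hXT := le3_dX hT.
have m2 A B : le3 1 F A -> le3 1 F B -> le3 2 F (A * B) by exact: le3M.
have m4 A B : le3 2 F A -> le3 2 F B -> le3 4 F (A * B) by exact: le3M.
rewrite /Psi !expr2; apply: le3D; [|apply: le3N]; apply: m4; (try exact: m2);
  by apply: le3D; [exact: m2|apply: le3N; apply: le3D; exact: m2].
Qed.

Lemma ev_point (xi eta xi' eta' : {poly k}) z F : xi.[z] = xi'.[z] -> eta.[z] = eta'.[z] ->
  (ev xi eta F).[z] = (ev xi' eta' F).[z].
Proof.
move=> hxi heta.
have E1 (G : {poly {poly k}}) u : G.[u].[z] = (map_poly (horner_eval z) G).[u.[z]].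
  by rewrite -[LHS]/(horner_eval z _) -horner_map.
rewrite /ev !E1 hxi; congr (_.[_]).
have E2 u : map_poly (horner_eval z) F.[u%:P]
    = (map_poly (map_poly (horner_eval z)) F).[u.[z]%:P].
  rewrite -[LHS]/(map_poly (horner_eval z) _) -(horner_map (map_poly (horner_eval z))) /=.
  by rewrite map_polyC.
by rewrite !E2 heta.
Qed.

(** [u] and [v] are the two roots of fX w^2 - fY w + fZ, the equation of the null tangent
    directions; Vieta's formulas express fY and fZ through fX. *)
Lemma crossing_algebra (u v fX fY fZ fXX fXY fXZ fYY fYZ fZZ : k) : u != v ->
  fZ - u * fY + u ^+ 2 * fX = 0 -> fZ - v * fY + v ^+ 2 * fX = 0 ->
  fZZ - u * (fYZ + fYZ) + u ^+ 2 * (fYY + (fXZ + fXZ)) - u ^+ 3 * (fXY + fXY)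
    + u ^+ 4 * fXX = 0 ->
  fZZ - v * (fYZ + fYZ) + v ^+ 2 * (fYY + (fXZ + fXZ)) - v ^+ 3 * (fXY + fXY)
    + v ^+ 4 * fXX = 0 ->
  fX * fX * (fY * fZZ - (fZ * fYZ + fZ * fYZ))
    - fZ * fZ * (fY * fXX - (fX * fXY + fX * fXY)) = 0.
Proof.
rewrite -subr_eq0 => uv h1 h2 q1 q2.
have : (u - v) * (fY - fX * (u + v)) = 0.
  rewrite -[RHS](subrr 0) -{1}h2 -h1; ring.
move/eqP; rewrite mulf_eq0 (negPf uv) subr_eq0 /= => /eqP fYE.
have fZE : fZ = fX * u * v.
  by apply/eqP; rewrite -subr_eq0 -h1 fYE; apply/eqP; ring.
apply: (mulfI uv); rewrite mulr0; subst fY fZ.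
(* In v^2 q1 - u^2 q2 the terms in fYY and fXZ cancel, which is why neither occurs in the
   conclusion. *)
have -> : (0 : k) = - fX ^+ 3 * (v ^+ 2 * 0 - u ^+ 2 * 0) by ring.
rewrite -{1}q1 -q2; ring.
Qed.

(** Along a ray contained in the surface the first and second derivatives of [F] vanish. Written in
    the frame of [e], this gives two equations for each of the rays at the crossing. *)
Lemma Psi_crossing e c a b c' a' b' z F : c != c' ->
  (rayX c a b).[z] = (rayX c' a' b').[z] -> (rayY c b).[z] = (rayY c' b').[z] ->
  on_ray c a b F = 0 -> on_ray c' a' b' F = 0 -> (on_ray c a b (Psi e F)).[z] = 0.
Proof.
move=> cc' hX hY h h'.
have hp G : (on_ray c' a' b' G).[z] = (on_ray c a b G).[z] by apply: ev_point.
have h1 : on_ray c a b (Dv c F) = 0 by rewrite -deriv_on_ray h deriv0.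
have h1' : on_ray c' a' b' (Dv c' F) = 0 by rewrite -deriv_on_ray h' deriv0.
have h2 : on_ray c a b (Dv c (Dv c F)) = 0 by rewrite -deriv_on_ray h1 deriv0.
have h2' : on_ray c' a' b' (Dv c' (Dv c' F)) = 0 by rewrite -deriv_on_ray h1' deriv0.
have val G d : on_ray c a b G = 0 -> on_ray c' a' b' d = 0 ->
  (on_ray c a b G).[z] = 0 /\ (on_ray c a b d).[z] = 0.
  by move=> -> hd; rewrite -hp hd horner0.
have [{}h1 {}h1'] := val _ _ h1 h1'; have [{}h2 {}h2'] := val _ _ h2 h2'.
move: h1 h1' h2 h2'.
rewrite (Dv2_shift e c F) (Dv2_shift e c' F) (Dv_shift e c F) (Dv_shift e c' F).
rewrite /Psi !expr2 !(rayD, rayN, rayM, ray_kc).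
rewrite !(hornerD, hornerN, hornerM, hornerC).
apply: crossing_algebra; rewrite ?subrr //.
by apply: contraNneq cc' => /addIr ->.
Qed.

End Rays.

(** * Wronskians in low degree, and the direction of the crossing rays *)

Section Wronskian.

Variables (k : fieldType) (p : nat).
Hypothesis charp : forall n, (0 < n < p)%N -> n%:R != 0 :> k.
Implicit Types (f g u v : {poly k}).

Lemma coef_top u v m n : (size u <= m.+1)%N -> (size v <= n.+1)%N ->
  (u * v)`_(m + n) = u`_m * v`_n.
Proof.
move=> su sv; rewrite coefM (bigD1 (inord m : 'I_(m + n).+1)) //= big1 ?addr0.
  by rewrite inordK ?ltnS ?leq_addr // addKn.
move=> i im; have {}im : (i != m :> nat).
  by apply: contraNneq im => im; apply/eqP/val_inj; rewrite /= inordK ?ltnS ?leq_addr.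
have [mi|im'] := ltnP m i; first by rewrite nth_default ?mul0r // (leq_trans su).
by rewrite [v`_ _]nth_default ?mulr0 // (leq_trans sv) // ltn_subRL; lia.
Qed.

Lemma natr_inj_lt m n : (m < p)%N -> (n < p)%N -> m%:R = n%:R :> k -> m = n.
Proof.
have aux a b : (a < b < p)%N -> a%:R = b%:R :> k -> False.
  move=> ab /eqP; rewrite eq_sym -subr_eq0 -natrB; last by lia.
  by apply/negP/charp; lia.
move=> mp np mn; case: (ltngtP m n) => // h.
  by case: (@aux m n) => //; rewrite h np.
by case: (@aux n m) => //; rewrite h mp.
Qed.

Lemma wronskian_eq0 u v : v != 0 -> (size u <= p)%N -> (size v <= p)%N ->
  u^`() * v = u * v^`() -> exists c, u = c%:P * v.
Proof.
move=> v0 su sv uv.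
(* The top coefficients of X w' v and w X v' differ by the factors deg w and deg v, which are below
   [p] and hence equal. The claim follows by subtracting the multiple of [v] that kills the leading
   term. *)
have key (w : {poly k}) : w != 0 -> (size w <= p)%N -> w^`() * v = w * v^`() -> size w = size v.
  move=> w0 sw wv.
  have sX (q : {poly k}) : q != 0 -> (size ('X * q^`())%R <= (size q).-1.+1)%N.
    move=> q0; apply: (leq_trans (size_polyMleq _ _)); rewrite size_polyX add2n /=.
    by rewrite prednK ?size_poly_gt0 // lt_size_deriv.
  have cX (q : {poly k}) : ('X * q^`())`_(size q).-1 = lead_coef q *+ (size q).-1.
    rewrite coefXM; case: eqP => [->|/eqP]; first by rewrite mulr0n.
    by rewrite -lt0n => q1; rewrite coef_deriv prednK.
  have : (('X * w^`()) * v)`_((size w).-1 + (size v).-1) = (w * ('X * v^`()))`_((size w).-1 + (size v).-1).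
    have -> : 'X * w^`() * v = w * ('X * v^`()) by rewrite -mulrA wv; ring.
    by [].
  rewrite !coef_top ?sX ?leqSpred // !cX -!lead_coefE.
  rewrite mulrnAl mulrnAr -mulr_natr -[RHS]mulr_natr => /mulfI; rewrite mulf_neq0 ?lead_coef_eq0 //.
  have := size_poly_gt0 w; have := size_poly_gt0 v; rewrite v0 w0 => sv0 sw0.
  by move=> /(_ isT)/natr_inj_lt; lia.
have [->|u0] := eqVneq u 0; first by exists 0; rewrite mul0r.
have suv := key u u0 su uv.
pose c := lead_coef u / lead_coef v; exists c; apply/eqP; rewrite -subr_eq0.
have sw : (size (u - c%:P * v)%R < size u)%N.
  have su0 : (0 < size u)%N by rewrite size_poly_gt0.
  rewrite -(prednK su0) ltnS; apply/leq_sizeP => i; rewrite leq_eqVlt coefB coefCM => /predU1P[<-|].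
    by rewrite {2}suv -!lead_coefE divfK ?lead_coef_eq0 // subrr.
  by rewrite prednK // => ui; rewrite !nth_default ?mulr0 ?subr0 // -suv.
have E : (u - c%:P * v)^`() * v = (u - c%:P * v) * v^`().
  by rewrite derivB derivM derivC mul0r add0r !mulrBl uv; ring.
apply/negPn/negP => w0; have := key _ w0 (leq_trans (ltnW sw) su) E.
by rewrite -suv => wE; move: sw; rewrite wE ltnn.
Qed.

(** The hypothesis is (f/g)'' = 0 with denominators cleared. With h = f' g - f g' it says that [h]
    and g^2 have zero Wronskian, so h = c1 g^2; then f - c1 X g and [g] have zero Wronskian. The
    bound on [p] covers the degree 2d of [h] and g^2. *)
Lemma ratio_affine f g d : g != 0 -> (size f <= d.+1)%N -> (size g <= d.+1)%N ->
  (d.*2 + 2 <= p)%N ->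
  g * (g * f^`()^`() - (f^`() * g^`() + f^`() * g^`()))
    = f * (g * g^`()^`() - (g^`() * g^`() + g^`() * g^`())) ->
  exists c0 c1, f = (c0%:P + c1%:P * 'X) * g.
Proof.
move=> g0 sf sg dp E; pose h := f^`() * g - f * g^`().
have sd (q : {poly k}) : (size q <= d.+1)%N -> (size q^`() <= d.+1)%N.
  by apply: leq_trans; rewrite (leq_trans (size_poly _ _)) ?leq_pred.
have sM (q r : {poly k}) : (size q <= d.+1)%N -> (size r <= d.+1)%N -> (size (q * r)%R <= p)%N.
  move=> sq sr; apply: leq_trans (size_mul_leS sq sr) _; lia.
have [||||c1 hE] := @wronskian_eq0 h (g * g).
- by rewrite mulf_neq0.
- by rewrite (leq_trans (size_polyD _ _)) // geq_max size_polyN !sM ?sd.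
- exact: sM.
- rewrite /h !(derivB, derivM); apply/eqP; rewrite -subr_eq0.
  by move/eqP: E; rewrite -subr_eq0 => /eqP E; apply/eqP; rewrite -[RHS](mulr0 g) -E; ring.
have [||||c0 uE] := @wronskian_eq0 (f - c1%:P * 'X * g) g => //.
- rewrite (leq_trans (size_polyD _ _)) // geq_max size_polyN; apply/andP; split; first by lia.
  rewrite -mulrA; apply: (leq_trans (size_mul_leS (size_polyC_leq1 _) (_ : _ <= d.+2)%N)); last by lia.
  by rewrite mulrC size_mulX //; lia.
- by lia.
- rewrite !(derivB, derivM) derivC derivX; apply/eqP; rewrite -subr_eq0; apply/eqP.
  by rewrite -[RHS](subrr (c1%:P * (g * g))) -{1}hE /h; ring.
by exists c0, c1; rewrite mulrDl -uE; ring.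
Qed.

End Wronskian.

Section OwnDirection.

Variables (k : fieldType) (s : k).
Notation P3 := {poly {poly {poly k}}}.
Implicit Types (F : P3).

(** Differentiating Psi = F h across the ray, on which [F] vanishes, gives [h] times the derivative
    of [F]. The directions [dX] and [Dt] yield two expressions for [h] on the ray, and eliminating
    it leaves (f/g)'' = 0. *)
Lemma own_direction c a b F : dvdr F (Psi s c F) -> on_ray s c a b F = 0 ->
  let f := on_ray s c a b (dX F) in let g := on_ray s c a b (Dt s c F) in
  f != 0 ->
  g * (g * f^`()^`() - (f^`() * g^`() + f^`() * g^`()))
    = f * (g * g^`()^`() - (g^`() * g^`() + g^`() * g^`())).
Proof.
move=> [h hE] F0 f g f0.
have V0 : on_ray s c a b (Dv s c F) = 0 by rewrite -deriv_on_ray F0 deriv0.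
have VV0 : on_ray s c a b (Dv s c (Dv s c F)) = 0 by rewrite -deriv_on_ray V0 deriv0.
have f1 : on_ray s c a b (dX (Dv s c F)) = f^`() by rewrite dX_Dv -deriv_on_ray.
have f2 : on_ray s c a b (dX (Dv s c (Dv s c F))) = f^`()^`().
  by rewrite !dX_Dv -!deriv_on_ray.
have g1 : on_ray s c a b (Dt s c (Dv s c F)) = g^`() by rewrite Dt_Dv -deriv_on_ray.
have g2 : on_ray s c a b (Dt s c (Dv s c (Dv s c F))) = g^`()^`().
  by rewrite !Dt_Dv -!deriv_on_ray.
(* The second half of Psi contains the square of [Dv s c F], so its derivative vanishes on the ray;
   in the first half only the terms that differentiate [Dv] or its iterate survive. *)
have key (D : P3 -> P3) : {morph D : x y / x + y} -> {morph D : x / - x} ->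
    (forall x y, D (x * y) = D x * y + x * D y) ->
    on_ray s c a b (D (Psi s c F)) = f * f * (g * on_ray s c a b (D (Dv s c (Dv s c F)))
      - (on_ray s c a b (D (Dv s c F)) * g^`() + on_ray s c a b (D (Dv s c F)) * g^`())).
  move=> DD DN DM; rewrite /Psi !expr2.
  have gen (A T Z ZZ TZ XX XT : P3) : on_ray s c a b Z = 0 -> on_ray s c a b ZZ = 0 ->
      on_ray s c a b (D (A * A * (T * ZZ - (Z * TZ + Z * TZ))
        - Z * Z * (T * XX - (A * XT + A * XT)))) =
      on_ray s c a b A * on_ray s c a b A * (on_ray s c a b T * on_ray s c a b (D ZZ)
        - (on_ray s c a b (D Z) * on_ray s c a b TZ + on_ray s c a b (D Z) * on_ray s c a b TZ)).
    move=> Z0 ZZ0; rewrite !(DD, DN, DM) !(rayD, rayN, rayM) Z0 ZZ0; ring.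
  by rewrite gen // g1.
have E1 := key (@dX k) (@dXD k) (@dXN k) (@dXM k).
have E2 := key (Dt s c) (@DtD k s c) (@DtN k s c) (@DtM k s c).
have ray0l (A B : P3) : on_ray s c a b (A * h + F * B) = on_ray s c a b A * on_ray s c a b h.
  by rewrite rayD !rayM F0 mul0r addr0.
move: E1 E2; rewrite hE dXM DtM !ray0l f1 f2 g1 g2 -/f -/g.
set H := on_ray s c a b h => E1 E2.
have ff0 : f * f != 0 by rewrite mulf_neq0.
by apply: (mulfI ff0); rewrite mulrCA -E1 [RHS]mulrCA -E2; ring.
Qed.

End OwnDirection.

(** * Incidences between two families of rays *)

Section EdgeCount.

Variables (I J : finType) (E : I -> J -> bool).
Implicit Types (R : {set I}) (B : {set J}).

Definition edges R B := (\sum_(j in B) #|[set i in R | E i j]|)%N.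

Lemma card_setIdE (T : finType) (A : {set T}) (P : pred T) :
  #|[set x in A | P x]| = (\sum_(x in A) P x)%N.
Proof.
by rewrite -sum1dep_card big_mkcondr; apply: eq_bigr => x _; case: (P x).
Qed.

Lemma edgesE R B : edges R B = (\sum_(i in R) #|[set j in B | E i j]|)%N.
Proof.
rewrite /edges (eq_bigr _ (fun j _ => card_setIdE R (E^~ j))) exchange_big /=.
by apply: eq_bigr => i _; rewrite card_setIdE.
Qed.

Lemma edgesUr R B1 B2 : [disjoint B1 & B2] -> edges R (B1 :|: B2) = (edges R B1 + edges R B2)%N.
Proof. by move=> d; rewrite /edges -bigU //; apply: eq_bigl => j; rewrite !inE. Qed.

Lemma edgesUl R1 R2 B : [disjoint R1 & R2] -> edges (R1 :|: R2) B = (edges R1 B + edges R2 B)%N.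
Proof. by move=> d; rewrite !edgesE -bigU //; apply: eq_bigl => i; rewrite !inE. Qed.

Lemma edges_leqr R B m : (forall j, j \in B -> (#|[set i in R | E i j]| <= m)%N) ->
  (edges R B <= m * #|B|)%N.
Proof. by move=> h; rewrite mulnC -sum_nat_const; exact: leq_sum. Qed.

Lemma edges_leql R B m : (forall i, i \in R -> (#|[set j in B | E i j]| <= m)%N) ->
  (edges R B <= m * #|R|)%N.
Proof. by move=> h; rewrite edgesE mulnC -sum_nat_const; exact: leq_sum. Qed.

End EdgeCount.

Lemma card_roots (T : finType) (k : fieldType) (Q : {poly k}) (A : {set T}) (z : T -> k) :
  Q != 0 -> {in A &, injective z} -> (forall t, t \in A -> Q.[z t] = 0) ->
  (#|A| <= (size Q).-1)%N.
Proof.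
move=> Q0 zi zr; rewrite -ltnS prednK ?size_poly_gt0 // cardE -(size_map z).
apply: max_poly_roots => //.
  by apply/allP => _ /mapP[t tA ->]; apply/eqP/zr; rewrite mem_enum in tA.
by rewrite map_inj_in_uniq ?enum_uniq // => x y; rewrite !mem_enum; exact: zi.
Qed.

Lemma kc_unit (k : fieldType) (c : k) : c != 0 -> kc c \is a GRing.unit.
Proof.
move=> c0; have E : kc c * kc c^-1 = 1 by rewrite -kcM (mulfV c0) kc1.
by apply/unitrPr; exists (kc c^-1).
Qed.

Section TwoFamilies.

Variables (k : fieldType) (s : k) (p : nat).
Hypothesis charp : forall n, (0 < n < p)%N -> n%:R != 0 :> k.
Notation P3 := {poly {poly {poly k}}}.

Record family (I : finType) := Family { dir : I -> k; fa : I -> k; fb : I -> k }.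

Definition ray I (r : family I) (i : I) : P3 -> {poly k} :=
  on_ray s (dir r i) (fa r i) (fb r i).

(** [cross_injl] and [cross_injr] turn bounds on roots into bounds on rays. [kappa] covers the one
    case out of reach of degrees: red rays whose inverse relative direction is an affine function of
    the parameter. *)
Record crossing (I J : finType) (r : family I) (b : family J)
    (E : I -> J -> bool) (z : I -> J -> k) (kappa : nat) : Prop := Crossing {
  crossX : forall i j, E i j ->
    (rayX s (dir r i) (fa r i) (fb r i)).[z i j] = (rayX s (dir b j) (fa b j) (fb b j)).[z i j];
  crossY : forall i j, E i j ->
    (rayY (dir r i) (fb r i)).[z i j] = (rayY (dir b j) (fb b j)).[z i j];
  cross_dir : forall i j, E i j -> dir r i != dir b j;
  cross_injl : forall i i' j, E i j -> E i' j -> z i j = z i' j -> i = i';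
  cross_injr : forall i j j', E i j -> E i j' -> z i j = z i j' -> j = j';
  cross_rayX : injective (fun j => rayX s (dir b j) (fa b j) (fb b j));
  cross_kappa : forall j (c0 c1 : k),
    (#|[set i | E i j && ((c0 + c1 * z i j) * (dir r i - dir b j) == 1)%R]| <= kappa)%N }.

Variables (I J : finType) (r : family I) (b : family J).
Variables (E : I -> J -> bool) (z : I -> J -> k) (kappa : nat).
Hypothesis C : crossing r b E z kappa.
Implicit Types (F : P3) (R : {set I}) (B : {set J}).

Lemma cross_eval i j F : E i j -> (ray r i F).[z i j] = (ray b j F).[z i j].
Proof. by move=> e; apply: ev_point; [exact: (crossX C)|exact: (crossY C)]. Qed.

Lemma size_ray (K : finType) (q : family K) j F : ((size (ray q j F)).-1 <= tdeg F)%N.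
Proof. by rewrite -subn1 leq_subLR add1n size_on_ray. Qed.

Lemma bezout_family F G m B : prime_elt F -> ~ dvdr F G -> (0 < m)%N -> le3 m F G ->
  (forall j, j \in B -> ray b j F = 0 /\ ray b j G = 0) ->
  (#|B| <= m.+1 * m * tdeg F ^ 2)%N.
Proof.
move=> pF FG m0 le h; pose X j := rayX s (dir b j) (fa b j) (fb b j).
rewrite cardE -(size_map X); apply: (bezout pF FG m0 le).
  by rewrite map_inj_uniq ?enum_uniq //; exact: (cross_rayX C).
move=> _ /mapP[j jB ->]; exists (rayY (dir b j) (fb b j)).
by apply: h; rewrite mem_enum in jB.
Qed.

Lemma card_off F i B : ray r i F != 0 -> (forall j, j \in B -> ray b j F = 0) ->
  (#|[set j in B | E i j]| <= tdeg F)%N.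
Proof.
move=> rF h; apply: leq_trans (card_roots (z := z i) rF _ _) (size_ray r i F).
  by move=> j j'; rewrite !inE => /andP[_ e] /andP[_ e']; exact: (cross_injr C).
by move=> j; rewrite inE => /andP[/h bF e]; rewrite cross_eval // bF horner0.
Qed.

Lemma card_cross_roots (Q : {poly k}) d (A : {set I}) j :
  Q != 0 -> ((size Q).-1 <= d)%N -> (forall i, i \in A -> E i j /\ Q.[z i j] = 0) ->
  (#|A| <= d)%N.
Proof.
move=> Q0 sQ h; apply: leq_trans (card_roots (z := z^~ j) Q0 _ _) sQ.
  by move=> i i' /h[e _] /h[e' _]; exact: (cross_injl C).
by move=> i /h[].
Qed.

(* At a crossing, the direction of the red ray is the second root of the
   quadratic equation of the null tangent directions of F = 0. *)
Lemma cross_tangent F i j : E i j -> ray r i F = 0 -> ray b j F = 0 ->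
  (dir r i - dir b j) * (ray b j (dX F)).[z i j] = (ray b j (Dt s (dir b j) F)).[z i j].
Proof.
move=> e rF bF; have u0 : dir r i - dir b j != 0 by rewrite subr_eq0 (cross_dir C).
have rV : ray r i (Dv s (dir r i) F) = 0 by rewrite /ray -deriv_on_ray [on_ray _ _ _ _ _]rF deriv0.
have bV : ray b j (Dv s (dir b j) F) = 0 by rewrite /ray -deriv_on_ray [on_ray _ _ _ _ _]bF deriv0.
have := congr1 (horner^~ (z i j)) rV; rewrite cross_eval // (Dv_shift s (dir b j)).
move: bV; rewrite /ray.
move: (Dt _ _ F) (dX F) (Dv _ _ F) => T X V V0.
rewrite rayD rayD rayN !rayM !ray_kc V0 !(hornerD, hornerN, hornerM, hornerC) add0r.
move=> h; apply: (mulfI u0); apply/eqP; rewrite -subr_eq0 -h; apply/eqP; ring.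
Qed.

(** A red ray off the surface meets at most [tdeg F] of the blue rays in it. For red rays in the
    surface the count is made on each blue ray, apart from the blue rays in [B0] along which an
    auxiliary polynomial vanishes identically. *)
Lemma prime_edges F R B : prime_elt F -> (2 * tdeg F + 2 <= p)%N ->
  (forall j, j \in B -> ray b j F = 0) ->
  exists B0 : {set J}, [/\ B0 \subset B, (#|B0| <= 20 * tdeg F ^ 2)%N &
    (edges E R (B :\: B0) <= tdeg F * #|R| + (4 * tdeg F + kappa) * #|B|)%N].
Proof.
move=> pF dp hB; have [F0 FU _] := pF.
suff [B0 [sB0 cB0 h]] : exists B0 : {set J}, [/\ B0 \subset B, (#|B0| <= 20 * tdeg F ^ 2)%N &
    forall j, j \in B -> j \notin B0 ->
    (#|[set i in R | (ray r i F == 0%R) && E i j]| <= 4 * tdeg F + kappa)%N].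
  exists B0; split=> //; pose R1 := [set i in R | ray r i F == 0].
  have RE : R = (R :\: R1) :|: R1.
    by rewrite -[LHS](setID R R1) setUC (setIidPr _) //; apply/subsetP => i; rewrite inE => /andP[].
  rewrite {1}RE edgesUl; last by rewrite -setI_eq0 setIC setDE setICA setICr setI0.
  apply: leq_add.
    apply: (@leq_trans (tdeg F * #|R :\: R1|)); last by rewrite leq_mul2l subset_leq_card ?subsetDl ?orbT.
    apply: edges_leql => i; rewrite !inE negb_and => /andP[/orP[/negP//|rF] iR].
    by apply: card_off => // j; rewrite inE => /andP[_]; exact: hB.
  apply: (@leq_trans ((4 * tdeg F + kappa) * #|B :\: B0|)); last by rewrite leq_mul2l subset_leq_card ?subsetDl ?orbT.
  apply: edges_leqr => j; rewrite inE => /andP[jB0 jB].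
  by apply: leq_trans (h j jB jB0); apply/subset_leq_card/subsetP => i; rewrite !inE => /andP[/andP[-> ->] ->].
(* If some [Psi s e F] is not a multiple of [F], it serves as the auxiliary polynomial. Its degrees
   are at most 4 times those of [F], so Bezout gives 20 = 5 * 4. *)
have [[e Fe]|/forallNP all_e] := pselect (exists e, ~ dvdr F (Psi s e F)).
  exists [set j in B | ray b j (Psi s e F) == 0]; split.
  - by apply/subsetP => j; rewrite inE => /andP[].
  - apply: (@bezout_family F (Psi s e F) 4) => //; first exact: le3_Psi.
    by move=> j; rewrite inE => /andP[/hB -> /eqP ->].
  - move=> j jB; rewrite inE jB /= => Pj; apply: (@leq_trans (4 * tdeg F)); last exact: leq_addr.
    apply: (card_cross_roots (Q := ray b j (Psi s e F)) (j := j)) => //.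
      by apply: (leq_trans (size_ray _ _ _)); apply/le3_tdeg/le3_Psi.
    move=> i; rewrite inE => /and3P[_ /eqP rF ij]; split=> //.
    apply: (@Psi_crossing k s e _ _ _ (dir r i) (fa r i) (fb r i)) => //.
    + by rewrite eq_sym (cross_dir C).
    + by rewrite (crossX C).
    + by rewrite (crossY C).
    + exact: hB.
(* Otherwise a nonzero partial derivative serves. Outside its exceptional rays [f] and [g] below are
   not both zero. One exists, since otherwise [F] would be a constant, hence a unit. *)
have [G [G0 FG le1G Gj]] : exists G, [/\ G != 0, ~ dvdr F G, le3 1 F G &
    forall j, j \in B -> ray b j (dX F) = 0 -> ray b j (Dt s (dir b j) F) = 0 -> ray b j G = 0].
  have X2Y j : ray b j (dX F) = 0 -> ray b j (Dt s (dir b j) F) = 0 -> ray b j (dY F) = 0.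
    by rewrite /ray /Dt => X0; rewrite rayD rayM X0 mulr0 addr0.
  have X2Z j : j \in B -> ray b j (dX F) = 0 -> ray b j (Dt s (dir b j) F) = 0 -> ray b j (dZ F) = 0.
    move=> /hB bF X0 T0; have Y0 := X2Y _ X0 T0.
    have : ray b j (Dv s (dir b j) F) = 0 by rewrite /ray -deriv_on_ray [on_ray _ _ _ _ _]bF deriv0.
    by rewrite /ray /Dv rayD rayD rayN !rayM [on_ray _ _ _ _ (dX F)]X0 [on_ray _ _ _ _ (dY F)]Y0 !mulr0 subr0 add0r.
  have F1 := le3_refl F0.
  have [X0|X0] := eqVneq (dX F) 0; last first.
    by exists (dX F); split=> //; [exact: ndvdr_dX|exact: le3_dX].
  have [Y0|Y0] := eqVneq (dY F) 0; last first.
    by exists (dY F); split=> //; [exact: ndvdr_dY|exact: le3_dY|move=> j _; exact: X2Y].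
  have [Z0|Z0] := eqVneq (dZ F) 0; last first.
    by exists (dZ F); split=> //; [exact: ndvdr_dZ|exact: le3_dZ].
  have /tdeg0_const FE : tdeg F = 0%N by apply: (partials0_tdeg charp) => //; lia.
  set c := F`_0`_0`_0 in FE.
  have c0 : c != 0 by apply: contraNneq F0 => h; rewrite FE h kc.unlock !polyC0.
  by move: FU; rewrite FE kc_unit.
exists [set j in B | ray b j G == 0]; split.
- by apply/subsetP => j; rewrite inE => /andP[].
- apply: (@leq_trans (2 * 1 * tdeg F ^ 2)); last by rewrite leq_mul2r orbT.
  apply: (@bezout_family F G 1) => //.
  by move=> j; rewrite inE => /andP[/hB -> /eqP ->].
move=> j jB; rewrite inE jB /= => Gj0.
set f := ray b j (dX F); set g := ray b j (Dt s (dir b j) F).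
have sf : ((size f).-1 <= tdeg F)%N.
  by apply: (leq_trans (size_ray _ _ _)); rewrite -[leqRHS]mul1n; apply/le3_tdeg/le3_dX/le3_refl.
have sg : ((size g).-1 <= tdeg F)%N.
  by apply: (leq_trans (size_ray _ _ _)); rewrite -[leqRHS]mul1n; apply/le3_tdeg/le3_Dt/le3_refl.
have tan i : E i j -> ray r i F = 0 -> (dir r i - dir b j) * f.[z i j] = g.[z i j].
  by move=> e rF; apply: cross_tangent => //; exact: hB.
have small m : (m <= tdeg F)%N -> (m <= 4 * tdeg F + kappa)%N by lia.
have [f0|f0] := eqVneq f 0.
  have g0 : g != 0 by apply: contraNneq Gj0 => g0; rewrite (Gj j).
  apply/small/(card_cross_roots (Q := g) (j := j)) => // i; rewrite inE => /and3P[_ /eqP rF e].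
  by split=> //; rewrite -tan // f0 horner0 mulr0.
have [g0|g0] := eqVneq g 0.
  apply/small/(card_cross_roots (Q := f) (j := j)) => // i; rewrite inE => /and3P[_ /eqP rF e].
  split=> //; have /eqP := tan i e rF; rewrite g0 horner0 mulf_eq0 subr_eq0.
  by rewrite (negPf (cross_dir C e)) => /eqP.
have [||||c0 [c1 fE]] := @ratio_affine k p charp f g (tdeg F) g0.
- by lia.
- by lia.
- by lia.
- by apply: own_direction => //; [have /contrapT := all_e (dir b j)|exact: hB].
pose A1 := [set i | E i j && (g.[z i j] == 0)].
pose A2 := [set i | E i j && ((c0 + c1 * z i j) * (dir r i - dir b j) == 1)].
(* At a crossing (dir r i - dir b j) f = g and f = (c0 + c1 z) g. Hence either g vanishes there or
   the crossing is among those counted by [kappa]. *)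
apply: (@leq_trans (#|A1 :|: A2|)).
  apply/subset_leq_card/subsetP => i; rewrite !inE => /and3P[_ /eqP rF e]; rewrite e /=.
  have := tan i e rF; rewrite fE !(hornerD, hornerM, hornerC, hornerX).
  have [//|gz /=] := eqVneq g.[z i j] 0; rewrite mulrA -{2}[g.[_]]mul1r => /(mulIf gz) <-.
  by rewrite mulrC.
apply: (leq_trans (leq_card_setU _ _)); apply: leq_add; last exact: (cross_kappa C).
apply: (@leq_trans (tdeg F)); last by lia.
by apply: (card_cross_roots (Q := g) (j := j)) => // i; rewrite inE => /andP[-> /eqP].
Qed.

(** Each blue ray is charged to the first factor that vanishes on it, so that the blue sets are
    disjoint and the bounds add up. *)
Lemma prime_product_edges (ps : seq P3) R B :
  (forall x, x \in ps -> prime_elt x) -> (2 * \sum_(x <- ps) tdeg x + 2 <= p)%N ->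
  (forall j, j \in B -> ray b j (\prod_(x <- ps) x) = 0) ->
  exists B0 : {set J}, [/\ B0 \subset B, (#|B0| <= 20 * (\sum_(x <- ps) tdeg x) ^ 2)%N &
    (edges E R (B :\: B0) <= (\sum_(x <- ps) tdeg x) * #|R|
      + (4 * \sum_(x <- ps) tdeg x + kappa) * #|B|)%N].
Proof.
elim: ps B => [|x ps IHps] B psP; rewrite ?big_nil ?big_cons => dp hB.
  have -> : B = set0.
    apply/setP => j; rewrite inE; apply/negP => /hB/eqP.
    by rewrite /ray -kc1 ray_kc oner_eq0.
  by exists set0; rewrite setD0 cards0; split=> //; rewrite /edges big_set0.
set dx := tdeg x in dp *; set ds := (\sum_(x <- ps) tdeg x)%N in dp IHps *.
pose B1 := [set j in B | ray b j x == 0]; pose B2 := B :\: B1.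
have BE : B = B1 :|: B2 by rewrite /B2 -{1}(setID B B1) (setIidPr _) //; apply/subsetP => j; rewrite inE => /andP[].
have dB : [disjoint B1 & B2] by rewrite -setI_eq0 /B2 setDE setICA setICr setI0.
have [|||B01 [s1 c1 e1]] := @prime_edges x R B1.
- by apply: psP; rewrite mem_head.
- by lia.
- by move=> j; rewrite inE => /andP[_ /eqP].
have [|||B02 [s2 c2 e2]] := IHps B2.
- by move=> y yps; apply: psP; rewrite inE yps orbT.
- by lia.
- move=> j; rewrite !inE negb_and => /andP[/orP[/negP//|xj] jB].
  have /eqP := hB j jB; rewrite /ray rayM mulf_eq0 [_ == 0](negPf xj).
  by move/eqP.
exists (B01 :|: B02); split.
- by rewrite [in X in _ \subset X]BE setUSS.
- rewrite (leq_trans (leq_card_setU _ _)) // (leq_trans (leq_add c1 c2)) //; nia.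
have -> : B :\: (B01 :|: B02) = (B1 :\: B01) :|: (B2 :\: B02).
  apply/setP => j; rewrite !inE; move: (subsetP s1 j) (subsetP s2 j); rewrite !inE.
  by case: (j \in B01) (j \in B02) (j \in B) (ray b j x == 0) => [] [] [] [] //= h1 h2;
    first [exact: (h1 isT)|exact: (h2 isT)|move: (h1 isT)|move: (h2 isT)].
rewrite edgesUr; last first.
  by apply: disjointW (subsetDl _ _) (subsetDl _ _) dB.
have cB : #|B| = (#|B1| + #|B2|)%N by rewrite {1}BE cardsU (disjoint_setI0 dB) cards0 subn0.
by rewrite cB; apply: (leq_trans (leq_add e1 e2)); nia.
Qed.

End TwoFamilies.

(** * Interpolation on a well-chosen sample of rays *)

Lemma underdetermined (k : fieldType) (A B : finType) (M : A -> B -> k) :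
  (#|B| < #|A|)%N ->
  exists c : A -> k, (exists a, c a != 0) /\ forall b, \sum_a c a * M a b = 0.
Proof.
move=> BA; pose N := \matrix_(i < #|A|, j < #|B|) M (enum_val i) (enum_val j).
have : kermx N != 0.
  rewrite -mxrank_eq0 mxrank_ker -lt0n subn_gt0.
  exact: leq_ltn_trans (rank_leq_col N) BA.
case/matrix0Pn=> i [j ij0]; exists (fun a => kermx N i (enum_rank a)); split.
  by exists (enum_val j); rewrite enum_valK.
move=> b; have /matrixP/(_ i (enum_rank b)) := mulmx_ker N; rewrite !mxE => kerE.
rewrite -[RHS]kerE (reindex_onto (@enum_val A predT) enum_rank) /=; last first.
  by move=> a _; rewrite enum_rankK.
apply: eq_big => [x|x _]; first by rewrite enum_valK eqxx.
by rewrite !mxE enum_valK enum_rankK.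
Qed.

Section Interpolation.

Variables (k : fieldType) (s : k) (I : finType) (r : family k I).
Notation P3 := {poly {poly {poly k}}}.

(** There are m^3 coefficients to choose; on each ray the restriction has degree at most 3(m - 1),
    so 3m linear conditions make it vanish. *)
Lemma interpolation (S : {set I}) m : (0 < m)%N -> (#|S| * 3 < m * m)%N ->
  exists F : P3, [/\ F != 0, (tdeg F <= 3 * m.-1)%N &
    forall i, i \in S -> ray s r i F = 0].
Proof.
move=> m0 Sm.
pose A := ('I_m * 'I_m * 'I_m)%type; pose B := ('I_#|S| * 'I_(3 * m))%type.
pose xi i := rayX s (dir r i) (fa r i) (fb r i); pose eta i := rayY (dir r i) (fb r i).
pose M (a : A) (b : B) : k :=
  ('X^(a.2) * xi (enum_val b.1) ^+ a.1.2 * eta (enum_val b.1) ^+ a.1.1)`_b.2.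
have [|c [[[[j0 i0] l0] c0] hc]] := @underdetermined k A B M.
  by rewrite !card_prod !card_ord mulnA ltn_pmul2r.
pose ci j i l := if insub j is Some j' then if insub i is Some i' then
  if insub l is Some l' then c (j', i', l') else 0 else 0 else 0.
have ciE (j i l : 'I_m) : ci j i l = c (j, i, l) by rewrite /ci !valK.
pose F : P3 := \poly_(j < m) \poly_(i < m) \poly_(l < m) ci j i l.
have FE j i l : F`_j`_i`_l = if [&& j < m, i < m & l < m]%N then ci j i l else 0.
  rewrite /F coef_poly; case: (j < m)%N; last by rewrite !coef0.
  rewrite coef_poly; case: (i < m)%N; last by rewrite coef0.
  by rewrite coef_poly.
have F0 : F != 0.
  apply: contraNneq c0 => F0; have := FE j0 i0 l0.
  by rewrite F0 !coef0 !ltn_ord ciE => ->.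
have dF : (tdeg F <= 3 * m.-1)%N.
  have sY : (size F <= m)%N by exact: size_poly.
  have sX : (size (swapXY F) <= m)%N.
    apply/leq_sizeP => i mi; apply/polyP => j; apply/polyP => l; rewrite coef_swap3 FE !coef0.
    by rewrite [(i < m)%N]ltnNge mi andbF.
  have sZ : (size (rotZ F) <= m)%N.
    apply/leq_sizeP => l ml; apply/polyP => j; apply/polyP => i; rewrite coef_rotZ FE !coef0.
    by rewrite [(l < m)%N]ltnNge ml !andbF.
  by rewrite /tdeg; move: (size F) (size (swapXY F)) (size (rotZ F)) sY sX sZ; lia.
exists F; split=> // i iS; pose b := enum_rank_in iS i.
have bE : enum_val b = i by rewrite enum_rankK_in.
have evE : ray s r i F = \sum_(a : A) c a *: ('X^(a.2) * xi i ^+ a.1.2 * eta i ^+ a.1.1).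
  transitivity (\sum_(j < m) \sum_(l < m) \sum_(l' < m)
      c (j, l, l') *: ('X^l' * xi i ^+ l * eta i ^+ j)).
    rewrite /ray /on_ray /ev /F horner_poly horner_sum; apply: eq_bigr => j _.
    rewrite -rmorphXn /= hornerM hornerC horner_poly mulr_suml.
    apply: eq_bigr => l _; rewrite poly_def !mulr_suml; apply: eq_bigr => l' _.
    by rewrite ciE -!scalerAl.
  by rewrite pair_bigA pair_bigA /=; apply: eq_bigr => -[[]].
apply/polyP => t; rewrite coef0; have [tm|mt] := ltnP t (3 * m); last first.
  rewrite nth_default // (leq_trans (size_on_ray _ _ _ _ _)) // (leq_trans _ mt) //.
  by move: dF; lia.
rewrite evE coef_sum -[RHS](hc (b, Ordinal tm)); apply: eq_bigr => a _.
by rewrite coefZ /M /= bE.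
Qed.

End Interpolation.

Section Greedy.

Variables (I J : finType) (E : I -> J -> bool).
Implicit Types (R S : {set I}) (B : {set J}).

(** A pair maximising the number of edges plus [T] times the number of deleted vertices: deleting a
    vertex of degree below [T] would increase this quantity. The maximum exceeds its value at empty
    edge sets because the full graph already does. *)
Lemma prune T : (T * (#|I| + #|J|) < edges E setT setT)%N ->
  exists (R : {set I}) (B : {set J}), [/\ R != set0, B != set0,
    forall j, j \in B -> (T <= #|[set i in R | E i j]|)%N &
    forall i, i \in R -> (T <= #|[set j in B | E i j]|)%N].
Proof.
move=> big; pose phi (X : {set I} * {set J}) := (edges E X.1 X.2 + T * (#|~: X.1| + #|~: X.2|))%N.
have [[R B] _ /= mx] := arg_maxnP phi (isT : xpredT (setT, setT)).
have mx' X : (phi X <= phi (R, B))%N by apply: mx.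
have e0 : (0 < edges E R B)%N.
  have := mx' (setT, setT); rewrite /phi /= !setCT !cards0 muln0 addn0.
  have : (#|~: R| <= #|I|)%N by exact: max_card.
  have : (#|~: B| <= #|J|)%N by exact: max_card.
  move: big; move: (edges E setT setT) (edges E R B) => a b; nia.
exists R, B; split.
- by apply: contraTneq e0 => ->; rewrite edgesE /edges big_set0.
- by apply: contraTneq e0 => ->; rewrite /edges big_set0.
- move=> j jB; have := mx' (R, B :\ j); rewrite /phi /=.
  have -> : edges E R B = (#|[set i in R | E i j]| + edges E R (B :\ j))%N.
    by rewrite /edges (big_setD1 j).
  have := cardsC B; have := cardsC (B :\ j); have := cardsD1 j B; rewrite jB.
  move: #|B| #|B :\ j| #|~: B| #|~: (B :\ j)| #|J| (edges _ _ _) => a b c d e f; nia.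
- move=> i iR; have := mx' (R :\ i, B); rewrite /phi /=.
  have -> : edges E R B = (#|[set j in B | E i j]| + edges E (R :\ i) B)%N.
    by rewrite !edgesE (big_setD1 i).
  have := cardsC R; have := cardsC (R :\ i); have := cardsD1 i R; rewrite iR.
  move: #|R| #|R :\ i| #|~: R| #|~: (R :\ i)| #|I| (edges _ _ _) => a b c d e f; nia.
Qed.

(* Potential argument: as long as a quarter of B has fewer than D neighbours in
   S, some new vertex of R is adjacent to many of these. *)
Lemma greedy R B T D n : (D < T)%N -> (0 < #|R|)%N ->
  (forall j, j \in B -> (T <= #|[set i in R | E i j]|)%N) ->
  exists S : {set I}, [/\ S \subset R, (#|S| <= n)%N &
    (3 * #|B| <= 4 * #|[set j in B | (D <= #|[set i in S | E i j]|)%N]|)%N \/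
    (n * ((T - D) * #|B|) <= 4 * #|R| * \sum_(j in B) minn #|[set i in S | E i j]| D)%N].
Proof.
move=> DT R0 hT; elim: n => [|n [S [SR Sn [hS|hS]]]].
- by exists set0; rewrite sub0set cards0; split=> //; right; rewrite mul0n.
- by exists S; split=> //; [exact: leqW|left].
have [good|bad] := leqP (3 * #|B|) (4 * #|[set j in B | (D <= #|[set i in S | E i j]|)%N]|).
  by exists S; split=> //; [exact: leqW|left].
pose Bd := [set j in B | (#|[set i in S | E i j]| < D)%N].
have cBd : (#|B| < 4 * #|Bd|)%N.
  move: bad; set G := [set j in B | _].
  have : #|B| = (#|G| + #|Bd|)%N.
    rewrite -(cardsID [set j | (D <= #|[set i in S | E i j]|)%N] B).
    by congr (_ + _)%N; apply: eq_card => j; rewrite !inE // -ltnNge andbC.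
  by move: #|B| #|G| #|Bd| => a b c; lia.
have edge_lb : ((T - D) * #|Bd| <= edges E (R :\: S) Bd)%N.
  rewrite mulnC -sum_nat_const; apply: leq_sum => j; rewrite inE => /andP[jB ltD].
  have := hT j jB; have -> : [set i in R | E i j] = [set i in S | E i j] :|: [set i in R :\: S | E i j].
    apply/setP => i; rewrite !inE; have := subsetP SR i.
    by case: (i \in S) => [/(_ isT)->|_] //=; rewrite ?orbF.
  move=> /leq_trans/(_ (leq_card_setU _ _)).
  by move: #|[set i in S | _]| #|[set i in R :\: S | _]| ltD => x y; lia.
(* Averaging over R \ S: every vertex of [Bd] still has at least T - D neighbours there, and [Bd] is
   more than a quarter of B. *)
have [i iRS gain] : exists2 i, i \in R :\: S &
    ((T - D) * #|B| <= 4 * #|R| * #|[set j in Bd | E i j]|)%N.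
  apply/exists_inP; apply: contraT => /exists_inPn none.
  have : (4 * #|R| * edges E (R :\: S) Bd <= #|R| * ((T - D) * #|B|))%N.
    rewrite edgesE big_distrr /=; apply: (@leq_trans (\sum_(i in R :\: S) (T - D) * #|B|)).
      by apply: leq_sum => i /none; rewrite -ltnNge => /ltnW.
    by rewrite sum_nat_const leq_mul2r subset_leq_card ?subsetDl ?orbT.
  rewrite leqNgt => /negP[]; apply: (@leq_trans (4 * #|R| * ((T - D) * #|Bd|))); last by rewrite leq_mul2l edge_lb orbT.
  have -> : (4 * #|R| * ((T - D) * #|Bd|) = #|R| * ((T - D) * (4 * #|Bd|)))%N by lia.
  by rewrite ltn_pmul2l // ltn_pmul2l // subn_gt0.
exists (i |: S); move: (iRS); rewrite inE => /andP[iS iR]; split.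
- by rewrite subUset sub1set iR.
- by rewrite cardsU1 iS add1n.
right; rewrite mulSn; apply: leq_trans (leq_add gain hS) _; rewrite -mulnDr leq_mul2l; apply/orP; right.
rewrite card_setIdE big_mkcond [X in (_ + X <= _)%N]big_mkcond [leqRHS]big_mkcond -big_split /=.
apply: leq_sum => j _; rewrite inE; case: (j \in B) => //=.
have -> : #|[set i' in i |: S | E i' j]| = (E i j + #|[set i' in S | E i' j]|)%N.
  case e : (E i j).
    have -> : [set i' in i |: S | E i' j] = i |: [set i' in S | E i' j].
      by apply/setP => i'; rewrite !inE; case: eqP => // ->; rewrite e.
    by rewrite cardsU1 inE (negPf iS).
  rewrite add0n; congr #|pred_of_set _|; apply/setP => i'; rewrite !inE.
  by case: eqP => // ->; rewrite e (negPf iS).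
case: ltnP; case: (E i j); lia.
Qed.

End Greedy.

(* [m] is about 72 r / T, the degree in each variable of a polynomial vanishing on
   the sampled rays; 76 = 72 + 4, and the lower bound for [K] makes 28 m at most
   the square root of r. *)
Section DegreeChoice.

Variables (r N T p m K : nat).
Hypotheses (K2 : (28 * 28 * (76 * 76) <= K)%N) (T0 : (0 < T)%N) (Tr : (T <= r)%N) (rN : (r <= N)%N).
Hypotheses (NT : (K * N <= T * T)%N).
Hypotheses (m4 : (4 <= m)%N) (mlo : ((m - 4) * T <= 72 * r)%N).

Lemma degree_linear : (m * T <= 76 * r)%N.
Proof.
have : (m * T = (m - 4) * T + 4 * T)%N by rewrite -mulnDl subnK.
move: mlo Tr; lia.
Qed.

Lemma degree_square : (m * m * K <= 76 * 76 * r)%N.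
Proof.
have r0 : (0 < r)%N by lia.
rewrite -(leq_pmul2r r0); apply: (@leq_trans (m * m * (T * T))).
  by rewrite -mulnA leq_mul2l (leq_trans _ NT) ?orbT // leq_mul2l rN orbT.
have := leq_mul degree_linear degree_linear; lia.
Qed.

Lemma degree_small : (m * K <= 76 * T)%N.
Proof.
rewrite -(leq_pmul2r T0); apply: (@leq_trans (76 * r * K)).
  by have := leq_mul degree_linear (leqnn K); lia.
by rewrite -mulnA -[leqRHS]mulnA leq_mul2l (leq_trans _ NT) ?orbT // mulnC leq_mul2l rN orbT.
Qed.

Lemma degree_le_T : (600 * m <= T)%N.
Proof.
have := degree_small; have := leq_mul (leqnn m) K2; move=> h1 h2.
have : (m * (28 * 28 * (76 * 76)) <= 76 * T)%N by exact: leq_trans h1 h2.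
lia.
Qed.

Lemma degree_special : (784 * (m * m) <= r)%N.
Proof.
have := degree_square; have := leq_mul (leqnn (m * m)) K2 => h1 h2.
have : (m * m * (28 * 28 * (76 * 76)) <= 76 * 76 * r)%N by exact: leq_trans h1 h2.
lia.
Qed.

Lemma degree_char : (N <= p * p)%N -> (6 * m + 2 <= p)%N.
Proof.
move=> Np; suff : (28 * m <= p)%N by lia.
rewrite -(@leq_exp2r _ _ 2) // -!mulnn.
apply: leq_trans (leq_trans rN Np); have := degree_special; lia.
Qed.

Hypothesis mhi : (72 * r < (m - 3) * T)%N.

(** [n] is the largest sample size that interpolation allows. With D = 3(m - 1) + 1, one more than
    the degree on a ray, the second inequality rules out the second alternative of [greedy]. *)
Lemma degree_steps n : n = ((m * m - 1) %/ 3)%N ->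
  (n * 3 < m * m)%N /\ (4 * r * (3 * m.-1).+1 < n * (T - (3 * m.-1).+1))%N.
Proof.
move=> nE; have nlo : (n * 3 <= m * m - 1)%N by rewrite nE leq_divM.
have mm : (16 <= m * m)%N by have := leq_mul m4 m4.
split; first by lia.
have nhi : (m * m <= n * 3 + 3)%N.
  by have := ltn_ceil (m * m - 1) (isT : 0 < 3)%N; rewrite -nE; lia.
have dT := degree_le_T; set D := (3 * m.-1).+1.
have D3 : (D <= 3 * m)%N by rewrite /D; lia.
have TD : (9 * T <= 10 * (T - D))%N by lia.
have lhs : (120 * r * D <= 5 * m * ((m - 3) * T))%N.
  apply: (@leq_trans (5 * m * (72 * r))); last by rewrite leq_mul2l (ltnW mhi) orbT.
  have : (r * D <= r * (3 * m))%N by rewrite leq_mul2l D3 orbT.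
  lia.
have rhs : ((m * m - 3) * (9 * T) <= 30 * (n * (T - D)))%N.
  apply: (@leq_trans (n * 3 * (10 * (T - D)))); first by apply: leq_mul; lia.
  by lia.
have mid : (5 * m * (m - 3) < (m * m - 3) * 9)%N.
  by rewrite -mulnA mulnBr; lia.
have mid' : (5 * m * ((m - 3) * T) < (m * m - 3) * (9 * T))%N.
  have -> : ((m * m - 3) * (9 * T) = (m * m - 3) * 9 * T)%N by lia.
  by rewrite mulnA ltn_pmul2r.
lia.
Qed.

End DegreeChoice.

(** * The incidence bound for two families of rays *)

Section Incidence.

Variables (k : fieldType) (s : k) (p : nat).
Hypothesis charp : forall n, (0 < n < p)%N -> n%:R != 0 :> k.
Notation P3 := {poly {poly {poly k}}}.

Section Asymmetric.

Variables (I J : finType) (r : family k I) (b : family k J).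
Variables (E : I -> J -> bool) (z : I -> J -> k) (kappa : nat).
Hypothesis C : crossing s r b E z kappa.

Lemma vanishing_edges (F : P3) (R : {set I}) (B : {set J}) : F != 0 -> (2 * tdeg F + 2 <= p)%N ->
  (forall j, j \in B -> ray s b j F = 0) ->
  exists B0 : {set J}, [/\ B0 \subset B, (#|B0| <= 20 * tdeg F ^ 2)%N &
    (edges E R (B :\: B0) <= tdeg F * #|R| + (4 * tdeg F + kappa) * #|B|)%N].
Proof.
move=> F0 Fp hB.
have fac : factorial_dom {poly {poly {poly k}}}.
  by do 3!apply: factorial_poly; exact: factorial_field.
have [u [ps [uU psP FE]]] := fac F F0.
have u0 : u != 0 by apply: contraNneq F0 => u0; rewrite FE u0 mul0r.
have tdp (qs : seq P3) : (forall x, x \in qs -> prime_elt x) ->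
    \prod_(x <- qs) x != 0 /\ (\sum_(x <- qs) tdeg x <= tdeg (\prod_(x <- qs) x))%N.
  elim: qs => [|x qs IHqs] qsP; rewrite ?big_nil ?big_cons; first by rewrite oner_eq0.
  have [|q0 qt] := IHqs; first by move=> y yq; apply: qsP; rewrite inE yq orbT.
  have [x0 _ _] : prime_elt x by apply: qsP; rewrite mem_head.
  by rewrite mulf_neq0 // tdegM // leq_add2l.
have [ps0 pst] := tdp ps psP.
have tF : (\sum_(x <- ps) tdeg x <= tdeg F)%N by rewrite FE tdegM // (leq_trans pst) ?leq_addl.
have [|j jB|B0 [sB0 cB0 eB0]] := prime_product_edges charp C R (B := B) psP.
- by rewrite (leq_trans _ Fp) // leq_add2r leq_mul2l tF.
- have := hB j jB; rewrite FE /ray rayM => /eqP; rewrite mulf_eq0 => /orP[/eqP ru0|/eqP//].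
  have [v vu] := unitrP uU; have := congr1 (ray s b j) vu.2.
  rewrite /ray rayM ru0 mul0r -(kc1 k) ray_kc => /eqP.
  by rewrite eq_sym polyC_eq0 oner_eq0.
exists B0; split=> //.
  by rewrite (leq_trans cB0) // leq_mul2l leq_exp2r.
rewrite (leq_trans eB0) // leq_add ?leq_mul2r ?tF ?orbT //.
by rewrite leq_add2r leq_mul2l tF !orbT.
Qed.

(** A polynomial vanishing on the sample [S] vanishes on three quarters of B. After removal of the
    exceptional rays half of B remains, where degrees at least [T] contradict [vanishing_edges]. *)
Lemma no_dense_pair (R : {set I}) (B : {set J}) N T K : (28 * 28 * (76 * 76) <= K)%N ->
  (0 < T)%N -> (0 < #|B|)%N ->
  (#|R| <= #|B|)%N -> (#|R| <= N)%N -> (K * N <= T * T)%N -> (N <= p * p)%N ->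
  (8 * kappa <= T)%N ->
  ~ (forall j, j \in B -> (T <= #|[set i in R | E i j]|)%N).
Proof.
move=> K2 T0 B0 RB RN NT Np kT hT.
have Tr : (T <= #|R|)%N.
  have [j jB] : exists j, j \in B by apply/set0Pn; rewrite -card_gt0.
  apply: leq_trans (hT j jB) _; apply/subset_leq_card/subsetP => i.
  by rewrite inE => /andP[].
pose m := (72 * #|R| %/ T + 4)%N.
have m4 : (4 <= m)%N by exact: leq_addl.
have mlo : ((m - 4) * T <= 72 * #|R|)%N by rewrite addnK leq_divM.
have mhi : (72 * #|R| < (m - 3) * T)%N by rewrite /m -addnBA // subSn // subnn addn1 ltn_ceil.
have mT := degree_le_T K2 T0 Tr RN NT m4 mlo.
have mr := degree_special K2 T0 Tr RN NT m4 mlo.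
have mp := degree_char K2 T0 Tr RN NT m4 mlo Np.
have [n3 nD] := degree_steps K2 T0 Tr RN NT m4 mlo mhi (erefl _).
move: n3 nD; set n := (_ %/ 3)%N; set D := (3 * m.-1).+1 => n3 nD.
have DT : (D < T)%N by rewrite /D; lia.
have R0 : (0 < #|R|)%N by lia.
have [S [SR Sn good]] := greedy n DT R0 hT.
have {}good : (3 * #|B| <= 4 * #|[set j in B | (D <= #|[set i in S | E i j]|)%N]|)%N.
  case: good => // bad; exfalso; move: bad; apply/negP; rewrite -ltnNge.
  apply: (@leq_ltn_trans (4 * #|R| * (D * #|B|))).
    rewrite leq_mul2l; apply/orP; right; rewrite mulnC -sum_nat_const.
    by apply: leq_sum => j _; exact: geq_minr.
  by rewrite !mulnA ltn_pmul2r // -mulnA mulnA.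
have [||F [F0 dF hF]] := @interpolation k s I r S m; [by lia| |].
  by apply: leq_ltn_trans n3; rewrite leq_mul2r Sn orbT.
move: good; set B1 := [set j in B | _] => good.
have B1F j : j \in B1 -> ray s b j F = 0.
  rewrite inE => /andP[jB hD]; apply/eqP; apply: contraTT hD => bF0; rewrite -ltnNge ltnS.
  apply: (card_cross_roots C (Q := ray s b j F) (j := j)) => //.
    by apply: leq_trans (size_ray _ _ _ _) dF.
  by move=> i; rewrite inE => /andP[/hF rF e]; split=> //; rewrite -(cross_eval C) // rF horner0.
have [|B2 [sB2 cB2 eB2]] := @vanishing_edges F R B1 F0 _ B1F; first by lia.
have lb : (T * #|B1 :\: B2| <= edges E R (B1 :\: B2))%N.
  rewrite mulnC -sum_nat_const; apply: leq_sum => j; rewrite !inE => /and3P[_ jB _].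
  exact: hT.
have cB : (#|B1 :\: B2| = #|B1| - #|B2|)%N by rewrite cardsD (setIidPr sB2).
have B1B : (#|B1| <= #|B|)%N by apply/subset_leq_card/subsetP => j; rewrite inE => /andP[].
(* Here 4 * 20 * (3m)^2 = 720 m^2, which is at most 28^2 m^2, hence at most |R| and |B|. *)
have cB2' : (4 * #|B2| <= #|B|)%N.
  have : (tdeg F ^ 2 <= 9 * (m * m))%N.
    have -> : (9 * (m * m) = (3 * m) ^ 2)%N by rewrite expnMn -mulnn.
    by rewrite leq_exp2r // (leq_trans dF) // leq_mul2l leq_pred orbT.
  by lia.
have half : (#|B| <= 2 * #|B1 :\: B2|)%N by lia.
have d3 : (tdeg F <= 3 * m)%N by rewrite (leq_trans dF) // leq_mul2l leq_pred orbT.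
have ub : (T * #|B1 :\: B2| <= (5 * tdeg F + kappa) * #|B|)%N.
  apply: leq_trans lb (leq_trans eB2 _).
  have h1 : (tdeg F * #|R| <= tdeg F * #|B|)%N by rewrite leq_mul2l RB orbT.
  have h2 : ((4 * tdeg F + kappa) * #|B1| <= (4 * tdeg F + kappa) * #|B|)%N by rewrite leq_mul2l B1B orbT.
  apply: leq_trans (leq_add h1 h2) _; rewrite -mulnDl leq_mul2r; apply/orP; right; lia.
have : (T * #|B| <= 2 * (5 * tdeg F + kappa) * #|B|)%N.
  apply: (@leq_trans (T * (2 * #|B1 :\: B2|))); first by rewrite leq_mul2l half orbT.
  by rewrite mulnCA -mulnA leq_mul2l ub.
(* Now T is at most 30 m + 2 kappa, which is at most T/20 + T/4. *)
rewrite leq_pmul2r // => hfin; lia.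
Qed.

End Asymmetric.

(** The polynomial is built from the smaller side, so that the exceptional rays are few on the
    larger one. After pruning either side can be the smaller, hence both orientations of
    [crossing]. *)
Lemma incidence_bound (I J : finType) (r : family k I) (b : family k J)
    (E : I -> J -> bool) (z : I -> J -> k) (kappa N T K : nat) :
  crossing s r b E z kappa ->
  crossing s b r (fun j i => E i j) (fun j i => z i j) kappa ->
  (28 * 28 * (76 * 76) <= K)%N -> (0 < T)%N -> (#|I| <= N)%N -> (#|J| <= N)%N ->
  (K * N <= T * T)%N -> (N <= p * p)%N -> (8 * kappa <= T)%N ->
  (edges E setT setT <= T * (#|I| + #|J|))%N.
Proof.
move=> C C' K2 T0 IN JN NT Np kT; rewrite leqNgt; apply/negP => big.
have [R [B [R0 B0 hB hR]]] := prune big.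
have [RB|/ltnW BR] := leqP #|R| #|B|.
  apply: (no_dense_pair C K2 T0 _ RB _ NT Np kT hB); first by rewrite card_gt0.
  by rewrite (leq_trans _ IN) // max_card.
apply: (no_dense_pair C' K2 T0 _ BR _ NT Np kT hR); first by rewrite card_gt0.
by rewrite (leq_trans _ JN) // max_card.
Qed.

End Incidence.

(** * Rays attached to a set invariant under dilations *)

Section GenericModel.

Variables (F : finFieldType) (k : fieldType) (h : {rmorphism F -> k}) (t : k).
Hypothesis indep : forall u0 u1 u2 u3 u4 u5 : F,
  h u0 + h u1 * t + h u2 * t ^+ 2 + h u3 * t ^+ 3 + h u4 * t ^+ 4 + h u5 * t ^+ 5 = 0 ->
  [/\ u0 = 0, u1 = 0, u2 = 0, u3 = 0 & u4 = 0 /\ u5 = 0].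

Variables (A C : {set F}).
Hypotheses (C0 : 0 \notin C) (CA : (#|C| <= #|A|)%N).

(* The triple (a, c, b) stands for the ray of direction c through a and b. *)
Definition triples : {set F * F * F} :=
  [set x | [&& x.1.1 \in A, x.1.2 \in C & x.2 \in A]].
Notation Q := 'I_#|triples|.
Let ra (i : Q) : F := (enum_val i).1.1.
Let rc (i : Q) : F := (enum_val i).1.2.
Let rb (i : Q) : F := (enum_val i).2.

(** The second condition excludes crossings in the plane y = 0, where rays of one colour can still
    be concurrent. *)
Definition meets (x y : F * F * F) : bool :=
  (x.1.1 - y.1.1 == x.1.2 * y.2 - y.1.2 * x.2) && (x.1.1 != y.1.1).

Let E (i j : Q) := meets (enum_val i) (enum_val j).

(* The scaling by powers of the generic [t] keeps the incidences between the
   red and the blue rays but makes rays of the same colour disjoint off y = 0. *)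
Definition red : family k Q :=
  Family (fun i => h (rc i)) (fun i => t ^+ 2 * h (ra i)) (fun i => t * h (rb i)).
Definition blue : family k Q :=
  Family (fun i => t * h (rc i)) (fun i => t ^+ 2 * h (ra i)) (fun i => t ^+ 2 * h (rb i)).
Let z (i j : Q) := (fb red i - fb blue j) / (dir red i - dir blue j).

Lemma rc_neq0 i : rc i != 0.
Proof.
have := enum_valP i; rewrite inE => /and3P[_ cC _].
by apply: contraNneq C0 => <-.
Qed.
Lemma rcC i : rc i \in C. Proof. by have := enum_valP i; rewrite inE => /and3P[]. Qed.
Lemma rbA i : rb i \in A. Proof. by have := enum_valP i; rewrite inE => /and3P[]. Qed.

Lemma triple_eq i j : ra i = ra j -> rc i = rc j -> rb i = rb j -> i = j.
Proof.
rewrite /ra /rc /rb => ea ec eb; apply: enum_val_inj.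
by case: (enum_val i) (enum_val j) ea ec eb => [[? ?] ?] [[? ?] ?] /= -> -> ->.
Qed.

Lemma h_inj : injective h. Proof. exact: fmorph_inj. Qed.

Lemma t_neq0 : t != 0.
Proof.
apply/eqP => t0; have [] := @indep 0 1 0 0 0 0.
  by rewrite !rmorph0 t0 !mul0r mulr0 !addr0.
by move=> _ /eqP; rewrite oner_eq0.
Qed.

Lemma dir_neq i j : dir red i - dir blue j != 0.
Proof.
rewrite /=; apply/eqP => e; have [] := @indep (rc i) (- rc j) 0 0 0 0.
  by rewrite !rmorph0 !mul0r !addr0 rmorphN mulNr mulrC.
by move=> ci; have := rc_neq0 i; rewrite ci eqxx.
Qed.

Lemma zE i j : z i j * (dir red i - dir blue j) = fb red i - fb blue j.
Proof. by rewrite /z divfK // dir_neq. Qed.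

Lemma meetsE i j : E i j -> ra i - ra j = rc i * rb j - rc j * rb i /\ ra i != ra j.
Proof. by case/andP=> /eqP. Qed.

(** Equality of the two parameters is a polynomial identity in [t]. Its coefficients, combined with
    the two meeting equations, determine a, then c (here a != a' is needed), then b (here c !=
    0). *)
Lemma z_injl i i' j : E i j -> E i' j -> z i j = z i' j -> i = i'.
Proof.
move=> /meetsE[e n] /meetsE[e' _] zz; have z1 := zE i j; have := zE i' j; rewrite -zz => z2.
have cr : (fb red i - fb blue j) * (dir red i' - dir blue j)
    = (fb red i' - fb blue j) * (dir red i - dir blue j) by rewrite -z1 -z2; ring.
have [|_ u1 u2 _ _] := @indep 0 (rb i * rc i' - rb i' * rc i)
   (rb i' * rc j - rb i * rc j - rb j * rc i' + rb j * rc i) 0 0 0.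
  rewrite !rmorph0 !(rmorphB, rmorphD, rmorphM) /= -[RHS](subrr ((fb red i' - fb blue j) * (dir red i - dir blue j))).
  by rewrite -{1}cr /=; ring.
have ea : ra i = ra i'.
  apply/eqP; rewrite -subr_eq0 -u2; apply/eqP.
  have -> : ra i - ra i' = (ra i - ra j) - (ra i' - ra j) by ring.
  rewrite e e'; ring.
have ec : rc i = rc i'.
  have n0 : ra i - ra j != 0 by rewrite subr_eq0.
  apply: (mulIf n0); rewrite {1}ea e' e; apply/eqP; rewrite -subr_eq0.
  by rewrite -[X in _ == X](mulr0 (rc j)) -u1; apply/eqP; ring.
apply: triple_eq => //; apply: (mulIf (rc_neq0 i)); apply/eqP.
by rewrite -subr_eq0 {1}ec u1.
Qed.

Lemma z_injr i j j' : E i j -> E i j' -> z i j = z i j' -> j = j'.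
Proof.
move=> /meetsE[e n] /meetsE[e' _] zz; have z1 := zE i j; have := zE i j'; rewrite -zz => z2.
have cr : (fb red i - fb blue j) * (dir red i - dir blue j')
    = (fb red i - fb blue j') * (dir red i - dir blue j) by rewrite -z1 -z2; ring.
have [|_ _ u1 u2 _] := @indep 0 0 (rb i * rc j - rb i * rc j' - rb j * rc i + rb j' * rc i)
   (rb j * rc j' - rb j' * rc j) 0 0.
  rewrite !rmorph0 !(rmorphB, rmorphD, rmorphM) /= -[RHS](subrr ((fb red i - fb blue j') * (dir red i - dir blue j))).
  by rewrite -{1}cr /=; ring.
have ea : ra j = ra j'.
  apply/eqP; rewrite -subr_eq0 -u1; apply/eqP.
  have -> : ra j - ra j' = (ra i - ra j') - (ra i - ra j) by ring.
  rewrite e e'; ring.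
have ec : rc j = rc j'.
  have n0 : ra i - ra j != 0 by rewrite subr_eq0.
  apply: (mulIf n0); rewrite {1}ea e' e; apply/eqP; rewrite -subr_eq0.
  by rewrite -[X in _ == X](mulr0 (- rc i)) -u2; apply/eqP; ring.
apply: triple_eq => //; apply: (mulIf (rc_neq0 j)); apply/eqP.
by rewrite -subr_eq0 {1}ec u2.
Qed.

(** With this shear the terms a, b, cb of the constant coefficient of [rayX] carry distinct powers
    of [t], up to t^5, and so do the terms c, c^2 of the linear one. Hence [rayX] determines the
    triple. *)
Let s := t ^+ 3.

Lemma z_rayY i j : (rayY (dir red i) (fb red i)).[z i j] = (rayY (dir blue j) (fb blue j)).[z i j].
Proof.
rewrite /rayY !(hornerD, hornerN, hornerM, hornerC, hornerX).
apply/eqP; rewrite -subr_eq0; apply/eqP.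
by rewrite -[RHS](subrr (fb red i - fb blue j)) -{2}zE; ring.
Qed.

Lemma z_rayX i j : E i j -> (rayX s (dir red i) (fa red i) (fb red i)).[z i j] =
  (rayX s (dir blue j) (fa blue j) (fb blue j)).[z i j].
Proof.
move=> /meetsE[/(congr1 h) he _]; move: he; rewrite !(rmorphB, rmorphM) /= => he.
have rE c a b x : (rayX s c a b).[x] = a + (s - c) * (rayY c b).[x].
  by rewrite /rayX /rayY !(hornerD, hornerN, hornerM, hornerC, hornerX); ring.
rewrite !rE -z_rayY; set y := (rayY _ _).[_].
have yE : (dir red i - dir blue j) * y = fa red i - fa blue j.
  rewrite /y /rayY !(hornerD, hornerN, hornerM, hornerC, hornerX).
  have -> : fa red i - fa blue j = (dir red i - dir blue j) * fb red i
      - dir red i * (fb red i - fb blue j).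
    have -> : fa red i - fa blue j = t ^+ 2 * (h (ra i) - h (ra j)) by rewrite /=; ring.
    by rewrite he /=; ring.
  by rewrite -(zE i j) /=; ring.
apply/eqP; rewrite -subr_eq0; apply/eqP.
by rewrite -[RHS](subrr ((dir red i - dir blue j) * y)) {1}yE /=; ring.
Qed.

Lemma red_rayX : injective (fun i => rayX s (dir red i) (fa red i) (fb red i)).
Proof.
move=> i j e; have e0 := congr1 (fun q : {poly k} => q`_0) e.
have e1 := congr1 (fun q : {poly k} => q`_1) e.
move: e0 e1; rewrite /rayX !coefD !coefC !coefMX !coefC /= !addr0 !add0r => e0 e1.
have [|_ _ _ /subr0_eq ec _] := @indep (rc i * rc i - rc j * rc j) 0 0 (rc j - rc i) 0 0.
  rewrite !rmorph0 !(rmorphB, rmorphM) -[RHS](subrr (h (rc j) ^+ 2 - s * h (rc j))).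
  by rewrite -{1}e1 /s; ring.
have [|_ _ /subr0_eq ea _ [/subr0_eq eb _]] := @indep 0 (rc i * rb j - rc i * rb i)
    (ra i - ra j) 0 (rb i - rb j) 0.
  rewrite !rmorph0 !(rmorphB, rmorphM) -[RHS](subrr (t ^+ 2 * h (ra j) - h (rc j) * (t * h (rb j)) + s * (t * h (rb j)))).
  by rewrite -{1}e0 ec /s; ring.
exact: triple_eq.
Qed.

Lemma blue_rayX : injective (fun i => rayX s (dir blue i) (fa blue i) (fb blue i)).
Proof.
move=> i j e; have e0 := congr1 (fun q : {poly k} => q`_0) e.
have e1 := congr1 (fun q : {poly k} => q`_1) e.
move: e0 e1; rewrite /rayX !coefD !coefC !coefMX !coefC /= !addr0 !add0r => e0 e1.
have [|_ _ _ _ [/subr0_eq ec _]] := @indep 0 0 (rc i * rc i - rc j * rc j) 0 (rc j - rc i) 0.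
  rewrite !rmorph0 !(rmorphB, rmorphM) -[RHS](subrr ((t * h (rc j)) ^+ 2 - s * (t * h (rc j)))).
  by rewrite -{1}e1 /s; ring.
have [|_ _ /subr0_eq ea _ [_ /subr0_eq eb]] := @indep 0 0
    (ra i - ra j) (rc i * rb j - rc i * rb i) 0 (rb i - rb j).
  rewrite !rmorph0 !(rmorphB, rmorphM) -[RHS](subrr (t ^+ 2 * h (ra j) - t * h (rc j) * (t ^+ 2 * h (rb j)) + s * (t ^+ 2 * h (rb j)))).
  by rewrite -{1}e0 ec /s; ring.
exact: triple_eq.
Qed.

(** If c1 = 0, all directions agree, and b determines the ray. If c1 != 0, the direction determines
    the parameter and thereby the ray, which leaves at most |C| of them. *)
Lemma kappa_bound (S : {set Q}) (dr zz : Q -> k) (d c0 c1 : k) :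
  (forall i, i \in S -> (c0 + c1 * zz i) * (dr i - d) = 1) ->
  {in S &, injective zz} -> (forall i j, dr i = dr j <-> rc i = rc j) ->
  (forall i j, i \in S -> j \in S -> rc i = rc j -> rb i = rb j -> i = j) ->
  (#|S| <= #|A|)%N.
Proof.
move=> hS zi dc bi; have [c10|c1n0] := eqVneq c1 0.
  rewrite -(card_in_imset (f := rb)); first by apply/subset_leq_card/subsetP => _ /imsetP[i _ ->]; exact: rbA.
  move=> i j iS jS; apply: bi => //; apply/dc.
  have := hS i iS; have := hS j jS; rewrite c10 !mul0r !addr0 => hj hi.
  have c00 : c0 != 0 by apply: contra_eq_neq hi => ->; rewrite mul0r eq_sym oner_eq0.
  by apply: (addIr (- d)); apply: (mulfI c00); rewrite hi hj.
apply: leq_trans CA.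
rewrite -(card_in_imset (f := rc)); first by apply/subset_leq_card/subsetP => _ /imsetP[i _ ->]; exact: rcC.
move=> i j iS jS /dc dd; apply: zi => //.
have := hS i iS; have hj := hS j jS; rewrite -hj dd.
have n0 : dr j - d != 0 by apply: contra_eq_neq hj => ->; rewrite mulr0 eq_sym oner_eq0.
by move/(mulIf n0)/addrI/(mulfI c1n0).
Qed.

Lemma red_dirE i j : dir red i = dir red j <-> rc i = rc j.
Proof. by split=> [/h_inj|/= ->]. Qed.
Lemma blue_dirE i j : dir blue i = dir blue j <-> rc i = rc j.
Proof. by split=> [/(mulfI t_neq0)/h_inj|/= ->]. Qed.

Lemma crossing_red_blue : crossing s red blue E z #|A|.
Proof.
split.
- exact: z_rayX.
- by move=> i j _; exact: z_rayY.
- by move=> i j _; rewrite -subr_eq0 dir_neq.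
- exact: z_injl.
- exact: z_injr.
- exact: blue_rayX.
- move=> j c0 c1; apply: (@kappa_bound _ (dir red) (z^~ j) (dir blue j) c0 c1).
  + by move=> i; rewrite inE => /andP[_ /eqP].
  + by move=> i i'; rewrite !inE => /andP[e _] /andP[e' _]; exact: z_injl.
  + exact: red_dirE.
  + move=> i i'; rewrite !inE => /andP[/meetsE[e _] _] /andP[/meetsE[e' _] _] ec eb.
    apply: triple_eq => //; apply: (addIr (- ra j)); rewrite e e' ec eb //.
Qed.

Lemma crossing_blue_red : crossing s blue red (fun j i => E i j) (fun j i => z i j) #|A|.
Proof.
split.
- by move=> i j e; rewrite z_rayX.
- by move=> i j _; rewrite z_rayY.
- by move=> i j _; rewrite eq_sym -subr_eq0 dir_neq.
- by move=> i i' j; exact: z_injr.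
- by move=> i j j'; exact: z_injl.
- exact: red_rayX.
- move=> j c0 c1; apply: (@kappa_bound _ (dir blue) (z j) (dir red j) c0 c1).
  + by move=> i; rewrite inE => /andP[_ /eqP].
  + by move=> i i'; rewrite !inE => /andP[e _] /andP[e' _]; exact: z_injr.
  + exact: blue_dirE.
  + move=> i i'; rewrite !inE => /andP[/meetsE[e _] _] /andP[/meetsE[e' _] _] ec eb.
    apply: triple_eq => //; apply: oppr_inj; apply: (addrI (ra j)); rewrite e e' ec eb //.
Qed.

Lemma meets_bound p T K : (forall n, (0 < n < p)%N -> n%:R != 0 :> F) ->
  (28 * 28 * (76 * 76) <= K)%N -> (0 < T)%N -> (K * #|triples| <= T * T)%N ->
  (#|triples| <= p * p)%N -> (8 * #|A| <= T)%N ->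
  (\sum_(x in triples) \sum_(y in triples) meets x y <= 2 * T * #|triples|)%N.
Proof.
move=> charp K2 T0 NT Np kT.
have charp' n : (0 < n < p)%N -> n%:R != 0 :> k.
  by move=> /charp; rewrite -(rmorph_nat h) fmorph_eq0.
have cQ : (#|{: Q}| <= #|triples|)%N by rewrite card_ord.
have := incidence_bound charp' crossing_red_blue crossing_blue_red K2 T0 cQ cQ NT Np kT.
rewrite card_ord addnn -mul2n mulnCA mulnA => /(leq_trans _); apply.
rewrite edgesE big_enum_val [leqRHS](eq_bigl xpredT) => [|i]; last by rewrite inE.
apply: leq_sum => i _; rewrite card_setIdE big_enum_val.
by rewrite [leqRHS](eq_bigl xpredT) // => j; rewrite inE.
Qed.

End GenericModel.

(** * Additive energy *)

Section FiniteSums.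

Variable R : rcfType.

Lemma cauchy_schwarz (I : finType) (u v : I -> R) :
  (\sum_i u i * v i) ^+ 2 <= (\sum_i u i ^+ 2) * (\sum_i v i ^+ 2).
Proof.
rewrite -subr_ge0.
have -> : (\sum_i u i ^+ 2) * (\sum_i v i ^+ 2) - (\sum_i u i * v i) ^+ 2
    = 2^-1 * \sum_i \sum_j (u i * v j - u j * v i) ^+ 2.
  have -> : \sum_i \sum_j (u i * v j - u j * v i) ^+ 2 =
      \sum_i \sum_j (u i ^+ 2 * v j ^+ 2) + \sum_i \sum_j (v i ^+ 2 * u j ^+ 2)
      - 2 * \sum_i \sum_j ((u i * v i) * (u j * v j)).
    rewrite mulr_sumr -big_split /= -sumrB; apply: eq_bigr => i _.
    rewrite mulr_sumr -big_split /= -sumrB; apply: eq_bigr => j _; ring.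
  by rewrite -!big_distrlr /=; field.
by rewrite mulr_ge0 ?invr_ge0 // sumr_ge0 // => i _; rewrite sumr_ge0 // => j _; exact: sqr_ge0.
Qed.

Lemma cauchy_schwarz_sqrt (I : finType) (u v : I -> R) :
  \sum_i u i * v i <= Num.sqrt (\sum_i u i ^+ 2) * Num.sqrt (\sum_i v i ^+ 2).
Proof.
rewrite -sqrtrM; last by rewrite sumr_ge0 // => i _; exact: sqr_ge0.
by rewrite (le_trans (ler_norm _)) // -sqrtr_sqr ler_sqrt ?cauchy_schwarz // mulr_ge0 // sumr_ge0 // => i _; exact: sqr_ge0.
Qed.

Lemma minkowski (I J : finType) (v : I -> J -> R) :
  \sum_x (\sum_i v i x) ^+ 2 <= (\sum_i Num.sqrt (\sum_x v i x ^+ 2)) ^+ 2.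
Proof.
have -> : \sum_x (\sum_i v i x) ^+ 2 = \sum_i \sum_j \sum_x v i x * v j x.
  under eq_bigr do rewrite expr2 big_distrlr /=.
  by rewrite exchange_big; apply: eq_bigr => i _; rewrite exchange_big.
rewrite expr2 big_distrlr /=; apply: ler_sum => i _; apply: ler_sum => j _.
exact: cauchy_schwarz_sqrt.
Qed.

End FiniteSums.

Section Convolution.

Variables (R : rcfType) (F : finFieldType).
Implicit Types (f g : F -> R).

Definition conv f g x := \sum_y f y * g (x - y).
Definition corr f x := \sum_y f (y + x) * f y.
Definition quad f := \sum_x conv f f x ^+ 2.
(** Up to normalisation, the L^4 norm of the Fourier transform of [f]. *)
Definition qnorm f := Num.sqrt (Num.sqrt (quad f)).

Lemma quad_ge0 f : 0 <= quad f. Proof. by rewrite sumr_ge0 // => x _; exact: sqr_ge0. Qed.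
Lemma qnorm_ge0 f : 0 <= qnorm f. Proof. exact: sqrtr_ge0. Qed.
Lemma qnorm4 f : qnorm f ^+ 4 = quad f.
Proof. by rewrite (exprM _ 2 2) /qnorm !sqr_sqrtr ?sqrtr_ge0 ?quad_ge0. Qed.

Lemma eq_quad f g : f =1 g -> quad f = quad g.
Proof.
move=> fg; apply: eq_bigr => x _; congr (_ ^+ 2).
by apply: eq_bigr => y _; rewrite !fg.
Qed.

(** Rewriting y + z = y' + z' as y' - y = z - z' separates [f] from [g]; Cauchy-Schwarz then bounds
    mixed energies by pure ones. *)
Lemma conv_corr f g : \sum_x conv f g x ^+ 2 = \sum_x corr f x * corr g x.
Proof.
transitivity (\sum_(y : F) \sum_(u : F) \sum_(x : F) f y * f (y + u) * (g (x + u) * g x)).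
  rewrite /conv; under eq_bigr do rewrite expr2 big_distrlr /=.
  rewrite exchange_big; apply: eq_bigr => y _; rewrite exchange_big /=.
  rewrite (reindex_inj (addrI y)) /=; apply: eq_bigr => u _.
  rewrite (reindex_inj (addrI (y + u))) /=; apply: eq_bigr => x _.
  have -> : y + u + x - y = x + u by ring.
  by have -> : y + u + x - (y + u) = x; ring.
rewrite exchange_big; apply: eq_bigr => u _.
rewrite /corr big_distrlr /=; apply: eq_bigr => y _; apply: eq_bigr => x _; ring.
Qed.

Lemma quad_corr f : quad f = \sum_x corr f x ^+ 2.
Proof. by rewrite /quad conv_corr; apply: eq_bigr => x _; rewrite expr2. Qed.

Lemma conv_qnorm f g : Num.sqrt (\sum_x conv f g x ^+ 2) <= qnorm f * qnorm g.
Proof.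
rewrite conv_corr -sqrtrM ?sqrtr_ge0 // ler_sqrt ?mulr_ge0 ?sqrtr_ge0 //.
by rewrite !quad_corr cauchy_schwarz_sqrt.
Qed.

Lemma quad_sum (I : finType) (f : I -> F -> R) :
  quad (fun x => \sum_i f i x) <= (\sum_i qnorm (f i)) ^+ 4.
Proof.
have -> : quad (fun x => \sum_i f i x) =
    \sum_x (\sum_(ij : I * I) conv (f ij.1) (f ij.2) x) ^+ 2.
  apply: eq_bigr => x _; congr (_ ^+ 2); rewrite /conv.
  under eq_bigr do rewrite big_distrlr /=.
  rewrite exchange_big -(pair_bigA _ (fun i j => \sum_y f i y * f j (x - y))) /=.
  by apply: eq_bigr => i _; rewrite exchange_big.
apply: le_trans (minkowski _) _; rewrite (exprM _ 2 2); apply: lerXn2r; rewrite ?nnegrE.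
- by rewrite sumr_ge0 // => i _; exact: sqrtr_ge0.
- by rewrite exprn_ge0 // sumr_ge0 // => i _; exact: qnorm_ge0.
rewrite expr2 big_distrlr /= pair_bigA /=; apply: ler_sum => ij _; exact: conv_qnorm.
Qed.

Lemma qnorm_sum (I : finType) (f : I -> F -> R) :
  qnorm (fun x => \sum_i f i x) <= \sum_i qnorm (f i).
Proof.
have h : 0 <= \sum_i qnorm (f i) by rewrite sumr_ge0 // => i _; exact: qnorm_ge0.
by rewrite -(@ler_pXn2r _ 4) ?nnegrE ?qnorm_ge0 // qnorm4; exact: quad_sum.
Qed.

Lemma quadZ c f : quad (fun x => c * f x) = c ^+ 4 * quad f.
Proof.
rewrite /quad mulr_sumr; apply: eq_bigr => x _.
have -> : conv (fun x => c * f x) (fun x => c * f x) x = c ^+ 2 * conv f f x.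
  by rewrite /conv mulr_sumr; apply: eq_bigr => y _; ring.
by rewrite exprMn -exprM.
Qed.

Lemma qnormZ c f : qnorm (fun x => c * f x) = `|c| * qnorm f.
Proof.
apply: (@pexpIrn R 4); rewrite ?nnegrE ?mulr_ge0 ?qnorm_ge0 //.
by rewrite exprMn !qnorm4 quadZ -normrX ger0_norm // (exprM _ 2 2) sqr_ge0.
Qed.

Definition mean f := (\sum_x f x) / #|F|%:R.

Lemma cardF_neq0 : #|F|%:R != 0 :> R.
Proof. by rewrite pnatr_eq0 -lt0n; apply/card_gt0P; exists 0. Qed.

Lemma sum_conv f g : \sum_x conv f g x = (\sum_x f x) * (\sum_x g x).
Proof.
rewrite exchange_big /= mulr_suml; apply: eq_bigr => y _; rewrite -mulr_sumr; congr (_ * _).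
by rewrite (reindex_inj (addrI y)) /=; apply: eq_bigr => x _; rewrite addrAC subrr add0r.
Qed.

Lemma quad_centered f :
  quad (fun x => f x - mean f) = quad f - (\sum_x f x) ^+ 4 / #|F|%:R.
Proof.
set S := \sum_x f x; have n0 := cardF_neq0.
have cE x : conv (fun x => f x - mean f) (fun x => f x - mean f) x = conv f f x - S ^+ 2 / #|F|%:R.
  rewrite /conv; have -> : \sum_y (f y - mean f) * (f (x - y) - mean f) =
     \sum_y f y * f (x - y) - mean f * \sum_y f y - mean f * \sum_y f (x - y) + mean f ^+ 2 * #|F|%:R.
    rewrite !mulr_sumr -!sumrB -[#|F|]/#|{: F}| -sum1_card natr_sum mulr_sumr -big_split /=.
    by apply: eq_bigr => y _; ring.
  have -> : \sum_y f (x - y) = S.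
    rewrite (reindex_inj (can_inj (subKr x))) /=.
    by apply: eq_bigr => y _; rewrite subKr.
  by rewrite /mean -/S; field.
set K := S ^+ 2 / _ in cE.
have -> : quad (fun x => f x - mean f) =
    \sum_x conv f f x ^+ 2 - 2 * K * \sum_x conv f f x + K ^+ 2 * #|F|%:R.
  rewrite mulr_sumr -sumrB -[#|F|]/#|{: F}| -sum1_card natr_sum mulr_sumr -big_split /=.
  by apply: eq_bigr => x _; rewrite cE; ring.
by rewrite sum_conv -/S /K /quad; field.
Qed.

Lemma sum_centered f : \sum_x (f x - mean f) = 0.
Proof.
rewrite sumrB sumr_const -mulr_natr /mean divfK ?subrr //; exact: cardF_neq0.
Qed.

Lemma sum_centered_sqr f :
  \sum_x (f x - mean f) ^+ 2 = \sum_x f x ^+ 2 - (\sum_x f x) ^+ 2 / #|F|%:R.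
Proof.
have n0 := cardF_neq0.
have -> : \sum_x (f x - mean f) ^+ 2 =
    \sum_x f x ^+ 2 - 2 * mean f * \sum_x f x + mean f ^+ 2 * #|F|%:R.
  rewrite mulr_sumr -sumrB -[#|F|]/#|{: F}| -sum1_card natr_sum mulr_sumr -big_split /=.
  by apply: eq_bigr => x _; ring.
by rewrite /mean; field.
Qed.

(* Dilating one factor of the convolution by [mu] in [C] does not change [quad f];
   in the sum over all [mu] in F the off-diagonal terms vanish. *)
Lemma quad_spectral f (C : {set F}) : \sum_x f x = 0 ->
  0 \notin C -> (forall c x, c \in C -> f (c * x) = f x) ->
  #|C|%:R * quad f <= #|F|%:R * (\sum_x f x ^+ 2) ^+ 2.
Proof.
move=> f0 C0 fC; pose T (mu : F) := \sum_x (\sum_b f (x - mu * b) * f b) ^+ 2.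
have TC mu : mu \in C -> T mu = quad f.
  move=> muC; have mu0 : mu != 0 by apply: contraNneq C0 => <-.
  apply: eq_bigr => x _; congr (_ ^+ 2); rewrite /conv [RHS](reindex_inj (mulfI mu0)) /=.
  by apply: eq_bigr => b _; rewrite (fC _ b) // mulrC.
have -> : #|C|%:R * quad f = \sum_(mu in C) T mu.
  by rewrite (eq_bigr _ TC) sumr_const mulr_natl.
have TE mu : T mu = \sum_b \sum_d f b * f d * \sum_x f (x - mu * b) * f (x - mu * d).
  rewrite /T; under eq_bigr do rewrite expr2 big_distrlr /=.
  rewrite exchange_big; apply: eq_bigr => b _; rewrite exchange_big; apply: eq_bigr => d _.
  by rewrite mulr_sumr; apply: eq_bigr => x _; ring.
apply: (@le_trans _ _ (\sum_mu T mu)).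
  rewrite [leRHS](bigID (mem C)) /= lerDl sumr_ge0 // => mu _.
  by rewrite sumr_ge0 // => x _; exact: sqr_ge0.
under eq_bigr do rewrite TE.
rewrite exchange_big /= expr2 mulrA [leRHS]mulr_sumr; apply: ler_sum => b _.
rewrite exchange_big /= (bigD1 b) //= [X in _ + X]big1 ?addr0; last first.
  move=> d db; rewrite -mulr_sumr exchange_big /= [X in _ * X](_ : _ = 0) ?mulr0 //.
  transitivity (\sum_y \sum_mu f y * f (y - mu)).
    rewrite exchange_big [RHS]exchange_big /=.
    rewrite [RHS](reindex_inj (mulfI (_ : d - b != 0))) ?subr_eq0 //=.
    apply: eq_bigr => mu _; rewrite (reindex_inj (addrI (mu * b))) /=.
    apply: eq_bigr => y _; congr (f _ * f _); first by ring.
    by ring.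
  transitivity ((\sum_x f x) * (\sum_x f x)); last by rewrite f0 mul0r.
  rewrite big_distrlr /=; apply: eq_bigr => y _.
  rewrite [LHS](reindex_inj (can_inj (subKr y))) /=.
  by apply: eq_bigr => x _; rewrite subKr.
have TT mu : f b * f b * (\sum_x f (x - mu * b) * f (x - mu * b)) = f b ^+ 2 * \sum_x f x ^+ 2.
  rewrite (reindex_inj (addrI (mu * b))) /=; congr (_ * _); apply: eq_bigr => x _.
  by rewrite addrAC subrr add0r expr2.
rewrite (eq_bigr _ (fun mu _ => TT mu)) sumr_const -[#|_|]/#|{: F}| -mulr_natl.
by rewrite le_eqVlt; apply/orP; left; apply/eqP; ring.
Qed.

End Convolution.

(** * The centred energy of an invariant set *)

Section Energy.

Variables (p : nat) (R : rcfType) (A C : {set 'F_p}).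
Hypotheses (p_pr : prime p) (C0 : 0 \notin C) (C1 : 1 \in C).
Hypotheses (AC : forall c x, c \in C -> (c * x \in A) = (x \in A)).
Hypotheses (An0 : A != set0) (A0 : 0 \notin A).
Notation F := 'F_p.

Lemma Fp_natr_neq0 n : (0 < n < p)%N -> n%:R != 0 :> F.
Proof.
move=> /andP[n0 np]; rewrite -(dvdn_pcharf (pchar_Fp p_pr)).
by apply/negP => /dvdn_leq; rewrite n0 leqNgt np => /(_ isT).
Qed.

Lemma card_le : (#|C| <= #|A|)%N.
Proof.
have [a aA] := set0Pn _ An0; have a0 : a != 0 by apply: contraNneq A0 => <-.
rewrite -(card_imset _ (mulIf a0)); apply/subset_leq_card/subsetP => _ /imsetP[c cC ->].
by rewrite AC.
Qed.

Lemma card_triples : #|triples A C| = (#|C| * (#|A| * #|A|))%N.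
Proof.
have -> : triples A C = setX (setX A C) A.
  by apply/setP => -[[a c] b]; rewrite !inE andbA.
by rewrite !cardsX -mulnA mulnCA.
Qed.

Lemma poly_indep (u0 u1 u2 u3 u4 u5 : F) (h := @FracField.tofrac {poly F} \o polyC)
    (t := @FracField.tofrac {poly F} 'X) :
  h u0 + h u1 * t + h u2 * t ^+ 2 + h u3 * t ^+ 3 + h u4 * t ^+ 4 + h u5 * t ^+ 5 = 0 ->
  [/\ u0 = 0, u1 = 0, u2 = 0, u3 = 0 & u4 = 0 /\ u5 = 0].
Proof.
rewrite /h /t /= -!rmorphXn -!rmorphM -!rmorphD /= => /eqP; rewrite tofrac_eq0 => /eqP P0.
have co i := congr1 (fun q : {poly F} => q`_i) P0.
move: (co 0%N) (co 1%N) (co 2%N) (co 3%N) (co 4%N) (co 5%N).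
rewrite !coef0 !coefD !coefCM !coefC !coefX !coefXn /= !mulr0 !mulr1 !addr0 !add0r.
by move=> -> -> -> -> -> ->.
Qed.

Lemma meets_triples T : (0 < T)%N -> (28 * 28 * (76 * 76) * #|triples A C| <= T * T)%N ->
  (#|triples A C| <= p * p)%N -> (8 * #|A| <= T)%N ->
  (\sum_(x in triples A C) \sum_(y in triples A C) meets x y <= 2 * T * #|triples A C|)%N.
Proof.
move=> T0 NT Np AT.
exact: (meets_bound (h := @FracField.tofrac {poly F} \o polyC) poly_indep C0 card_le
  Fp_natr_neq0 (leqnn _) T0 NT Np AT).
Qed.

Definition ind (B : {set F}) (x : F) : R := (x \in B)%:R.

Lemma sum_ind (B : {set F}) : \sum_x ind B x = #|B|%:R.
Proof. by rewrite -sum1_card natr_sum [RHS]big_mkcond; apply: eq_bigr => x _; rewrite /ind; case: (x \in B). Qed.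

Lemma sum_indM (B : {set F}) (f : F -> R) : \sum_x ind B x * f x = \sum_(x in B) f x.
Proof. by rewrite [RHS]big_mkcond; apply: eq_bigr => x _; rewrite /ind; case: ifP; rewrite ?mul1r ?mul0r. Qed.

Lemma sum_triples (G : F * F * F -> R) : \sum_(x in triples A C) G x =
  \sum_(c in C) \sum_(b in A) \sum_(a in A) G (a, c, b).
Proof.
transitivity (\sum_(x | ((x.1.1 \in A) && (x.1.2 \in C)) && (x.2 \in A)) G (x.1, x.2)).
  by apply: eq_big => [[[a c] b]|[[a c] b] _] //; rewrite inE /= andbA.
rewrite -(pair_big (fun u : F * F => (u.1 \in A) && (u.2 \in C)) (mem A) (fun u b => G (u, b))) /=.
rewrite (eq_bigr (fun u : F * F => \sum_(b in A) G (u.1, u.2, b))); last by case.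
rewrite -(pair_big (mem A) (mem C) (fun a c => \sum_(b in A) G (a, c, b))) /=.
by rewrite exchange_big; apply: eq_bigr => c _; rewrite exchange_big.
Qed.

Lemma conv_ind c x : c \in C ->
  conv (ind A) (ind A) x = \sum_b ind A (x - c * b) * ind A b.
Proof.
move=> cC; have c0 : c != 0 by apply: contraNneq C0 => <-.
rewrite /conv (reindex_inj (mulfI c0)) /=; apply: eq_bigr => b _.
by rewrite mulrC; congr (_ * _); rewrite /ind AC.
Qed.

Lemma quad_ind_dir c c' : c \in C -> c' \in C -> quad (ind A) =
  \sum_(b in A) \sum_(b' in A) \sum_(a in A) \sum_(a' in A)
    (a - a' == c * b' - c' * b)%:R.
Proof.
move=> cC c'C.
transitivity (\sum_x (\sum_b ind A (x - c' * b) * ind A b) * (\sum_b ind A (x - c * b) * ind A b)).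
  by apply: eq_bigr => x _; rewrite expr2 -!conv_ind.
under eq_bigr do rewrite big_distrlr /=.
rewrite exchange_big /= -[RHS]sum_indM; apply: eq_bigr => b _.
rewrite exchange_big /= -[X in _ = _ * X]sum_indM mulr_sumr; apply: eq_bigr => b' _.
rewrite (reindex_inj (addrI (c' * b))) -[X in _ = _ * (_ * X)]sum_indM !mulr_sumr /=.
apply: eq_bigr => a _.
have -> : c' * b + a - c' * b = a by ring.
have -> : \sum_(a' in A) (a - a' == c * b' - c' * b)%:R = ind A (c' * b + a - c * b').
  rewrite -sum_indM (bigD1 (c' * b + a - c * b')) //= big1 ?addr0.
    have -> : a - (c' * b + a - c * b') == c * b' - c' * b by apply/eqP; ring.
    by rewrite mulr1.
  move=> a' ne; have /negPf-> : a - a' != c * b' - c' * b; last by rewrite mulr0.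
  by apply: contra ne => /eqP e; apply/eqP; rewrite -[a'](subKr a) e; ring.
ring.
Qed.

(** The last term accounts for the solutions with a = a': then c b' = c' b, and b' is determined by
    c, c' and b. *)
Lemma energy_meets : #|C|%:R ^+ 2 * quad (ind A) <=
  (\sum_(x in triples A C) \sum_(y in triples A C) meets x y)%N%:R + #|C|%:R ^+ 2 * #|A|%:R ^+ 2.
Proof.
pose T (b a c b' a' c' : F) : R := (meets (a, c, b) (a', c', b'))%:R.
have step c c' : c \in C -> c' \in C -> quad (ind A) <=
    \sum_(b in A) \sum_(a in A) \sum_(b' in A) \sum_(a' in A) T b a c b' a' c' + #|A|%:R ^+ 2.
  move=> cC c'C; have c0 : c != 0 by apply: contraNneq C0 => <-.
  rewrite (quad_ind_dir cC c'C).
  have -> : #|A|%:R ^+ 2 = \sum_(b in A) \sum_(a in A) (1 : R).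
    by rewrite !sumr_const -mulrnA mulnn -natrX.
  rewrite -big_split; apply: ler_sum => b bA; rewrite exchange_big -big_split; apply: ler_sum => a aA /=.
  apply: (@le_trans _ _ (\sum_(b' in A) (\sum_(a' in A) T b a c b' a' c' + (b' == c^-1 * (c' * b))%:R))).
    apply: ler_sum => b' b'A; rewrite [X in X <= _](bigID (pred1 a)) /= addrC.
    apply: lerD.
      rewrite [X in X <= _]big_mkcondr /=; apply: ler_sum => a' _; rewrite /T /meets /=.
      by rewrite eq_sym andbC; case: (a == a') => /=; rewrite ?mulr0 ?lexx ?ler0n //=; case: eqP; rewrite ?lexx ?ler0n.
    have -> : \sum_(a' in A | a' == a) (a - a' == c * b' - c' * b)%:R = (c * b' == c' * b)%:R :> R.
      rewrite (big_pred1 a) ?subrr ?[0 == _]eq_sym ?subr_eq0 // => a'.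
      by rewrite andb_idl // => /eqP ->.
    rewrite ler_nat; case: eqP => // e; rewrite -e mulKf // eqxx //.
  rewrite big_split /= lerD2l; case: (boolP (c^-1 * (c' * b) \in A)) => hA; last first.
    rewrite big1 ?ler01 // => b' b'A; case: eqP => // e; by move: hA; rewrite -e b'A.
  rewrite (bigD1 _ hA) /= eqxx big1 ?addr0 // => b' /andP[_ /negPf ->] //.
have -> : #|C|%:R ^+ 2 * quad (ind A) = \sum_(c in C) \sum_(c' in C) quad (ind A).
  by rewrite !sumr_const -[#|_|]/#|C| -mulrnA mulnn -natrX mulr_natl.
have -> : #|C|%:R ^+ 2 * #|A|%:R ^+ 2 = \sum_(c in C) \sum_(c' in C) (#|A|%:R ^+ 2 : R).
  by rewrite !sumr_const -[#|_|]/#|C| -mulrnA mulnn -natrX mulr_natl.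
apply: (@le_trans _ _ (\sum_(c in C) \sum_(c' in C) (\sum_(b in A) \sum_(a in A) \sum_(b' in A) \sum_(a' in A)
    T b a c b' a' c' + #|A|%:R ^+ 2))).
  by apply: ler_sum => c cC; apply: ler_sum => c' c'C; exact: step.
rewrite (eq_bigr _ (fun c _ => big_split _ _ _ _ _)) big_split /= lerD2r le_eqVlt; apply/orP; left; apply/eqP.
rewrite natr_sum sum_triples; apply: eq_bigr => c _.
rewrite exchange_big; apply: eq_bigr => b _ /=; rewrite exchange_big; apply: eq_bigr => a _ /=.
by rewrite natr_sum sum_triples.
Qed.

Lemma natsqrt N : (0 < N)%N -> exists q, [/\ (N <= q * q)%N, (0 < q)%N & (q.-1 * q.-1 < N)%N].
Proof.
move=> N0; have ex : exists q, (N <= q * q)%N by exists N; rewrite leq_pmulr.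
case: (ex_minnP ex) => q hq mq; exists q; rewrite hq.
have q0 : (0 < q)%N by case: q hq {mq} => //; rewrite muln0 leqn0 => /eqP N0'; rewrite N0' in N0.
split=> //; rewrite ltnNge; apply/negP => /mq; lia.
Qed.

Lemma leq_mul_square x y q N : (N <= q * q)%N ->
  (x * x * (y * y) * N <= x * y * q * (x * y * q))%N.
Proof. by move=> Nq; rewrite [leqRHS]mulnACA mulnACA leq_mul2l Nq orbT. Qed.

(** The incidence bound costs 2T per triple with T = 28 * 76 * q, where q is at most twice the
    square root of the number of triples; the 1 comes from the solutions with a = a'. *)
Definition energy_const : R := 4 * 28 * 76 + 1.

Lemma energy_const_ge0 : 0 <= energy_const.
Proof. by rewrite /energy_const; lra. Qed.

Lemma energy_bound :
  Num.sqrt #|C|%:R * quad (fun x => ind A x - mean (ind A)) <= energy_const * #|A|%:R ^+ 3.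
Proof.
set n : R := #|C|%:R; set a : R := #|A|%:R; set e := quad _; set w := Num.sqrt n.
have n1 : 1 <= n by rewrite ler1n card_gt0; apply/set0Pn; exists 1.
have na : n <= a by rewrite ler_nat card_le.
have w0 : 0 <= w by exact: sqrtr_ge0.
have w2 : w ^+ 2 = n by rewrite sqr_sqrtr //; lra.
have w1 : 1 <= w by rewrite -[1]sqrtr1 ler_sqrt //; lra.
have cF : #|F| = p by rewrite card_Fp.
have sum0 : \sum_x (ind A x - mean (ind A)) = 0 by exact: sum_centered.
have nw : n <= a * w by nra.
have wn : w <= n by rewrite -w2; nra.
have N1 : (0 < #|triples A C|)%N.
  by rewrite card_triples !muln_gt0 !card_gt0 An0 !andbT; apply/set0Pn; exists 1.
(* With more than p^2 triples, p is less than |A| |C|^(1/2), and [quad_spectral] alone gives the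
   bound with constant 1. *)
have [Np|pN] := leqP #|triples A C| (p * p); last first.
  have inv c x : c \in C -> ind A (c * x) - mean (ind A) = ind A x - mean (ind A).
    by move=> cC; rewrite /ind AC.
  have := quad_spectral sum0 C0 inv; rewrite -/e -/n cF.
  set S2 := \sum_x _ => hS.
  have S2a : S2 <= a.
    have -> : S2 = a - a ^+ 2 / p%:R.
      rewrite /S2 sum_centered_sqr sum_ind -/a cF; congr (_ - _).
      rewrite /a -sum_ind; apply: eq_bigr => x _.
      by rewrite /ind; case: (x \in A); rewrite ?expr1n ?expr0n.
    by rewrite gerBl divr_ge0 ?sqr_ge0.
  have S20 : 0 <= S2 by rewrite sumr_ge0 // => x _; exact: sqr_ge0.
  have pw : p%:R <= a * w.
    rewrite -(ler_pXn2r (n := 2)) ?nnegrE ?mulr_ge0 ?ler0n //.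
    by rewrite exprMn w2 /a /n -!natrX -natrM ler_nat -!mulnn mulnC -card_triples ltnW.
  have a0 : 0 <= a by lra.
  have : n * e <= a * w * a ^+ 2.
    apply: (le_trans hS); apply: ler_pM => //; first by rewrite sqr_ge0.
    by rewrite ler_pXn2r ?nnegrE.
  rewrite -w2 -mulrA => h; have : w * e <= a ^+ 3.
    have wp : 0 < w by lra.
    rewrite -(ler_pM2l wp); move: h; rewrite expr2 => h.
    apply: le_trans (_ : _ <= w * w * e) _; first by rewrite mulrA.
    by apply: (le_trans h); rewrite le_eqVlt; apply/orP; left; apply/eqP; ring.
  move/le_trans; apply; rewrite ler_peMl ?exprn_ge0 //; rewrite /energy_const; lra.
have [q [Nq q0 qN]] := natsqrt N1.
have aq : (#|A| <= q)%N.
  rewrite -(@leq_exp2r _ _ 2) // -!mulnn (leq_trans _ Nq) // card_triples leq_pmull //.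
  by rewrite card_gt0; apply/set0Pn; exists 1.
set N := #|triples A C| in N1 Np Nq qN *.
have hm : (\sum_(x in triples A C) \sum_(y in triples A C) meets x y <= 2 * (28 * 76 * q) * N)%N.
  have T0 : (0 < 28 * 76 * q)%N by rewrite muln_gt0 q0.
  have AT : (8 * #|A| <= 28 * 76 * q)%N by exact: leq_mul.
  exact: (meets_triples T0 (leq_mul_square 28 76 Nq) Np AT).
have NE : N%:R = n * a ^+ 2 :> R by rewrite /N card_triples !natrM -/n -/a expr2.
have qle : q%:R <= 2 * (w * a).
  have : (q.-1)%:R <= w * a.
    rewrite -(ler_pXn2r (n := 2)) ?nnegrE ?mulr_ge0 ?ler0n //.
    by rewrite exprMn w2 -NE -natrX ler_nat -mulnn ltnW.
  have : q%:R = (q.-1)%:R + 1 :> R by rewrite -[in LHS](prednK q0) -addn1 natrD.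
  nra.
have := energy_meets; rewrite -/n -/a => hE.
have hm' : n ^+ 2 * quad (ind A) <= 4 * 28 * 76 * (w * a) * (n * a ^+ 2) + n ^+ 2 * a ^+ 2.
  apply: (le_trans hE); rewrite lerD2r.
  apply: (@le_trans _ _ ((2 * (28 * 76 * q) * N)%N%:R)); first by rewrite ler_nat.
  rewrite !natrM NE.
  have -> : 2 * (28 * 76 * q%:R) * (n * a ^+ 2) = q%:R * (2 * 28 * 76 * (n * a ^+ 2)) by ring.
  apply: (@le_trans _ _ (2 * (w * a) * (2 * 28 * 76 * (n * a ^+ 2)))); last by rewrite le_eqVlt; apply/orP; left; apply/eqP; ring.
  by apply: ler_wpM2r => //; rewrite !mulr_ge0 ?sqr_ge0 //; lra.
have eq : e <= quad (ind A).
  rewrite /e quad_centered gerBl divr_ge0 // sum_ind; exact: exprn_ge0.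
have n20 : 0 < n ^+ 2 by rewrite exprn_gt0 //; lra.
rewrite -(ler_pM2l n20) mulrCA.
apply: (@le_trans _ _ (w * (4 * 28 * 76 * (w * a) * (n * a ^+ 2) + n ^+ 2 * a ^+ 2))).
  by apply: ler_wpM2l => //; apply: le_trans hm'; rewrite ler_pM2l.
have -> : n ^+ 2 * (energy_const * a ^+ 3) =
   w * (4 * 28 * 76 * (w * a) * (n * a ^+ 2)) + n ^+ 2 * a ^+ 2 * a.
  by rewrite -{1 3}w2 /energy_const -w2; ring.
rewrite mulrDr lerD2l mulrC; apply: ler_wpM2l; first by rewrite mulr_ge0 ?sqr_ge0.
exact: le_trans wn na.
Qed.

End Energy.

(** * Layer-cake decomposition of an invariant function *)

Section RealInequalities.

Variable R : rcfType.

(* Hoelder with exponents (2, 4, 4), in the form needed for the layer cake. *)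
Lemma hoelder_244 (I : finType) (a tau : I -> R) :
  (forall i, 0 <= a i) -> (forall i, 0 < tau i) ->
  (\sum_i Num.sqrt (a i * Num.sqrt (a i))) ^+ 4 <=
    (\sum_i a i) ^+ 2 * ((\sum_i tau i * a i) * \sum_i (tau i)^-1).
Proof.
move=> a0 t0.
have h1 : (\sum_i Num.sqrt (a i * Num.sqrt (a i))) ^+ 2 <= (\sum_i a i) * \sum_i Num.sqrt (a i).
  have := cauchy_schwarz (fun i => Num.sqrt (a i)) (fun i => Num.sqrt (Num.sqrt (a i))).
  rewrite (eq_bigr (fun i => Num.sqrt (a i * Num.sqrt (a i)))) => [|i _]; last by rewrite sqrtrM.
  move=> /le_trans; apply; rewrite le_eqVlt; apply/orP; left; apply/eqP; congr (_ * _);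
    by apply: eq_bigr => i _; rewrite sqr_sqrtr ?sqrtr_ge0.
have h2 : (\sum_i Num.sqrt (a i)) ^+ 2 <= (\sum_i tau i * a i) * \sum_i (tau i)^-1.
  have := cauchy_schwarz (fun i => Num.sqrt (tau i * a i)) (fun i => Num.sqrt (tau i)^-1).
  rewrite (eq_bigr (fun i => Num.sqrt (a i))) => [|i _]; last first.
    by rewrite -sqrtrM ?mulr_ge0 ?(ltW (t0 _)) // mulrAC mulfV ?mul1r // gt_eqF.
  move=> /le_trans; apply; rewrite le_eqVlt; apply/orP; left; apply/eqP; congr (_ * _);
    apply: eq_bigr => i _; rewrite sqr_sqrtr //; first by rewrite mulr_ge0 ?(ltW (t0 _)).
  by rewrite invr_ge0 ltW.
have s0 : 0 <= \sum_i a i by exact: sumr_ge0.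
have s1 : 0 <= \sum_i Num.sqrt (a i) by rewrite sumr_ge0 // => i _; exact: sqrtr_ge0.
rewrite (exprM _ 2 2); apply: (@le_trans _ _ (((\sum_i a i) * \sum_i Num.sqrt (a i)) ^+ 2)).
  by rewrite ler_pXn2r ?nnegrE ?sqr_ge0 ?mulr_ge0.
by rewrite exprMn ler_wpM2l ?sqr_ge0.
Qed.

Lemma harmonic_pow2 L : \sum_(t < 2 ^ L) (t.+1%:R : R)^-1 <= L.+1%:R.
Proof.
rewrite -(big_mkord xpredT (fun t => (t.+1%:R)^-1)); elim: L => [|L IHL].
  by rewrite expn0 big_nat1 invr1.
have le2 : (2 ^ L <= 2 ^ L.+1)%N by rewrite leq_exp2l.
rewrite (@big_cat_nat _ _ _ (2 ^ L)) //= -[L.+2]addn1 natrD; apply: lerD => //.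
apply: (@le_trans _ _ (\sum_(2 ^ L <= t < 2 ^ L.+1) (2 ^ L)%:R^-1)).
  apply: ler_sum_nat => t /andP[lo _]; rewrite lef_pV2 ?posrE ?ltr0n ?expn_gt0 // ler_nat.
  exact: leqW.
by rewrite sumr_const_nat expnS mul2n -addnn addnK -[leLHS]mulr_natl mulfV // ?pnatr_eq0 -?lt0n ?expn_gt0.
Qed.

Lemma expr4_add_le (u v : R) : (u + v) ^+ 4 <= 8 * (u ^+ 4 + v ^+ 4).
Proof.
have h (x y : R) : (x + y) ^+ 2 <= 2 * (x ^+ 2 + y ^+ 2).
  by rewrite -subr_ge0 (_ : _ - _ = (x - y) ^+ 2) ?sqr_ge0 //; ring.
rewrite !(exprM _ 2 2); apply: (@le_trans _ _ ((2 * (u ^+ 2 + v ^+ 2)) ^+ 2)).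
  by rewrite ler_pXn2r ?nnegrE ?sqr_ge0 ?mulr_ge0 ?addr_ge0 ?sqr_ge0.
by have := h (u ^+ 2) (v ^+ 2); rewrite exprMn; lra.
Qed.

End RealInequalities.

Section LayerCake.

Variables (p : nat) (R : rcfType) (C : {set 'F_p}) (c w : R).
Notation F := 'F_p.
Hypotheses (w0 : 0 < w) (c0 : 0 <= c) (C0 : 0 \notin C).
Hypothesis level_bound : forall B : {set F}, B != set0 -> 0 \notin B ->
  (forall a x, a \in C -> (a * x \in B) = (x \in B)) ->
  w * quad (fun x => ind R B x - mean (ind R B)) <= c * #|B|%:R ^+ 3.

Variables (sg : F -> bool) (v : F -> nat) (L : nat).
Hypotheses (sgC : forall a x, a \in C -> sg (a * x) = sg x).
Hypotheses (vC : forall a x, a \in C -> v (a * x) = v x).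
Hypotheses (vL : forall x, (v x <= 2 ^ L)%N).
Let g x : R := (-1) ^+ sg x * (v x)%:R.
Hypothesis g0 : \sum_x g x = 0.

Let I := ('I_(2 ^ L) * bool)%type.
(** The origin is left out because the energy bound concerns sets without 0; the value of [g] there
    is treated as a separate point mass. *)
Let level (i : I) : {set F} := [set x | [&& x != 0, sg x == i.2 & (i.1 < v x)%N]].

(** The fourth root of the energy bound; the nested square roots of the cardinality are its power
    3/4. *)
Lemma level_qnorm (i : I) : qnorm (fun x => (-1) ^+ i.2 * (ind R (level i) x - mean (ind R (level i))))
  <= Num.sqrt (Num.sqrt (c / w)) * Num.sqrt (#|level i|%:R * Num.sqrt #|level i|%:R).
Proof.
rewrite qnormZ normrX normrN1 expr1n mul1r.
set a : R := #|level i|%:R; have a0 : 0 <= a by exact: ler0n.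
have cw : 0 <= c / w by rewrite divr_ge0 // ltW.
have bound : quad (fun x => ind R (level i) x - mean (ind R (level i))) <= c / w * a ^+ 3.
  rewrite mulrAC ler_pdivlMr // mulrC; have [B0|Bn0] := eqVneq (level i) set0.
    rewrite (@eq_quad _ _ _ (fun=> 0)) => [|x]; last first.
      by rewrite /mean sum_ind B0 cards0 mul0r subr0 /ind inE.
    rewrite /quad big1 ?mulr0 ?mulr_ge0 ?exprn_ge0 // => x _.
    by rewrite /conv big1 ?expr0n // => y _; rewrite mul0r.
  apply: level_bound => //; first by rewrite inE eqxx.
  move=> b x bC; rewrite !inE sgC // vC // mulf_eq0 negb_or.
  by have -> : b != 0 by apply: contraNneq C0 => <-.
rewrite -(@ler_pXn2r _ 4) ?nnegrE ?mulr_ge0 ?sqrtr_ge0 // qnorm4.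
rewrite exprMn !(exprM _ 2 2) !sqr_sqrtr ?sqrtr_ge0 ?mulr_ge0 ?sqrtr_ge0 //.
  by rewrite exprMn sqr_sqrtr // -exprSr.
by rewrite invr_ge0 ltW.
Qed.

Lemma sum_ltn M n : (n <= M)%N -> (\sum_(t < M) (t < n) = n)%N.
Proof.
move=> nM; rewrite -[RHS](minn_idPr nM); elim: M {nM} => [|M IHM]; first by rewrite big_ord0 min0n.
by rewrite big_ord_recr /= IHM; case: (ltnP M n); lia.
Qed.

Lemma sum_ltn_weighted M n : (\sum_(t < M) (t < n) * t.+1 <= n ^ 2)%N.
Proof.
suff : (\sum_(t < M) (t < n) * t.+1 <= minn M n ^ 2)%N.
  by move/leq_trans; apply; rewrite leq_exp2r // geq_minr.
elim: M => [|M IHM]; first by rewrite big_ord0.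
rewrite big_ord_recr /=; case: (ltnP M n) => Mn.
  have -> : minn M.+1 n = M.+1 by apply/minn_idPl.
  move: IHM; rewrite (minn_idPl (ltnW Mn)) -!mulnn mul1n.
  by move: (\sum_(t < M) _)%N => x; lia.
by rewrite mul0n addn0 (minn_idPr (leqW Mn)) -{2}(minn_idPr Mn).
Qed.

Lemma level_sum (tau : 'I_(2 ^ L) -> R) (z : bool -> R) x : x != 0 ->
  \sum_(i : I) z i.2 * tau i.1 * ind R (level i) x = z (sg x) * \sum_t tau t * (t < v x)%N%:R.
Proof.
move=> x0; rewrite -(pair_bigA _ (fun t b => z b * tau t * ind R (level (t, b)) x)) /= mulr_sumr.
apply: eq_bigr => t _; rewrite (bigD1 (sg x)) //= big1 => [|b /negPf bs].
  by rewrite addr0 /ind inE x0 eqxx /= mulrA.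
by rewrite /ind inE x0 /= eq_sym bs /= mulr0.
Qed.

Lemma level_decomposition x : g x = g 0 * ind R [set (0 : F)] x + \sum_(i : I) (-1) ^+ i.2 * ind R (level i) x.
Proof.
have [->|x0] := eqVneq x 0.
  rewrite /ind inE eqxx mulr1 big1 ?addr0 // => i _.
  by rewrite inE eqxx mulr0.
rewrite {1}/ind inE (negPf x0) mulr0 add0r.
have := level_sum (fun=> 1) (fun b : bool => (-1) ^+ b) x0.
under eq_bigr do rewrite mulr1.
move=> ->; rewrite /g; congr (_ * _); rewrite -{1}(sum_ltn (vL x)) natr_sum.
by apply: eq_bigr => t _; rewrite mul1r.
Qed.

Lemma level_card (tau : 'I_(2 ^ L) -> R) : (forall t, 0 <= tau t) ->
  \sum_(i : I) tau i.1 * #|level i|%:R <= \sum_x \sum_t tau t * (t < v x)%N%:R.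
Proof.
move=> tau0; under eq_bigr do rewrite -(sum_ind R) mulr_sumr.
rewrite exchange_big /=; apply: ler_sum => x _; have [->|x0] := eqVneq x 0.
  rewrite big1 ?sumr_ge0 // => [t _|i _]; first by rewrite mulr_ge0.
  by rewrite /ind inE eqxx mulr0.
have := level_sum tau (fun=> 1) x0.
by rewrite (eq_bigr (fun i : I => tau i.1 * ind R (level i) x)) => [->|i _]; rewrite mul1r.
Qed.

Lemma qnorm_point : qnorm (fun x => ind R [set (0 : F)] x - mean (ind R [set (0 : F)])) <= 1.
Proof.
rewrite -(@ler_pXn2r _ 4) ?nnegrE ?qnorm_ge0 // qnorm4 expr1n quad_centered.
apply: (@le_trans _ _ (quad (ind R [set (0 : F)]))).
  by rewrite gerBl divr_ge0 // sum_ind exprn_ge0.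
rewrite /quad (bigD1 0) //= big1 => [|x x0].
  rewrite addr0 /conv (bigD1 0) //= big1 => [|y y0].
    by rewrite subr0 addr0 /ind inE eqxx mulr1 expr1n.
  by rewrite /ind inE (negPf y0) mul0r.
rewrite /conv (bigD1 0) //= big1 => [|y y0].
  by rewrite subr0 addr0 /ind !inE eqxx (negPf x0) mulr0 expr0n.
by rewrite /ind inE (negPf y0) mul0r.
Qed.

(** As [g] has mean zero, its layers and the point mass at 0 may each be centred. The factor 8
    separates the point mass from the layers. *)
Lemma layer_cake : quad g <= 8 * (c / w * ((\sum_x (v x)%:R) ^+ 2
   * ((\sum_x (v x)%:R ^+ 2) * (2 * L.+1%:R))) + (v 0)%:R ^+ 4).
Proof.
pose d0 x := g 0 * (ind R [set (0 : F)] x - mean (ind R [set (0 : F)])).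
pose f (i : I) x := (-1) ^+ i.2 * (ind R (level i) x - mean (ind R (level i))).
pose s x := \sum_i f i x.
have gE x : g x = d0 x + s x.
  have -> : d0 x + s x = g x - (g 0 * mean (ind R [set (0 : F)]) + \sum_(i : I) (-1) ^+ i.2 * mean (ind R (level i))).
    rewrite level_decomposition /d0 /s /f; under [X in _ + X = _]eq_bigr do rewrite mulrBr.
    by rewrite sumrB; ring.
  rewrite [X in g x - X](_ : _ = mean g); first by rewrite /mean g0 mul0r subr0.
  rewrite /mean (eq_bigr _ (fun x _ => level_decomposition x)) big_split /= -mulr_sumr exchange_big /=.
  rewrite mulrDl mulrA; congr (_ + _); rewrite mulr_suml; apply: eq_bigr => i _.
  by rewrite -mulr_sumr mulrA.
have qd0 : qnorm d0 <= (v 0)%:R.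
  rewrite /d0 qnormZ /g normrM normrX normrN1 expr1n mul1r normr_nat.
  by rewrite ler_piMr // qnorm_point.
have cw : 0 <= c / w by rewrite divr_ge0 // ltW.
pose S : R := \sum_(i : I) Num.sqrt (#|level i|%:R * Num.sqrt #|level i|%:R).
have qs : qnorm s <= Num.sqrt (Num.sqrt (c / w)) * S.
  by apply: (le_trans (qnorm_sum f)); rewrite mulr_sumr; apply: ler_sum => i _; exact: level_qnorm.
have qsum : qnorm g <= qnorm d0 + qnorm s.
  have -> : qnorm g = qnorm (fun x => \sum_(b : bool) (if b then d0 else s) x).
    by rewrite /qnorm; congr (Num.sqrt (Num.sqrt _)); apply: eq_quad => x; rewrite big_bool.
  by apply: (le_trans (qnorm_sum _)); rewrite big_bool.
have v0 : 0 <= (v 0)%:R :> R by [].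
have S0 : 0 <= S by rewrite sumr_ge0 // => i _; exact: sqrtr_ge0.
have qS : quad g <= ((v 0)%:R + Num.sqrt (Num.sqrt (c / w)) * S) ^+ 4.
  rewrite -qnorm4 ler_pXn2r ?nnegrE ?qnorm_ge0 ?addr_ge0 ?mulr_ge0 ?sqrtr_ge0 //.
  exact: le_trans qsum (lerD qd0 qs).
apply: (le_trans qS); rewrite addrC; apply: (le_trans (expr4_add_le _ _)).
rewrite ler_wpM2l // lerD2r exprMn (exprM _ 2 2) !sqr_sqrtr ?sqrtr_ge0 //.
apply: ler_wpM2l => //.
(* With weight t + 1 at threshold t, the weighted sum of the cardinalities is at most the sum of
   v^2, while the inverse weights form a harmonic sum, the source of the logarithm; the factor 2
   counts the signs. *)
have tau0 (i : I) : 0 < (i.1.+1%:R : R) by rewrite ltr0n.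
have a0 (i : I) : 0 <= (#|level i|%:R : R) by [].
apply: (le_trans (hoelder_244 a0 tau0)).
have h1 : \sum_(i : I) #|level i|%:R <= \sum_x (v x)%:R :> R.
  have := @level_card (fun=> 1) (fun=> ler01); under eq_bigr do rewrite mul1r.
  move/le_trans; apply; apply: ler_sum => x _; rewrite -[in leRHS](sum_ltn (vL x)) natr_sum.
  by apply: ler_sum => t _; rewrite mul1r.
have h2 : \sum_(i : I) i.1.+1%:R * #|level i|%:R <= \sum_x (v x)%:R ^+ 2 :> R.
  apply: (le_trans (@level_card (fun t => t.+1%:R) (fun t => ler0n _ _))).
  apply: ler_sum => x _; rewrite -natrX; apply: le_trans (_ : _ <= (\sum_(t < 2 ^ L) (t < v x) * t.+1)%N%:R) _.
    by rewrite natr_sum; apply: ler_sum => t _; rewrite natrM mulrC.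
  by rewrite ler_nat sum_ltn_weighted.
have h3 : \sum_(i : I) (i.1.+1%:R : R)^-1 <= 2 * L.+1%:R.
  rewrite -(pair_bigA _ (fun (t : 'I_(2 ^ L)) (b : bool) => (t.+1%:R : R)^-1)) /=.
  rewrite (eq_bigr (fun t : 'I_(2 ^ L) => 2 * (t.+1%:R : R)^-1)) => [|t _].
    by rewrite -mulr_sumr ler_pM2l // harmonic_pow2.
  by rewrite sumr_const card_bool mulr_natl.
apply: ler_pM; rewrite ?sqr_ge0 //.
- by rewrite mulr_ge0 // sumr_ge0 // => i _; rewrite ?mulr_ge0 ?invr_ge0.
- by rewrite ler_pXn2r ?nnegrE ?sumr_ge0.
by apply: ler_pM => //; rewrite sumr_ge0 // => i _; rewrite ?mulr_ge0 ?invr_ge0.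
Qed.

End LayerCake.

(** * Iterated representation functions *)

Section Representations.

Variables (p : nat) (A : {set 'F_p}).
Notation F := 'F_p.

Definition reps k (x : F) : nat :=
  #|[set f : {ffun 'I_k -> F} | [forall i, f i \in A] && (\sum_i f i == x)]|.

Lemma repsE k x :
  reps k x = (\sum_(f : {ffun 'I_k -> F}) ([forall i, f i \in A] && (\sum_i f i == x)%R))%N.
Proof.
by rewrite /reps -sum1dep_card big_mkcond; apply: eq_bigr => f _; case: (_ && _).
Qed.

Lemma reps1 x : reps 1 x = (x \in A).
Proof.
rewrite /reps; case xA : (x \in A).
  rewrite (_ : [set f | _] = [set [ffun=> x]]) ?cards1 //; apply/setP => f.
  rewrite !inE big_ord1; apply/andP/eqP => [[_ /eqP fx]|->].
    by apply/ffunP => i; rewrite ffunE ord1.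
  by rewrite ffunE eqxx; split=> //; apply/forallP => i; rewrite ffunE.
apply: eq_card0 => f; rewrite !inE big_ord1; apply/negP => /andP[/forallP/(_ ord0) h /eqP fx].
by rewrite fx xA in h.
Qed.

Lemma repsD k l x : reps (k + l) x = (\sum_y reps k y * reps l (x - y)%R)%N.
Proof.
pose phi (gh : {ffun 'I_k -> F} * {ffun 'I_l -> F}) : {ffun 'I_(k + l) -> F} :=
  [ffun i => match fintype.split i with inl a => gh.1 a | inr b => gh.2 b end].
pose psi (f : {ffun 'I_(k + l) -> F}) : {ffun 'I_k -> F} * {ffun 'I_l -> F} :=
  ([ffun a => f (lshift l a)], [ffun b => f (rshift k b)]).
have phiL gh a : phi gh (lshift l a) = gh.1 a by rewrite ffunE (unsplitK (inl a)).
have phiR gh b : phi gh (rshift k b) = gh.2 b by rewrite ffunE (unsplitK (inr b)).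
have phiK : cancel phi psi.
  by move=> [g h]; congr pair; apply/ffunP => i; rewrite ffunE ?phiL ?phiR.
have psiK : cancel psi phi.
  move=> f; apply/ffunP => i; rewrite ffunE -[in RHS](splitK i).
  by case: (fintype.split i) => a; rewrite ffunE.
rewrite repsE (reindex phi); last by exists psi => ? _; [exact: phiK|exact: psiK].
transitivity (\sum_(g : {ffun 'I_k -> F}) \sum_(h : {ffun 'I_l -> F})
    ([&& [forall i, g i \in A], [forall i, h i \in A] & (\sum_i g i + \sum_i h i == x)%R]))%N.
  rewrite pair_bigA; apply: eq_bigr => -[g h] _; congr nat_of_bool; rewrite andbA; congr (_ && _).
    apply/forallP/andP => [H|[/forallP Hg /forallP Hh] i].
      by split; apply/forallP => i; [have := H (lshift l i); rewrite phiL|have := H (rshift k i); rewrite phiR].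
    by rewrite -(splitK i); case: (fintype.split i) => a; rewrite /unsplit ?phiL ?phiR.
  rewrite big_split_ord /=; congr (_ + _ == _); apply: eq_bigr => i _; rewrite ?phiL ?phiR //.
transitivity (\sum_(g : {ffun 'I_k -> F}) \sum_(h : {ffun 'I_l -> F}) \sum_y
   ([forall i, g i \in A] && (\sum_i g i == y)%R) * ([forall i, h i \in A] && (\sum_i h i == x - y)%R))%N.
  apply: eq_bigr => g _; apply: eq_bigr => h _; rewrite (bigD1 (\sum_i g i)) //= [X in (_ + X)%N]big1 => [|y /negPf yg].
    rewrite eqxx andbT addn0 -mulnb; congr (_ * (_ && _))%N.
    by rewrite addrC eq_sym -subr_eq eq_sym.
  by rewrite eq_sym yg andbF.
rewrite exchange_big /= [RHS](eq_bigr (fun y => \sum_(g : {ffun 'I_k -> F}) \sum_(h : {ffun 'I_l -> F})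
   ([forall i, g i \in A] && (\sum_i g i == y)%R) * ([forall i, h i \in A] && (\sum_i h i == x - y)%R))%N) => [|y _].
  rewrite [RHS]exchange_big [LHS]exchange_big; apply: eq_bigr => g _ /=.
  by rewrite exchange_big.
by rewrite !repsE big_distrlr.
Qed.

Lemma TplusE k : Tplus k A = (\sum_x reps k x ^ 2)%N.
Proof.
transitivity (\sum_x \sum_(g : {ffun 'I_k -> F}) \sum_(h : {ffun 'I_k -> F})
  ([forall i, g i \in A] && (\sum_i g i == x)%R) * ([forall i, h i \in A] && (\sum_i h i == x)%R))%N; last first.
  by apply: eq_bigr => x _; rewrite -mulnn repsE big_distrlr.
rewrite /Tplus -sum1dep_card big_mkcond -(pair_bigA _ (fun g h : {ffun 'I_k -> F} =>
  if [&& [forall i, g i \in A], [forall i, h i \in A] & (\sum_i g i == \sum_i h i)%R] then 1%N else 0%N)) /=.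
rewrite [RHS]exchange_big; apply: eq_bigr => g _ /=; rewrite [RHS]exchange_big; apply: eq_bigr => h _ /=.
rewrite (bigD1 (\sum_i g i)) //= [X in (_ + X)%N]big1 => [|y /negPf yg]; last by rewrite eq_sym yg andbF.
by rewrite eqxx andbT addn0 mulnb [_ == \sum_i g i]eq_sym; case: (_ && _).
Qed.

Fixpoint rep j (x : F) : nat :=
  if j is i.+1 then (\sum_y rep i y * rep i (x - y)%R)%N else (x \in A).

Lemma reps_pow2 j x : reps (2 ^ j) x = rep j x.
Proof.
elim: j x => [|j IHj] x; first by rewrite expn0 reps1.
by rewrite expnS mul2n -addnn repsD; apply: eq_bigr => y _; rewrite !IHj.
Qed.

Lemma rep_scale j c x : c != 0 -> (forall y, (c * y \in A) = (y \in A)) -> rep j (c * x) = rep j x.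
Proof.
move=> c0 cA; elim: j x => [|j IHj] x /=; first by rewrite cA.
rewrite (reindex_inj (mulfI c0)) /=; apply: eq_bigr => y _.
by rewrite -mulrBr !IHj.
Qed.

Lemma sum_rep j : (\sum_x rep j x = #|A| ^ 2 ^ j)%N.
Proof.
elim: j => [|j IHj] /=.
  by rewrite expn1 -sum1_card [RHS]big_mkcond; apply: eq_bigr => x _; case: (x \in A).
rewrite exchange_big /= expnS mul2n -addnn expnD -IHj big_distrl; apply: eq_bigr => y _ /=.
rewrite -big_distrr (reindex_inj (addrI y)) /=; congr (_ * _)%N; apply: eq_bigr => x _.
by rewrite addrAC subrr add0r.
Qed.

(** All summands but one determine the last. *)
Lemma rep_le j x : (rep j x * #|A| <= #|A| ^ 2 ^ j)%N.
Proof.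
elim: j x => [|j IHj] x /=; first by rewrite expn1; case: (x \in A); rewrite ?mul1n ?mul0n.
rewrite big_distrl /= expnS mul2n -addnn expnD.
apply: (@leq_trans (\sum_y rep j y * #|A| ^ 2 ^ j)%N); last by rewrite -big_distrl sum_rep.
by apply: leq_sum => y _; rewrite -mulnA leq_mul2l IHj orbT.
Qed.

End Representations.

(** * From one doubling to the next *)

Section Recursion.

Variables (p : nat) (R : rcfType) (A : {set 'F_p}).
Hypotheses (p_pr : prime p) (A0 : 0 \notin A) (A1 : 1 \in A).
Hypothesis AA : forall c x, c \in A -> (c * x \in A) = (x \in A).
Notation F := 'F_p.

Let n : R := #|A|%:R.
Definition rho j (x : F) : R := (rep A j x)%:R.
Definition moment j : R := \sum_x rho j x ^+ 2.
Definition excess j : R := moment j - #|A|%:R ^+ (2 ^ j.+1) / p%:R.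

Let An0 : A != set0. Proof. by apply/set0Pn; exists 1. Qed.
Let cF : #|F| = p. Proof. exact: card_Fp. Qed.
Let p0 : 0 < p%:R :> R. Proof. by rewrite ltr0n prime_gt0. Qed.
Let n1 : 1 <= n. Proof. by rewrite ler1n card_gt0. Qed.

Lemma card_subgroup_le : (#|A| <= p)%N.
Proof. by apply: leq_trans (max_card _) _; rewrite cF. Qed.

Lemma rho_sum j : \sum_x rho j x = n ^+ (2 ^ j).
Proof. by rewrite -natr_sum sum_rep natrX. Qed.

Lemma conv_rho j x : conv (rho j) (rho j) x = rho j.+1 x.
Proof. by rewrite /rho /= natr_sum; apply: eq_bigr => y _; rewrite natrM. Qed.

Lemma moment_TplusE j : moment j = (Tplus (2 ^ j) A)%:R.
Proof. by rewrite TplusE natr_sum; apply: eq_bigr => x _; rewrite natrX reps_pow2. Qed.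

Lemma excessE j : excess j = \sum_x (rho j x - mean (rho j)) ^+ 2.
Proof.
rewrite sum_centered_sqr rho_sum cF /excess /moment; congr (_ - _ / _).
by rewrite -exprM -expnSr.
Qed.

Lemma excess_ge0 j : 0 <= excess j.
Proof. by rewrite excessE sumr_ge0 // => x _; exact: sqr_ge0. Qed.

Lemma excessS j : excess j.+1 = quad (fun x => rho j x - mean (rho j)).
Proof.
rewrite quad_centered rho_sum cF -exprM /excess; congr (_ - n ^+ _ / _).
  by apply: eq_bigr => x _; rewrite conv_rho.
by rewrite !expnSr -mulnA.
Qed.

(** The layer cake is applied to p (rho - mean), which takes integer values. The constant 64 is 8 *
    2 * 2^2: from [layer_cake], the two signs, and the square of the l^1 bound 2 p S. *)
Lemma excess_step j ell : (p <= 2 ^ ell)%N ->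
  excess j.+1 <= (64 * energy_const R * (ell * (2 ^ j).+1).+1%:R + 8)
    * (n ^+ (2 ^ j.+1) / Num.sqrt n) * excess j.
Proof.
move=> pl; set w := Num.sqrt n; set c := energy_const R; set m := (2 ^ j)%N.
set L := (ell * m.+1)%N; set S := n ^+ m.
have nle : (#|A| <= p)%N := card_subgroup_le.
pose S0 := (#|A| ^ m)%N; have SE : S = S0%:R by rewrite /S /S0 natrX.
(* As subtraction is truncated, one of the two differences is 0 and [v] is the absolute value. *)
pose v x := (p * rep A j x - S0 + (S0 - p * rep A j x))%N.
pose sg x := (p * rep A j x < S0)%N.
pose g x : R := (-1) ^+ sg x * (v x)%:R.
have gE x : g x = p%:R * (rho j x - mean (rho j)).
  rewrite mulrBr /mean rho_sum cF mulrCA mulfV ?mulr1 ?gt_eqF // -/S SE /rho -natrM /g /sg /v.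
  case: ltnP => h; rewrite ?expr1 ?expr0 ?mulN1r ?mul1r.
    have -> : (p * rep A j x - S0 = 0)%N by apply/eqP; rewrite subn_eq0 ltnW.
    by rewrite add0n natrB ?opprB // ltnW.
  have -> : (S0 - p * rep A j x = 0)%N by apply/eqP; rewrite subn_eq0.
  by rewrite addn0 natrB.
have vn x : (v x * #|A| <= p * S0)%N.
  have h1 : (p * rep A j x * #|A| <= p * S0)%N by rewrite -mulnA leq_mul2l rep_le orbT.
  have h2 : (S0 * #|A| <= p * S0)%N by rewrite mulnC leq_mul2r nle orbT.
  by rewrite /v; case: (leqP S0 (p * rep A j x)) => h; nia.
have A_gt0 : (0 < #|A|)%N by rewrite card_gt0.
have vL x : (v x <= 2 ^ L)%N.
  apply: (@leq_trans (p * S0)); first by apply: leq_trans (vn x); rewrite leq_pmulr.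
  rewrite /L expnM expnS leq_mul // /S0.
  by elim: (m) => // i IHi; rewrite !expnS leq_mul // (leq_trans nle).
have lb B : B != set0 -> 0 \notin B -> (forall a x, a \in A -> (a * x \in B) = (x \in B)) ->
    w * quad (fun x => ind R B x - mean (ind R B)) <= c * #|B|%:R ^+ 3.
  by move=> Bn0 B0 BA; exact: energy_bound.
have w0 : 0 < w by rewrite sqrtr_gt0 (lt_le_trans ltr01 n1).
have c0 : 0 <= c := energy_const_ge0 R.
have inv a x : a \in A -> rep A j (a * x) = rep A j x.
  move=> aA; apply: rep_scale => [|y]; last exact: AA.
  by apply: contraNneq A0 => <-.
have g0 : \sum_x g x = 0 by rewrite (eq_bigr _ (fun x _ => gE x)) -mulr_sumr sum_centered mulr0.
have sgC a x : a \in A -> sg (a * x) = sg x by move=> aA; rewrite /sg inv.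
have vC a x : a \in A -> v (a * x) = v x by move=> aA; rewrite /v inv.
have := @layer_cake p R A c w w0 c0 A0 lb sg v L sgC vC vL g0.
have -> : quad (fun x => (-1) ^+ sg x * (v x)%:R) = p%:R ^+ 4 * excess j.+1.
  by rewrite excessS -quadZ; apply: eq_quad.
have v2E : \sum_x (v x)%:R ^+ 2 = p%:R ^+ 2 * excess j.
  rewrite excessE mulr_sumr; apply: eq_bigr => x _.
  by rewrite -exprMn -gE /g exprMn -exprM mulnC exprM sqrrN !expr1n mul1r.
have v1le : \sum_x (v x)%:R <= 2 * p%:R * S.
  have -> : 2 * p%:R * S = \sum_x (p%:R * rho j x + S).
    rewrite big_split -mulr_sumr rho_sum sumr_const cF -/S /= -mulr_natl; ring.
  apply: ler_sum => x _; rewrite SE /rho -natrM -natrD ler_nat /v.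
  by rewrite leq_add ?leq_subr.
have D0 : 0 <= excess j := excess_ge0 j.
have v0le1 : (v 0)%:R ^+ 2 <= p%:R ^+ 2 * excess j.
  by rewrite -v2E (bigD1 0) //= lerDl sumr_ge0 // => x _; exact: sqr_ge0.
have n0 : 0 < n := lt_le_trans ltr01 n1.
have S_ge0 : 0 <= S by rewrite exprn_ge0 // ltW.
have w1 : 1 <= w by rewrite -[1]sqrtr1 ler_sqrt.
have w2 : w ^+ 2 = n by rewrite sqr_sqrtr // ltW.
have wn : w <= n ^+ 2.
  apply: (@le_trans _ _ (w ^+ 2)); first by rewrite expr2 ler_peMl // ltW.
  by rewrite w2 expr2 ler_peMl // ltW.
(* One square of v(0) is bounded by the excess, the other by the pointwise bound on [rep]; their
   product makes the point mass proportional to the excess as well. *)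
have v0le2 : (v 0)%:R ^+ 2 <= p%:R ^+ 2 * (S ^+ 2 / w).
  rewrite mulrA ler_pdivlMr // -exprMn.
  have h : (v 0)%:R * n <= p%:R * S by rewrite SE -!natrM ler_nat.
  apply: (@le_trans _ _ (((v 0)%:R * n) ^+ 2)); last first.
    by rewrite ler_pXn2r ?nnegrE ?mulr_ge0 ?ler0n // ltW.
  by rewrite exprMn ler_wpM2l ?sqr_ge0.
have v04 : (v 0)%:R ^+ 4 <= p%:R ^+ 4 * (S ^+ 2 / w * excess j).
  have -> : p%:R ^+ 4 * (S ^+ 2 / w * excess j) = p%:R ^+ 2 * (S ^+ 2 / w) * (p%:R ^+ 2 * excess j) by ring.
  by rewrite (exprD _ 2 2) ler_pM ?sqr_ge0.
have v12 : (\sum_x (v x)%:R) ^+ 2 <= (2 * p%:R * S) ^+ 2 :> R.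
  by rewrite ler_pXn2r ?nnegrE ?mulr_ge0 ?ler0n ?sumr_ge0.
rewrite v2E => lc; rewrite -(@ler_pM2l _ (p%:R ^+ 4)) ?exprn_gt0 //.
have -> : n ^+ (2 ^ j.+1) = S ^+ 2 by rewrite -exprM expnSr.
apply: le_trans lc _.
have K0 : 0 <= c / w * (p%:R ^+ 2 * excess j * (2 * L.+1%:R)).
  by rewrite !mulr_ge0 ?invr_ge0 ?ler0n ?sqr_ge0 // ltW.
have -> : p%:R ^+ 4 * ((64 * c * L.+1%:R + 8) * (S ^+ 2 / w) * excess j) =
  8 * (c / w * (p%:R ^+ 2 * excess j * (2 * L.+1%:R)) * (2 * p%:R * S) ^+ 2
   + p%:R ^+ 4 * (S ^+ 2 / w * excess j)) by ring.
rewrite ler_pM2l //; apply: lerD => //.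
by apply: le_trans (ler_wpM2l K0 v12); rewrite mulrCA mulrC.
Qed.
End Recursion.

Section Logarithm.

Variable R : realType.

Lemma trunc_log_le_log2 p : (0 < p)%N -> (trunc_log 2 p)%:R <= log2 (p%:R : R).
Proof.
move=> p0; have l2 : 0 < ln (2 : R) by rewrite ln_gt0 ?ltr1n.
rewrite /log2 ler_pdivlMr // mulr_natl -lnXn ?ltr0n // -natrX ler_ln ?posrE ?ltr0n ?expn_gt0 //.
by rewrite ler_nat trunc_logP.
Qed.

Lemma log2_ge1 p : (1 < p)%N -> 1 <= log2 (p%:R : R).
Proof.
move=> p1; apply: le_trans (trunc_log_le_log2 (ltnW p1)).
by rewrite ler1n trunc_log_gt0.
Qed.

End Logarithm.

(** * Iterating the recursion *)

Section Bound.

Variables (p : nat) (R : realType) (A : {set 'F_p}).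
Hypotheses (p_pr : prime p) (A0 : 0 \notin A) (A1 : 1 \in A).
Hypothesis AA : forall c x, c \in A -> (c * x \in A) = (x \in A).

Let n : R := #|A|%:R.
Let la : R := log2 p%:R.

(** 384 = 64 * 6, where 6 bounds the ratio of the number of dyadic scales to 2^k log p in
    [step_factor]. *)
Definition log_const : R := 384 * energy_const R + 8.

Lemma log_const_gt0 : 0 < log_const.
Proof. by have := energy_const_ge0 R; rewrite /log_const; lra. Qed.

Let n0 : 0 < n.
Proof. by rewrite ltr0n card_gt0; apply/set0Pn; exists 1. Qed.

(** The exponent of 2 is the increment of 3 k^2. A factor 2^k log p would do, so both powers on the
    right leave room. *)
Lemma step_factor k : 64 * energy_const R * ((trunc_log 2 p).+1 * (2 ^ k).+1).+1%:R + 8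
  <= 2 ^+ (3 * (k.+1 ^ 2 - k ^ 2)) * (log_const * la ^+ 4).
Proof.
have la1 : 1 <= la := log2_ge1 R (prime_gt1 p_pr).
have tl : (trunc_log 2 p)%:R <= la := trunc_log_le_log2 R (prime_gt0 p_pr).
have e0 := energy_const_ge0 R.
have la4 : la <= la ^+ 4 by rewrite -[leLHS]expr1 ler_weXn2l.
have m1 : 1 <= 2 ^+ k :> R by rewrite exprn_ege1 ?ler1n.
have mm : 2 ^+ k <= 2 ^+ (3 * (k.+1 ^ 2 - k ^ 2)) :> R.
  by rewrite ler_weXn2l ?ler1n //; nia.
have h : ((trunc_log 2 p).+1 * (2 ^ k).+1).+1%:R <= 6 * (2 ^+ k * la).
  rewrite -addn1 natrD natrM -addn1 natrD -[(2 ^ k).+1]addn1 natrD natrX.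
  move: (2 ^+ k) (_%:R) tl m1 => m t; nra.
have h2 : 64 * energy_const R * ((trunc_log 2 p).+1 * (2 ^ k).+1).+1%:R + 8 <= log_const * (2 ^+ k * la).
  have := ler_wpM2l (mulr_ge0 (ler0n R 64) e0) h; have : 1 <= 2 ^+ k * la by rewrite mulr_ege1.
  rewrite /log_const; move: (2 ^+ k * la) => x x1; move: (energy_const R) => e; lra.
apply: le_trans h2 _; rewrite [leRHS]mulrCA ler_wpM2l ?(ltW log_const_gt0) //.
by apply: ler_pM => //; rewrite ?exprn_ge0 //; lra.
Qed.

Lemma excess_le k : excess R A k.+1 <= 2 ^+ (3 * k.+1 ^ 2) * (log_const * la ^+ 4) ^+ k
  * n `^ ((2 ^ k.+2)%:R - (k.+1 + 7)%:R / 2) * (Tplus 2 A)%:R.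
Proof.
elim: k => [|k IHk].
  (* For a single doubling the exponent of |A| is 4 - 8/2 = 0, and the excess is at most
     [Tplus 2 A]. *)
  rewrite expr0 mulr1 (_ : _ - _ = 0) ?powRr0 ?mulr1; last first.
    rewrite (_ : (2 ^ 2)%N = 4%N) // (_ : (1 + 7)%N = 8%N) //; lra.
  rewrite /excess moment_TplusE; set t := _%:R; have t0 : 0 <= t by rewrite ler0n.
  apply: (@le_trans _ _ t); first by rewrite gerBl divr_ge0 ?exprn_ge0 ?ler0n.
  by rewrite ler_peMl // exprn_ege1 ?ler1n.
apply: le_trans (excess_step R p_pr A0 A1 AA k.+1 (ltnW (trunc_log_ltn p (isT : 1 < 2)%N))) _.
have powS : n `^ ((2 ^ k.+3)%:R - (k.+2 + 7)%:R / 2) =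
    (n ^+ (2 ^ k.+2) / Num.sqrt n) * n `^ ((2 ^ k.+2)%:R - (k.+1 + 7)%:R / 2).
  rewrite -powR12_sqrt ?ltW // -powRN -powR_mulrn ?ltW // -!powRD ?(gt_eqF n0) ?implybT //.
  congr (_ `^ _); rewrite [(2 ^ k.+3)%N]expnS natrM [in LHS]addSn -[X in X%:R / 2]addn1 natrD; lra.
have E0 : 0 <= n ^+ (2 ^ k.+2) / Num.sqrt n by rewrite divr_ge0 ?sqrtr_ge0 ?exprn_ge0 ?ltW.
rewrite powS; apply: le_trans (ler_pM _ _ (ler_wpM2r E0 (step_factor k.+1)) IHk) _.
- rewrite mulr_ge0 // addr_ge0 // !mulr_ge0 ?ler0n //; exact: energy_const_ge0.
- exact: excess_ge0.
have -> : (3 * k.+2 ^ 2 = 3 * (k.+2 ^ 2 - k.+1 ^ 2) + 3 * k.+1 ^ 2)%N.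
  by rewrite -mulnDr subnK // leq_exp2r.
rewrite exprD (exprS _ k) -/n; move: ((log_const * la ^+ 4) ^+ k) (log_const * la ^+ 4) (2 ^+ _) (2 ^+ _) (_ `^ _) (_ / Num.sqrt n) => a b c d e f.
by rewrite le_eqVlt; apply/orP; left; apply/eqP; ring.
Qed.

End Bound.

Theorem theorem3 (R : realType) :
  exists Cstar : R, 0 < Cstar /\
    forall (p : nat) (G : {group {unit 'F_p}}) (k : nat),
      prime p -> odd p -> (1 <= k)%N ->
      0 <= (Tplus (2 ^ k) (unit_set G))%:R - #|G|%:R ^+ (2 ^ k.+1) / p%:R :> R
      /\
      (Tplus (2 ^ k) (unit_set G))%:R - #|G|%:R ^+ (2 ^ k.+1) / p%:R
        <= 2 ^+ (3 * k ^ 2) * (Cstar * log2 p%:R ^+ 4) ^+ (k - 1)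
           * #|G|%:R `^ ((2 ^ k.+1)%:R - (k + 7)%:R / 2)
           * (Tplus 2 (unit_set G))%:R :> R.
Proof.
exists (log_const R); split; first exact: log_const_gt0.
move=> p G [//|k] p_pr _ _; set A := unit_set G.
have cA : #|G| = #|A| by rewrite card_imset //; exact: val_inj.
have A0 : 0 \notin A.
  by apply/imsetP => -[u _ /esym u0]; have : FinRing.uval u \is a GRing.unit := valP u; rewrite u0 unitr0.
have A1 : 1 \in A by apply/imsetP; exists 1%g; rewrite ?group1.
have AA c x : c \in A -> (c * x \in A) = (x \in A).
  move=> /imsetP[u uG ->]; apply/imsetP/imsetP => -[v vG xE]; last first.
    by exists (u * v)%g; rewrite ?groupM // xE.
  exists (u^-1 * v)%g; first by rewrite groupM ?groupV.
  by apply: (mulrI (valP u)); rewrite FinRing.val_unitM FinRing.val_unitV mulVKr ?(valP u).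
rewrite cA -moment_TplusE; split; first exact: excess_ge0.
by rewrite subSS subn0; exact: excess_le.
Qed.
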